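(* Assume that $g=e^{-\frac{1}{|z|^\alpha}}$ with $\alpha>0$, and let $L=\partial_z-ig_1(z)\partial_t$ on $\mathbb{C}\times\mathbb{R}$, where $g_1=\partial_zg$. Let $k\ge1$ be a fixed integer, and let $\zeta_0\prec\zeta_1$ be cut-off functions in a neighborhood of $0$. If $$\|\zeta_0u\|_s^2\lesssim\|(\log\Lambda)^r\zeta_1\bar Lu\|_s^2+\|(\log\Lambda)^r\zeta_1\bar z^kLu\|_s^2+\|\bar z^ku\|_{\frac12}^2$$ for smooth functions $u$, then we must have $$r\gtrsim\frac{k-(\alpha+1)}{\alpha}.$$
   Context: Coordinates on $\mathbb{C}\times\mathbb{R}\cong\mathbb{R}^3$ are $(z,\bar z,t)$, with dual variables $\xi=(\xi_z,\xi_{\bar z},\xi_t)$. $\bar L$ is the complex conjugate of $L$. $\Lambda^s$ is the pseudodifferential operator with symbol $(1+|\xi|^2)^{s/2}$, $\Lambda=\Lambda^1$, $\|u\|_s:=\|\Lambda^su\|_0$ is the $s$-Sobolev norm ($\|\cdot\|_0$ being the $L^2$ norm), and $(\log\Lambda)^r$ is the pseudodifferential operator with symbol $\left(\log(1+|\xi|^2)^{1/2}\right)^r$. For cut-off functions, $\zeta_0\prec\zeta_1$ means $\zeta_1\equiv1$ on $\operatorname{supp}\zeta_0$. The symbols $\lesssim$ and $\gtrsim$ denote inequalities up to multiplicative constants.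
   Formalization: The order s, left undeclared, is assumed to satisfy s ≥ 1/2: for a fixed s < 1/2 the term ‖z̄^k u‖_{1/2} makes the estimate hold for every r ≤ 0, however negative, so the claimed lower bound on r fails. *)

(* Defs.v *)
From mathcomp Require Import all_boot all_order all_algebra.
From mathcomp Require Import complex.
From mathcomp Require Import all_classical all_reals all_analysis.
Import Order.TTheory GRing.Theory Num.Theory.
Import numFieldNormedType.Exports.

Set Implicit Arguments.
Unset Strict Implicit.
Unset Printing Implicit Defensive.

Local Open Scope classical_set_scope.
Local Open Scope complex_scope.
Local Open Scope ring_scope.

(* A point p : R * R * R is (x, y, t), i.e. (z, t) in C x R with z = x + iy. *)
Notation R3 R := (R * R * R)%type.

Section Calculus.
Context {R : realType}.
Implicit Types (f : R3 R -> R) (u : R3 R -> R[i]) (p : R3 R).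

Definition zcoord p : R[i] := p.1.1 +i* p.1.2.

Definition ex : R3 R := (1, 0, 0).
Definition ey : R3 R := (0, 1, 0).
Definition et : R3 R := (0, 0, 1).

Fixpoint Ck (n : nat) f : Prop :=
  if n is m.+1 then
    forall e, e \in [:: ex; ey; et] ->
      (forall p, derivable f p e) /\ Ck m (fun p => 'D_e f p)
  else continuous f.

Definition smooth f := forall n, Ck n f.

Definition smoothC u :=
  smooth (fun p => complex.Re (u p)) /\ smooth (fun p => complex.Im (u p)).

Definition supp {V : nmodType} (f : R3 R -> V) : set (R3 R) :=
  closure [set p | f p != 0].

Definition test_function u := smoothC u /\ compact (supp u).

Definition cutoff f :=
  [/\ smooth f, compact (supp f), (forall p, 0 <= f p <= 1) &
      \forall p \near (0 : R3 R), f p = 1].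

Definition prec f0 f1 := forall p, supp f0 p -> f1 p = 1 :> R.

Definition partial (e : R3 R) u p : R[i] :=
  'D_e (fun q => complex.Re (u q)) p +i* 'D_e (fun q => complex.Im (u q)) p.

Definition dz u p : R[i] := (partial ex u p - 'i%C * partial ey u p) / 2.
Definition dt u p : R[i] := partial et u p.

(* The value at 0 is the continuous extension; the formula itself would give
   expR 0 = 1 there, because 0^-1 = 0. *)
Definition g (alpha : R) (z : R[i]) : R :=
  if z == 0 then 0 else expR (- (ComplexField.Normc.normc z `^ alpha)^-1).

Definition g1 (alpha : R) p : R[i] := dz (fun q => (g alpha (zcoord q))%:C) p.

Definition L (alpha : R) u p : R[i] := dz u p - 'i%C * g1 alpha p * dt u p.

Definition Lbar (alpha : R) u p : R[i] := (L alpha (fun q => (u q)^*) p)^*.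

End Calculus.

Section Sobolev.
Context {R : realType}.
Implicit Types (m : R3 R -> R) (u : R3 R -> R[i]) (xi : R3 R).

Definition leb3 :=
  ((@lebesgue_measure R \x @lebesgue_measure R) \x @lebesgue_measure R)%E.

Definition dot3 (p q : R3 R) : R :=
  p.1.1 * q.1.1 + p.1.2 * q.1.2 + p.2 * q.2.

Definition expNi (a : R) : R[i] := cos a -i* sin a.

Definition fourier u xi : R[i] :=
  (\int[leb3]_p complex.Re (u p * expNi (dot3 p xi)))
  +i* (\int[leb3]_p complex.Im (u p * expNi (dot3 p xi))).

Definition LambdaS (s : R) xi : R := (1 + dot3 xi xi) `^ (s / 2).

(* For r < 0 the symbol is singular at xi = 0, a null set. *)
Definition logLambdaS (r : R) xi : R := ln ((1 + dot3 xi xi) `^ 2^-1) `^ r.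

(* Squared L^2 norm of Op(m) u, where Op(m) is the Fourier multiplier of
   symbol m, computed on the Fourier side; it is +oo when m * fourier u is not
   in L^2.  The constant is the Plancherel constant of this Fourier transform,
   so that m = 1 gives the squared L^2 norm of u. *)
Definition multiplier_normsq m u : \bar R :=
  (((2 * pi) ^- 3)%:E *
   \int[leb3]_xi ((m xi * ComplexField.Normc.normc (fourier u xi)) ^+ 2)%:E)%E.

Definition sobolev_normsq (s : R) u : \bar R :=
  multiplier_normsq (LambdaS s) u.

Definition log_sobolev_normsq (r s : R) u : \bar R :=
  multiplier_normsq (fun xi => LambdaS s xi * logLambdaS r xi) u.

End Sobolev.

Definition log_estimate {R : realType} (alpha s r : R) (k : nat)
    (zeta0 zeta1 : R3 R -> R) : Prop :=
  exists2 C : R, 0 < C & forall u : R3 R -> R[i], test_function u ->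
    (sobolev_normsq s (fun p => ((zeta0 p)%:C * u p)%R) <=
     C%:E *
     (log_sobolev_normsq r s (fun p => ((zeta1 p)%:C * Lbar alpha u p)%R) +
      log_sobolev_normsq r s
        (fun p => ((zeta1 p)%:C * ((zcoord p)^* ^+ k * L alpha u p))%R) +
      sobolev_normsq (2^-1)%R (fun p => ((zcoord p)^* ^+ k * u p)%R)))%E.

(* Main.v *)
From HB Require Import structures.
Require Import Defs.
From mathcomp Require Import all_boot all_order all_algebra complex.
From mathcomp Require Import all_classical all_reals all_analysis.
From mathcomp Require Import measurable_realfun ring lra.
Import Order.TTheory GRing.Theory Num.Theory numFieldNormedType.Exports.

Set Implicit Arguments.
Unset Strict Implicit.
Unset Printing Implicit Defensive.

Local Open Scope classical_set_scope.
Local Open Scope complex_scope.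
Local Open Scope ring_scope.

(** The estimate is tested on functions concentrated where [|z|] is about a
    small radius [del] and oscillating in [t] at a high frequency [- tau].
    Everything is driven by one large parameter [lam]:
      [tau = exp lam],  [del = lam^(-1/alpha)],  [mu = lam / del],
    so that [g = exp (- lam) = 1 / tau] exactly on the circle [|z| = del].
    The conjugate operator annihilates [exp (- tau g (z) - i tau t)].  In the
    [z] variable this function is close to 1 inside the circle and to 0
    outside, up to a layer of width [1 / mu] around it.  The probe is the product
      [exp (- tau g (z)) * psi (x / del) * psi (y / del) * b (t)],
    where [b] is the [N]-th derivative of [chi (t) exp (- i tau t)] divided by
    [tau^N].

    On the probe [u], [Lbar u] is negligible: what remains comes either from a
    derivative of [chi], which lacks a factor [tau], or from a derivative of
    [psi], which lives where [|z|] is at least [2 del] and where [exp (- tau g)]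
    is smaller than any power of [1 / mu].  On the other hand [L u] has size
    [mu] in the layer, and [zbar^k] brings it down by [del^k].  Frequencies are
    comparable with [tau], so [Lambda^s] acts as [tau^s] and
    [(log Lambda)^r] as [lam^r].  Were this literally so, the estimate would
    give, for every [theta > 0],
      [1 <= C (lam^r mu^(1+theta) del^k + tau^(1/2-s) mu^theta del^k)^2 + o(1)].
    Since [s >= 1/2], and since [mu] and [1 / del] are the powers [1 + 1/alpha]
    and [1/alpha] of [lam], letting [lam] tend to infinity forces
    [r + 1 + 1/alpha - k/alpha >= 0], which is the claim with constant 1.

    The work is to justify the size of the norms, all computed on the Fourier
    side.  There [u] becomes [(i xi_t / tau)^N F (xi_x, xi_y, xi_t + tau)],
    with [F] the transform of a fixed profile at scale [del].  A Peetre-type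
    inequality ([peetre]) compares the symbols with [tau^s lam^r] at the cost of
    powers of [1 + |xi_t + tau|], [1 + |xi_x| / mu] and [1 + |xi_y| / mu].  The
    factor [(xi_t / tau)^N] compensates the vanishing of the logarithm at
    frequency [0] when [r < 0].  These powers are absorbed by the decay of [F].
    A derivative in [x] or [y] costs a factor [mu] but produces functions that
    are concentrated in the layer, whose [L^1] norm is smaller by [1 / (mu del)]
    ([int3_om], a bound of total variation); hence
    [|F| * |xi_x|^j <= C del mu^(j-1)] ([decay_x], [decay_y]), which is enough to
    integrate [|F|^2] with a loss of [mu^(2 theta)] only ([int_weight3]).  The
    lower bound for the left-hand side ([probe_lower]) only uses the frequencies
    where all the phases are close to 0. *)

Lemma le_eq (R : numDomainType) (x y : R) : x = y -> x <= y.
Proof. by move=> ->. Qed.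

Lemma eqC (R : rcfType) (a b : R[i]) :
  complex.Re a = complex.Re b -> complex.Im a = complex.Im b -> a = b.
Proof. by case: a b => [a1 a2] [b1 b2] /= -> ->. Qed.

(** * Smooth functions of three variables and of one variable *)

Section Derivatives.
Context {R : realType}.
Implicit Types (f g : R3 R -> R) (F G : R -> R) (p e : R3 R).

(** Directional derivatives are one-variable derivatives along lines; all the
    calculus rules below are transported through this equivalence. *)
Lemma is_derive_line f p e (t d : R) :
  is_derive (t *: e + p) e f d <-> is_derive t 1 (fun h : R => f (h *: e + p)) d.
Proof.
have E : (fun h : R => h^-1 *: (((fun h : R => f (h *: e + p)) \o shift t) (h *: (1 : R)) -
     f (t *: e + p))) = (fun h => h^-1 *: ((f \o shift (t *: e + p)) (h *: e) - f (t *: e + p))).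
  by apply/funext => h /=; rewrite scaler1 scalerDl addrA.
have E2 : 'D_1 (fun h : R => f (h *: e + p)) t = 'D_e f (t *: e + p).
  by rewrite /derive E.
split=> -[df1 df2].
  apply: DeriveDef; last by rewrite E2.
  by rewrite /derivable E.
apply: DeriveDef; last by rewrite -E2.
by move: df1; rewrite /derivable E.
Qed.

Lemma is_derive_comp1 F f p e (dF df : R) :
  is_derive p e f df -> is_derive (f p) 1 F dF ->
  is_derive p e (fun q => F (f q)) (dF * df).
Proof.
move=> Hf HF; have p0 : p = 0 *: e + p by rewrite scale0r add0r.
rewrite p0; apply/is_derive_line.
apply: (@is_derive1_comp R F (fun h : R => f (h *: e + p))); first by rewrite -p0.
by apply/is_derive_line; rewrite -p0.
Qed.

Lemma is_derive_add f g p e (df dg : R) :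
  is_derive p e f df -> is_derive p e g dg ->
  is_derive p e (fun q => f q + g q) (df + dg).
Proof. exact: is_deriveD. Qed.

Lemma is_derive_mul f g p e (df dg : R) :
  is_derive p e f df -> is_derive p e g dg ->
  is_derive p e (fun q => f q * g q) (df * g p + f p * dg).
Proof.
move=> Hf Hg; have H := is_deriveM Hf Hg.
have E : f p *: dg + g p *: df = df * g p + f p * dg.
  by rewrite addrC; congr (_ + _); rewrite /GRing.scale /= mulrC.
by rewrite E in H; exact: H.
Qed.

Lemma is_derive_scale f p e (k df : R) :
  is_derive p e f df -> is_derive p e (fun q => k * f q) (k * df).
Proof. by move=> H; exact: is_deriveZ. Qed.

Lemma smooth_cont f : smooth f -> continuous f.
Proof. by move/(_ 0%N). Qed.

Definition basis3 : seq (R3 R) := [:: ex; ey; et].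

Lemma smooth_derivable f e p : smooth f -> e \in basis3 -> derivable f p e.
Proof. by move=> sf eb; have [] := sf 1%N e eb. Qed.

Lemma smooth_derive f e : smooth f -> e \in basis3 ->
  smooth (fun p => 'D_e f p).
Proof. by move=> sf eb n; have [] := sf n.+1 e eb. Qed.

Lemma smooth_is_derive f e p : smooth f -> e \in basis3 ->
  is_derive p e f ('D_e f p).
Proof. by move=> sf eb; apply/derivableP/smooth_derivable. Qed.

(** Smoothness is an infinite tower of conditions.  It follows from membership in
    any set of continuous functions that is closed under the three partial
    derivatives; products and compositions are treated by exhibiting such a set. *)
Lemma smooth_coind (S : (R3 R -> R) -> Prop) :
  (forall f, S f -> continuous f /\ forall e, e \in basis3 ->
     exists2 g, S g & forall p, is_derive p e f (g p)) ->
  forall f, S f -> smooth f.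
Proof.
move=> H f Sf n; elim: n f Sf => [|n IH] f Sf /=; first by have [] := H f Sf.
move=> e eb; have [_ /(_ e eb)[g Sg fg]] := H f Sf; split.
  by move=> p; have := fg p; move=> [].
have -> : (fun p => 'D_e f p) = g; last exact: IH.
by apply/funext => p; have := fg p; move=> [].
Qed.

(** Products alone are not closed under differentiation, but sums of products are. *)
Inductive sprod : (R3 R -> R) -> Prop :=
| sprod_mul f g of smooth f & smooth g : sprod (fun p => f p * g p)
| sprod_add f g of sprod f & sprod g : sprod (fun p => f p + g p).

Lemma sprod_smooth f : sprod f -> smooth f.
Proof.
apply: smooth_coind => {f} f; elim=> {f} [f g sf sg|f g Sf [cf df] Sg [cg dg]].
  split.
    by move=> p; apply: cvgM; [exact: (smooth_cont sf)|exact: (smooth_cont sg)].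
  move=> e eb.
  exists (fun p => 'D_e f p * g p + f p * 'D_e g p).
    by apply: sprod_add; apply: sprod_mul => //; exact: smooth_derive.
  by move=> p; apply: is_derive_mul; exact: smooth_is_derive.
split; first by move=> p; apply: cvgD; [exact: cf|exact: cg].
move=> e eb; have [f' Sf' f'P] := df e eb; have [g' Sg' g'P] := dg e eb.
exists (fun p => f' p + g' p); first exact: sprod_add.
by move=> p; exact: is_derive_add.
Qed.

Lemma smoothM f g : smooth f -> smooth g -> smooth (fun p => f p * g p).
Proof. by move=> sf sg; apply/sprod_smooth/sprod_mul. Qed.

Lemma smooth_cst (c : R) : smooth (fun _ : R3 R => c).
Proof.
apply: (@smooth_coind (fun f => exists c, f = fun _ => c)); last by exists c.
move=> _ [{}c ->]; split; first by move=> p; exact: cvg_cst.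
move=> e _; exists (fun=> 0); first by exists 0.
by move=> p; exact: is_derive_cst.
Qed.

Lemma smoothD f g : smooth f -> smooth g -> smooth (fun p => f p + g p).
Proof.
move=> sf sg.
have -> : (fun p => f p + g p) = (fun p => f p * 1 + g p * 1).
  by apply/funext => p; rewrite !mulr1.
by apply/sprod_smooth/sprod_add; apply: sprod_mul => //; exact: smooth_cst.
Qed.

Lemma is_derive_linear (l : R3 R -> R) p e :
  (forall (h : R) q, l (h *: e + q) = h * l e + l q) -> is_derive p e l (l e).
Proof.
move=> Hl; rewrite -[p]add0r -(scale0r e); apply/is_derive_line.
under [X in is_derive _ _ X _]eq_fun do rewrite Hl.
apply: (is_derive_eq (f' := l e + 0)); last by rewrite addr0.
apply: is_deriveD.
apply: (is_derive_eq (f' := (l e) *: (1 : R))); last by rewrite scaler1.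
have -> : (fun h : R => h * l e) = (l e) \*: id by apply/funext => h /=; rewrite mulrC.
exact: is_deriveZ.
Qed.

Definition cx p : R := p.1.1.
Definition cy p : R := p.1.2.
Definition ct p : R := p.2.

Lemma is_derive_cx p e : is_derive p e cx (cx e).
Proof. by apply: is_derive_linear. Qed.
Lemma is_derive_cy p e : is_derive p e cy (cy e).
Proof. by apply: is_derive_linear. Qed.
Lemma is_derive_ct p e : is_derive p e ct (ct e).
Proof. by apply: is_derive_linear. Qed.

Lemma cont_cx : continuous cx.
Proof. by move=> [[x y] t]; apply: cvg_comp; exact: cvg_fst. Qed.
Lemma cont_cy : continuous cy.
Proof. by move=> [[x y] t]; apply: cvg_comp; [exact: cvg_fst|exact: cvg_snd]. Qed.
Lemma cont_ct : continuous ct.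
Proof. by move=> [[x y] t]; exact: cvg_snd. Qed.

Lemma smooth_coord (l : R3 R -> R) : continuous l ->
  (forall p e, is_derive p e l (l e)) -> smooth l.
Proof.
move=> cl dl.
apply: (@smooth_coind (fun f => f = l \/ smooth f)); last by left.
move=> f [->|sf].
  split=> // e eb; exists (fun=> l e) => //; right; exact: smooth_cst.
split; first exact: smooth_cont.
move=> e eb; exists (fun p => 'D_e f p).
  by right; exact: smooth_derive.
by move=> p; exact: smooth_is_derive.
Qed.

Lemma smooth_cx : smooth cx.
Proof. by apply: smooth_coord; [exact: cont_cx|exact: is_derive_cx]. Qed.
Lemma smooth_cy : smooth cy.
Proof. by apply: smooth_coord; [exact: cont_cy|exact: is_derive_cy]. Qed.
Lemma smooth_ct : smooth ct.
Proof. by apply: smooth_coord; [exact: cont_ct|exact: is_derive_ct]. Qed.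

(** A variant rather than a definition, so that unification never unfolds it. *)
Variant smooth1 F : Prop :=
  Smooth1 of forall n (x : R), derivable (F^`(n))%classic x (1 : R).

Lemma smooth1_derivable F (x : R) : smooth1 F -> derivable F x 1.
Proof. by move=> [sF]; exact: (sF 0%N x). Qed.

Lemma smooth1_derive F : smooth1 F -> smooth1 (F^`())%classic.
Proof. by move=> [sF]; split=> n x; rewrite -derive1Sn; exact: sF. Qed.

Lemma smooth1_is_derive F (x : R) : smooth1 F -> is_derive x (1 : R) F ((F^`())%classic x).
Proof. by move=> sF; rewrite derive1E; apply/derivableP/smooth1_derivable. Qed.

Lemma derivable_cont1 F : (forall x : R, derivable F x 1) -> continuous F.
Proof.
by move=> dF x; apply: differentiable_continuous; exact/derivable1_diffP.
Qed.

Lemma smooth1_cont F : smooth1 F -> continuous F.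
Proof. by move=> sF; apply: derivable_cont1 => x; exact: smooth1_derivable. Qed.

Lemma is_derive_derive1 F G : (forall x : R, is_derive x (1 : R) F (G x)) -> (F^`())%classic = G.
Proof. by move=> H; apply/funext => x; rewrite derive1E; have [] := H x. Qed.

Lemma smooth1_coind (S : (R -> R) -> Prop) :
  (forall F, S F -> exists2 G, S G & forall x : R, is_derive x (1 : R) F (G x)) ->
  forall F, S F -> smooth1 F.
Proof.
move=> H F SF; split=> n; elim: n F SF => [|n IH] F SF x.
  by rewrite derive1n0; have [G _ /(_ x)[]] := H F SF.
have [G SG FG] := H F SF.
by rewrite derive1Sn (is_derive_derive1 FG); exact: IH.
Qed.

Lemma is_derive1_mul F G (x df dg : R) :
  is_derive x (1 : R) F df -> is_derive x (1 : R) G dg ->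
  is_derive x (1 : R) (fun q => F q * G q) (df * G x + F x * dg).
Proof.
move=> Hf Hg; have H := is_deriveM Hf Hg.
have E : F x *: dg + G x *: df = df * G x + F x * dg.
  by rewrite addrC; congr (_ + _); rewrite /GRing.scale /= mulrC.
by rewrite E in H; exact: H.
Qed.

Lemma is_derive1_add F G (x df dg : R) :
  is_derive x (1 : R) F df -> is_derive x (1 : R) G dg ->
  is_derive x (1 : R) (fun q => F q + G q) (df + dg).
Proof. exact: is_deriveD. Qed.

Lemma is_derive1_scale F (x k df : R) :
  is_derive x (1 : R) F df -> is_derive x (1 : R) (fun q => k * F q) (k * df).
Proof. by move=> H; exact: is_deriveZ. Qed.

Lemma is_derive1_chain F G (x df dg : R) :
  is_derive x (1 : R) G dg -> is_derive (G x) 1 F df ->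
  is_derive x (1 : R) (fun q => F (G q)) (df * dg).
Proof.
by move=> HG HF; exact: is_derive1_comp.
Qed.

Inductive sprod1 : (R -> R) -> Prop :=
| sprod1_mul F G of smooth1 F & smooth1 G : sprod1 (fun x => F x * G x)
| sprod1_add F G of sprod1 F & sprod1 G : sprod1 (fun x => F x + G x).

Lemma sprod1_smooth F : sprod1 F -> smooth1 F.
Proof.
apply: smooth1_coind => {F} F.
elim=> {F} [F G sf sg|F G Sf [F' SF' F'P] Sg [G' SG' G'P]].
  exists (fun x => (F^`())%classic x * G x + F x * (G^`())%classic x).
    apply: sprod1_add.
      by apply: (@sprod1_mul (F^`())%classic G) => //; exact: smooth1_derive.
    by apply: (@sprod1_mul F (G^`())%classic) => //; exact: smooth1_derive.
  by move=> x; apply: is_derive1_mul; exact: smooth1_is_derive.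
exists (fun x => F' x + G' x); first exact: sprod1_add.
by move=> x; exact: is_derive1_add.
Qed.

Lemma smooth1M F G : smooth1 F -> smooth1 G -> smooth1 (fun x => F x * G x).
Proof. by move=> sf sg; apply/sprod1_smooth/(@sprod1_mul F G). Qed.

Lemma smooth1_cst (c : R) : smooth1 (fun=> c).
Proof.
apply: (@smooth1_coind (fun F => exists c, F = fun _ => c)); last by exists c.
move=> _ [{}c ->]; exists (fun=> 0); first by exists 0.
by move=> x; exact: is_derive_cst.
Qed.

Lemma smooth1D F G : smooth1 F -> smooth1 G -> smooth1 (fun x => F x + G x).
Proof.
move=> sf sg.
have -> : (fun x => F x + G x) = (fun x => F x * 1 + G x * 1).
  by apply/funext => x; rewrite !mulr1.
apply/sprod1_smooth/sprod1_add.
  by apply: (@sprod1_mul F (fun=> 1)) => //; exact: smooth1_cst.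
by apply: (@sprod1_mul G (fun=> 1)) => //; exact: smooth1_cst.
Qed.

Lemma smooth1Z F (c : R) : smooth1 F -> smooth1 (fun x => c * F x).
Proof. by apply: smooth1M; exact: smooth1_cst. Qed.

Lemma smooth1_id : smooth1 (@id R).
Proof.
apply: (@smooth1_coind (fun F => F = id \/ smooth1 F)); last by left.
move=> F [->|sf].
  exists (fun=> 1); first by right; exact: smooth1_cst.
  by move=> x; exact: is_derive_id.
exists (F^`())%classic; first by right; exact: smooth1_derive.
by move=> x; exact: smooth1_is_derive.
Qed.

Lemma smooth1_expR : smooth1 (@expR R).
Proof.
apply: (@smooth1_coind (fun F => F = expR)) => // F ->; exists expR => // x.
exact: is_derive_expR.
Qed.

(** The extra factor [H] absorbs the inner derivatives produced by the chain rule. *)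
Inductive comp1 : (R -> R) -> Prop :=
| comp1_base F G H of smooth1 F & smooth1 G & smooth1 H :
   comp1 (fun x => F (G x) * H x)
| comp1_add F G of comp1 F & comp1 G : comp1 (fun x => F x + G x).

Lemma smooth1_comp F G : smooth1 F -> smooth1 G -> smooth1 (fun x => F (G x)).
Proof.
move=> sF sG; have -> : (fun x => F (G x)) = (fun x => F (G x) * 1).
  by apply/funext => x; rewrite mulr1.
apply: (@smooth1_coind comp1); last by apply: (@comp1_base F G (fun=> 1)) => //; exact: smooth1_cst.
move=> ?; elim=> {F G sF sG} [F G H sF sG sH|F G Sf [F' SF' F'P] Sg [G' SG' G'P]].
  exists (fun x => (F^`())%classic (G x) * ((G^`())%classic x * H x) + F (G x) * (H^`())%classic x).
    apply: comp1_add.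
      apply: (@comp1_base (F^`())%classic G (fun x => (G^`())%classic x * H x)) => //.
        exact: smooth1_derive.
      by apply: smooth1M => //; exact: smooth1_derive.
    by apply: (@comp1_base F G (H^`())%classic) => //; exact: smooth1_derive.
  move=> x; rewrite mulrA; apply: is_derive1_mul; last exact: smooth1_is_derive.
  by apply: is_derive1_chain; exact: smooth1_is_derive.
exists (fun x => F' x + G' x); first exact: comp1_add.
by move=> x; exact: is_derive1_add.
Qed.

Inductive comp3 : (R3 R -> R) -> Prop :=
| comp3_base F f g of smooth1 F & smooth f & smooth g :
   comp3 (fun x => F (f x) * g x)
| comp3_add f g of comp3 f & comp3 g : comp3 (fun p => f p + g p).

Lemma smooth_comp F f : smooth1 F -> smooth f -> smooth (fun x => F (f x)).
Proof.
move=> sF sf; have -> : (fun x => F (f x)) = (fun x => F (f x) * 1).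
  by apply/funext => x; rewrite mulr1.
apply: (@smooth_coind comp3); last by apply: (@comp3_base F f (fun=> 1)) => //; exact: smooth_cst.
move=> ?; elim=> {F f sF sf} [F f g sF sf sg|f g Sf [cf df] Sg [cg dg]].
  split.
    move=> p; apply: cvgM; last exact: smooth_cont.
    by apply: continuous_comp; [exact: smooth_cont|exact: smooth1_cont].
  move=> e eb.
  exists (fun x => (F^`())%classic (f x) * ('D_e f x * g x) + F (f x) * 'D_e g x).
    apply: comp3_add.
      apply: (@comp3_base (F^`())%classic f (fun x => 'D_e f x * g x)).
      - exact: smooth1_derive.
      - exact: sf.
      by apply: smoothM => //; exact: smooth_derive.
    by apply: (@comp3_base F f (fun x => 'D_e g x)) => //; exact: smooth_derive.
  move=> x; rewrite mulrA; apply: is_derive_mul; last exact: smooth_is_derive.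
  by apply: is_derive_comp1; [exact: smooth_is_derive|exact: smooth1_is_derive].
split; first by move=> p; apply: cvgD; [exact: cf|exact: cg].
move=> e eb; have [f' Sf' f'P] := df e eb; have [g' Sg' g'P] := dg e eb.
exists (fun p => f' p + g' p); first exact: comp3_add.
by move=> p; exact: is_derive_add.
Qed.

End Derivatives.

(** * Integration over three-dimensional space *)

Section Leb2.
Context (R : realType).
Let L1 := (@lebesgue_measure R).

(** The plane measure is named so that its sigma-finiteness can be registered,
    which the iterated-integral theorems require of the first factor of [leb3]. *)
Definition leb2 := (@lebesgue_measure R \x @lebesgue_measure R)%E.
HB.instance Definition _ := Measure.on leb2.

Let leb2_sigma_finite : sigma_finite setT leb2.
Proof.
have /sigma_finiteP[F [TF ndF Foo]] := sigma_finiteT L1.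
exists (fun n => F n `*` F n).
 rewrite -setXTT {1}TF TF predeqE => -[x y]; split.
    move=> [/= [n _ Fnx] [k _ Gky]]; exists (maxn n k) => //; split.
    - by move: x Fnx; exact/subsetPset/ndF/leq_maxl.
    - by move: y Gky; exact/subsetPset/ndF/leq_maxr.
  by move=> [n _ []/= ? ?]; split; exists n.
move=> k; have [? ?] := Foo k.
split; first exact: measurableX.
by rewrite /leb2 product_measure1E// lte_mul_pinfty// ge0_fin_numE.
Qed.
HB.instance Definition _ := Measure_isSigmaFinite.Build _ _ _ leb2 leb2_sigma_finite.
End Leb2.

Section Tonelli.
Context (R : realType).

Local Notation L1 := (@lebesgue_measure R).
Local Notation L3 := (@leb3 R).
Implicit Types (p : R3 R).

(** The integral of a nonnegative function is a supremum over the simple functions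
    below it, hence monotone on arbitrary nonnegative functions; the integrands of
    the Sobolev norms can thus be compared directly with measurable weights. *)
Lemma ge0_le_int d (T : measurableType d) (mu : {measure set T -> \bar R}) (f g : T -> \bar R) :
  (forall x, 0 <= f x)%E -> (forall x, f x <= g x)%E ->
  (\int[mu]_x f x <= \int[mu]_x g x)%E.
Proof.
move=> f0 fg; have g0 x : (0 <= g x)%E by exact: le_trans (fg x).
rewrite !ge0_integralE //; apply: le_ereal_sup => _ [h hf <-]; exists h => //= x.
by apply: le_trans (hf x) _; rewrite !patch_setT.
Qed.

Lemma meas_cx : measurable_fun setT (@cx R).
Proof. exact: measurableT_comp. Qed.
Lemma meas_cy : measurable_fun setT (@cy R).
Proof. exact: measurableT_comp. Qed.
Lemma meas_ct : measurable_fun setT (@ct R).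
Proof. exact: measurable_snd. Qed.

Lemma meas_comp1 (F : R -> R) (l : R3 R -> R) : continuous F -> measurable_fun setT l ->
  measurable_fun setT (fun p => F (l p)).
Proof. by move=> cF ml; apply: measurableT_comp => //; exact: continuous_measurable_fun. Qed.

Lemma leb3E : L3 = (@leb2 R \x L1)%E. Proof. by []. Qed.

Lemma tonelli_xyt (F : R3 R -> \bar R) : measurable_fun setT F -> (forall p, 0 <= F p)%E ->
  (\int[L3]_p F p = \int[L1]_x \int[L1]_y \int[L1]_t F (x, y, t))%E.
Proof.
move=> mF F0; rewrite leb3E fubini_tonelli1 //.
apply: (@fubini_tonelli1 _ _ _ _ R L1 L1 (fubini_F L1 F)).
  exact: measurable_fun_fubini_tonelli_F.
by move=> x; apply: integral_ge0.
Qed.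

Lemma tonelli_txy (F : R3 R -> \bar R) : measurable_fun setT F -> (forall p, 0 <= F p)%E ->
  (\int[L3]_p F p = \int[L1]_t \int[L1]_x \int[L1]_y F (x, y, t))%E.
Proof.
move=> mF F0; rewrite leb3E fubini_tonelli2 //.
apply: eq_integral => t _.
apply: (@fubini_tonelli1 _ _ _ _ R L1 L1 (fun q => F (q, t))) => //.
exact/measurableT_comp.
Qed.

Lemma tonelli_tyx (F : R3 R -> \bar R) : measurable_fun setT F -> (forall p, 0 <= F p)%E ->
  (\int[L3]_p F p = \int[L1]_t \int[L1]_y \int[L1]_x F (x, y, t))%E.
Proof.
move=> mF F0; rewrite leb3E fubini_tonelli2 //.
apply: eq_integral => t _.
apply: (@fubini_tonelli2 _ _ _ _ R L1 L1 (fun q => F (q, t))) => //.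
exact/measurableT_comp.
Qed.

Lemma tonelli_prod (a b c : R -> R) :
  measurable_fun setT a -> measurable_fun setT b -> measurable_fun setT c ->
  (forall x, 0 <= a x) -> (forall x, 0 <= b x) -> (forall x, 0 <= c x) ->
  (\int[L3]_p (a (cx p) * b (cy p) * c (ct p))%:E =
   \int[L1]_x (a x)%:E * (\int[L1]_x (b x)%:E * \int[L1]_x (c x)%:E))%E.
Proof.
move=> ma mb mc a0 b0 c0.
have I0 : (0 <= \int[L1]_x (c x)%:E)%E by apply: integral_ge0 => x _; rewrite lee_fin.
have J0 : (0 <= \int[L1]_x (b x)%:E)%E by apply: integral_ge0 => x _; rewrite lee_fin.
have mE (u : R -> R) : measurable_fun setT u -> measurable_fun setT (fun x => (u x)%:E).
  by move=> mu; apply/measurable_EFinP.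
rewrite tonelli_xyt; first last.
- by move=> p; rewrite lee_fin !mulr_ge0.
- apply/measurable_EFinP; apply: measurable_funM.
    by apply: measurable_funM; apply: measurableT_comp => //; [exact: meas_cx|exact: meas_cy].
  by apply: measurableT_comp => //; exact: meas_ct.
have ZE (k : \bar R) (u : R -> R) : (0 <= k)%E -> measurable_fun setT u ->
    (forall x, 0 <= u x) ->
    (\int[L1]_x (k * (u x)%:E) = k * \int[L1]_x (u x)%:E)%E.
  move=> k0 mu u0; rewrite ge0_integralZl //; first exact: mE.
  by move=> x _; rewrite lee_fin.
transitivity (\int[L1]_x ((\int[L1]_x (b x)%:E * \int[L1]_x (c x)%:E) * (a x)%:E))%E; last first.
  by rewrite ZE ?mule_ge0 // muleC.
apply: eq_integral => x _.
transitivity (\int[L1]_y (((a x)%:E * \int[L1]_x (c x)%:E) * (b y)%:E))%E; last first.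
  by rewrite ZE ?mule_ge0 ?lee_fin // -muleA muleC; congr (_ * _)%E; exact: muleC.
apply: eq_integral => y _ /=; rewrite /cx /cy /ct /=.
transitivity (\int[L1]_t ((a x * b y)%:E * (c t)%:E))%E.
  by apply: eq_integral => t _; rewrite -EFinM.
by rewrite ZE // ?lee_fin ?mulr_ge0 // EFinM -!muleA (muleC (b y)%:E).
Qed.

End Tonelli.

(** * Functions supported in a box *)

Section Boxes.
Context (R : realType).
Local Notation L1 := (@lebesgue_measure R).
Local Notation L3 := (@leb3 R).
Implicit Types (p : R3 R) (a b : R).

(** A real-valued indicator of [[-a, a]], so that domination can be written as a
    product inequality. *)
Definition ind (a x : R) : R := (`|x| <= a)%R%:R.

Lemma ind_ge0 a x : 0 <= ind a x. Proof. exact: ler0n. Qed.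
Lemma ind_le1 a x : ind a x <= 1. Proof. by rewrite /ind lern1 leq_b1. Qed.
Lemma ind1 a x : `|x| <= a -> ind a x = 1. Proof. by rewrite /ind => ->. Qed.
Lemma ind0 a x : a < `|x| -> ind a x = 0. Proof. by rewrite /ind leNgt => ->. Qed.
Lemma ind_mono a b x : a <= b -> ind a x <= ind b x.
Proof.
move=> ab; rewrite /ind; have [xa|_] := boolP (`|x| <= a); last exact: ler0n.
by rewrite (le_trans xa ab).
Qed.

Lemma indE a : ind a = \1_(`[-a, a]).
Proof.
apply/funext => x; rewrite indicE /ind; congr (_%:R); congr nat_of_bool.
by rewrite ler_norml; apply/idP/idP => [h|]; [rewrite inE/= in_itv/= | rewrite inE/= in_itv/=].
Qed.

Lemma meas_ind a : measurable_fun setT (ind a).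
Proof. by rewrite indE; exact: measurable_indic. Qed.

Lemma integral_ind a : 0 <= a -> (\int[L1]_x (ind a x)%:E = (2 * a)%:E)%E.
Proof.
move=> a0; rewrite indE integral_indic // setIT.
apply: (etrans (lebesgue_measure_itv _)); rewrite /= lte_fin.
have [aa|aa] := ltP (- a) a; first by rewrite -EFinB; congr EFin; ring.
by congr EFin; lra.
Qed.

Definition bx (a b : R) p : R := ind a (cx p) * ind a (cy p) * ind b (ct p).

Lemma bx_ge0 a b p : 0 <= bx a b p. Proof. by rewrite !mulr_ge0 ?ind_ge0. Qed.

Lemma meas_bx a b : measurable_fun setT (bx a b).
Proof.
apply: measurable_funM; first apply: measurable_funM.
- by apply: measurableT_comp; [exact: meas_ind|exact: meas_cx].
- by apply: measurableT_comp; [exact: meas_ind|exact: meas_cy].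
- by apply: measurableT_comp; [exact: meas_ind|exact: meas_ct].
Qed.

Lemma int_bx a b : 0 <= a -> 0 <= b ->
  (\int[L3]_p (bx a b p)%:E = (8 * a ^+ 2 * b)%:E)%E.
Proof.
move=> a0 b0; rewrite tonelli_prod ?integral_ind //; try exact: meas_ind; try exact: ind_ge0.
by rewrite -!EFinM; congr EFin; ring.
Qed.

Lemma bx_mono a b a' b' p : a <= a' -> b <= b' -> bx a b p <= bx a' b' p.
Proof. by move=> aa bb; rewrite /bx !ler_pM ?mulr_ge0 ?ind_ge0 ?ind_mono. Qed.

(** The functions whose Fourier integrals can be manipulated freely: they and all
    their trigonometric multiples are integrable. *)
Definition tame (F : R3 R -> R) := measurable_fun setT F /\
  exists C a : R, [/\ 0 <= C, 0 <= a & forall p, `|F p| <= C * bx a a p].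

Lemma tame_integrable F : tame F -> L3.-integrable setT (EFin \o F).
Proof.
move=> [mF [C [a [C0 a0 FC]]]]; apply/integrableP; split; first exact/measurable_EFinP.
apply: (@le_lt_trans _ _ (\int[L3]_p (C%:E * (bx a a p)%:E))%E).
  by apply: ge0_le_int => p //=; rewrite lee_fin.
rewrite ge0_integralZl ?lee_fin //; first by rewrite int_bx // -EFinM ltry.
  by apply/measurable_EFinP; exact: meas_bx.
by move=> p _; rewrite lee_fin bx_ge0.
Qed.

Lemma tame_add F G : tame F -> tame G -> tame (fun p => F p + G p).
Proof.
move=> [mF [C [a [C0 a0 FC]]]] [mG [D [b [D0 b0 GD]]]]; split.
  exact: measurable_funD.
exists (C + D), (a + b); split; rewrite ?addr_ge0 // => p.
rewrite (le_trans (ler_normD _ _)) // mulrDl lerD //.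
  by rewrite (le_trans (FC p)) // ler_wpM2l // bx_mono // lerDl.
by rewrite (le_trans (GD p)) // ler_wpM2l // bx_mono // lerDr.
Qed.

Lemma tame_mul (F G : R3 R -> R) : tame F -> measurable_fun setT G -> (exists D : R, forall p, `|G p| <= D) ->
  tame (fun p => F p * G p).
Proof.
move=> [mF [C [a [C0 a0 FC]]]] mG [D GD]; split; first exact: measurable_funM.
have D0 : 0 <= D by exact: le_trans (GD 0).
exists (C * D), a; split; rewrite ?mulr_ge0 // => p.
by rewrite normrM mulrAC ler_pM.
Qed.

Lemma tame_mull (F G : R3 R -> R) : tame F -> measurable_fun setT G -> (exists D : R, forall p, `|G p| <= D) ->
  tame (fun p => G p * F p).
Proof.
move=> tF mG bG; rewrite (_ : (fun p => _) = (fun p => F p * G p)); first exact: tame_mul.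
by apply/funext => p; rewrite mulrC.
Qed.

Lemma tame_scale (F : R3 R -> R) (k : R) : tame F -> tame (fun p => k * F p).
Proof. by move=> tF; apply: tame_mull => //; exists `|k|. Qed.

(** The fundamental theorem of calculus between two points beyond the support. *)
Lemma int1_deriv0 (h k : R -> R) (a : R) : 0 <= a ->
  (forall x, is_derive x (1 : R) h (k x)) -> continuous k ->
  (forall x, a < `|x| -> h x = 0) -> (forall x, a < `|x| -> k x = 0) ->
  (\int[L1]_x (k x)%:E = 0)%E.
Proof.
move=> a0 hk ck h0 k0.
have ha : h (a + 1) = 0 by apply: h0; rewrite ger0_norm; lra.
have hna : h (- (a + 1)) = 0 by apply: h0; rewrite normrN ger0_norm; lra.
have ch : continuous h by apply: derivable_cont1 => x; have [] := hk x.
transitivity (\int[L1]_(x in `[(- (a + 1))%R, (a + 1)%R]) (k x)%:E)%E.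
  rewrite [RHS]integral_mkcond; apply: eq_integral => x _.
  rewrite patchE; case: ifPn => // /negP; rewrite inE /= in_itv/= -ler_norml => /negP.
  by rewrite -ltNge => xa; rewrite k0 // (lt_trans _ xa) // ltrDl.
rewrite (@continuous_FTC2 _ k h) ?ha ?hna ?subee //; first lra.
- exact: continuous_subspaceT.
- split.
  + by move=> x _; have [] := hk x.
  + by apply: cvg_at_right_filter; exact: ch.
  + by apply: cvg_at_left_filter; exact: ch.
- by move=> x _; rewrite (is_derive_derive1 hk).
Qed.

Lemma integrable2 (F : R * R -> R) C a : measurable_fun setT F -> 0 <= C -> 0 <= a ->
  (forall q, `|F q| <= C * (ind a q.1 * ind a q.2)) ->
  (@leb2 R).-integrable setT (EFin \o F).
Proof.
move=> mF C0 a0 FC; apply/integrableP; split; first exact/measurable_EFinP.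
have m1 : measurable_fun setT (fun q : R * R => (ind a q.1)).
  by apply: measurableT_comp; [exact: meas_ind|exact: measurable_fst].
have m2 : measurable_fun setT (fun q : R * R => (ind a q.2)).
  by apply: measurableT_comp; [exact: meas_ind|exact: measurable_snd].
have m3 : measurable_fun setT (fun q : R * R => ((ind a q.1 * ind a q.2)%:E)).
  by apply/measurable_EFinP; exact: measurable_funM.
have f0 (q : R * R) : (0 <= (ind a q.1 * ind a q.2)%:E)%E by rewrite lee_fin mulr_ge0 ?ind_ge0.
apply: (@le_lt_trans _ _ (\int[@leb2 R]_(q in setT) (C%:E * (ind a q.1 * ind a q.2)%:E))%E).
  by apply: ge0_le_int => p //=; rewrite lee_fin.
rewrite ge0_integralZl ?lee_fin //.
suff -> : (\int[@leb2 R]_(q in setT) (ind a q.1 * ind a q.2)%:E = (2 * a * (2 * a))%:E)%E by rewrite -EFinM ltry.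
have me (x : R) : measurable_fun setT (fun y => (ind a y)%:E) by apply/measurable_EFinP; exact: meas_ind.
apply: (etrans (@fubini_tonelli1 _ _ _ _ R L1 L1 _ m3 f0)).
transitivity (\int[L1]_x ((2 * a)%:E * (ind a x)%:E))%E.
  apply: eq_integral => x _; rewrite /fubini_F /=.
  under eq_integral do rewrite EFinM.
  rewrite ge0_integralZl ?lee_fin ?ind_ge0 //; first by rewrite integral_ind // muleC.
    exact: (me 0).
  by move=> y _; rewrite lee_fin ind_ge0.
rewrite ge0_integralZl ?lee_fin ?mulr_ge0 //; first by rewrite integral_ind // EFinM.
  exact: (me 0).
by move=> y _; rewrite lee_fin ind_ge0.
Qed.

(** Fubini reduces the claim to lines in the direction [e], where it is
    [int1_deriv0]. *)
Lemma int3_deriv0 (H K : R3 R -> R) e : e \in @basis3 R ->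
  tame K -> tame H -> (forall p, is_derive p e H (K p)) ->
  (forall p, derivable K p e) ->
  (\int[L3]_p (K p)%:E = 0)%E.
Proof.
move=> eb tK tH HK dK; have iK := tame_integrable tK.
move: tK tH => [mK [C [a [C0 a0 KC]]]] [_ [D [b [D0 b0 HD]]]].
have c0 : 0 <= a + b by rewrite addr_ge0.
have zero (G : R3 R -> R) (E c : R) : 0 <= c -> (forall p, `|G p| <= E * bx c c p) ->
    forall p, c < `|cx p| \/ c < `|cy p| \/ c < `|ct p| -> G p = 0.
  move=> _ GE p hp; apply/eqP; rewrite -normr_le0 (le_trans (GE p)) // /bx.
  by case: hp => [h|[h|h]]; rewrite (ind0 h) ?(mulr0,mul0r).
have line (l : R -> R3 R) (p0 : R3 R) : (forall h, l h = h *: e + p0) ->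
    (forall h, a + b < `|h| -> (a + b) < `|cx (l h)| \/ a + b < `|cy (l h)| \/ a + b < `|ct (l h)|) ->
    (\int[L1]_h (K (l h))%:E = 0)%E.
  move=> lE hl.
  have isd x : is_derive x (1 : R) (fun h => H (l h)) (K (l x)).
    under [X in is_derive _ _ X _]eq_fun do rewrite lE.
    by rewrite lE; apply/is_derive_line.
  apply: (int1_deriv0 c0 isd).
  - apply: derivable_cont1 => x.
    under [X in derivable X _ _]eq_fun do rewrite lE.
    have /derivableP/is_derive_line := dK (x *: e + p0).
    by move=> [].
  - move=> x /hl h; apply: (zero H D b) => //.
    by move: h => [h|[h|h]]; [left|right;left|right;right]; rewrite (le_lt_trans _ h) // lerDr.
  - move=> x /hl h; apply: (zero K C a) => //.
    by move: h => [h|[h|h]]; [left|right;left|right;right]; rewrite (le_lt_trans _ h) // lerDl.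
have i2 t : (@leb2 R).-integrable setT (EFin \o (fun q => K (q, t))).
  apply: (@integrable2 _ C a) => //.
    by apply: measurableT_comp => //; exact: measurable_pair2.
  move=> q; rewrite (le_trans (KC _)) // ler_wpM2l // /bx /cx /cy /ct /=.
  by rewrite ler_piMr ?ind_le1 // mulr_ge0 ?ind_ge0.
move: eb; rewrite !inE => /orP[/eqP E|/orP[/eqP E|/eqP E]].
- apply: (etrans (esym (@integral21_prod_meas1 _ _ _ _ R (@leb2 R) L1 (EFin \o K) iK))).
  apply: integral0_eq => t _; rewrite /fubini_G.
  apply: (etrans (esym (@integral21_prod_meas1 _ _ _ _ R L1 L1 (EFin \o (fun q => K (q, t))) (i2 t)))).
  apply: integral0_eq => y _; rewrite /fubini_G /=.
  apply: (line (fun x => (x, y, t)) (0, y, t)).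
    move=> h; rewrite E /ex; congr (_, _, _) => /=.
    - by rewrite /GRing.scale /= mulr1 addr0.
    - by rewrite /GRing.scale /= mulr0 add0r.
    - by rewrite /GRing.scale /= mulr0 add0r.
  by move=> h hh; left.
- apply: (etrans (esym (@integral21_prod_meas1 _ _ _ _ R (@leb2 R) L1 (EFin \o K) iK))).
  apply: integral0_eq => t _; rewrite /fubini_G.
  apply: (etrans (esym (@integral12_prod_meas1 _ _ _ _ R L1 L1 (EFin \o (fun q => K (q, t))) (i2 t)))).
  apply: integral0_eq => x _; rewrite /fubini_F /=.
  apply: (line (fun y => (x, y, t)) (x, 0, t)).
    move=> h; rewrite E /ey; congr (_, _, _) => /=.
    - by rewrite /GRing.scale /= mulr0 add0r.
    - by rewrite /GRing.scale /= mulr1 addr0.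
    - by rewrite /GRing.scale /= mulr0 add0r.
  by move=> h hh; right; left.
- apply: (etrans (esym (@integral12_prod_meas1 _ _ _ _ R (@leb2 R) L1 (EFin \o K) iK))).
  apply: integral0_eq => -[x y] _; rewrite /fubini_F /=.
  apply: (line (fun t => (x, y, t)) (x, y, 0)).
    move=> h; rewrite E /et; congr (_, _, _) => /=.
    - by rewrite /GRing.scale /= mulr0 add0r.
    - by rewrite /GRing.scale /= mulr0 add0r.
    - by rewrite /GRing.scale /= mulr1 addr0.
  by move=> h hh; right; right.
Qed.

End Boxes.

(** * Fourier transforms of bounded, boxed functions *)

Section Fourier.
Context (R : realType).
Local Notation L3 := (@leb3 R).
Local Notation normc := ComplexField.Normc.normc.
Implicit Types (p xi : R3 R) (F G : R3 R -> R) (u v : R3 R -> R[i]).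

Lemma dot3D (h : R) p q xi : dot3 (h *: p + q) xi = h * dot3 p xi + dot3 q xi.
Proof.
case: p => [[p1 p2] p3]; case: q => [[q1 q2] q3]; rewrite /dot3 /=.
by rewrite /GRing.scale /=; ring.
Qed.

Lemma meas_dot3 xi : measurable_fun setT (fun p => dot3 p xi).
Proof.
apply: measurable_funD; first apply: measurable_funD.
- by apply: measurable_funM => //; exact: meas_cx.
- by apply: measurable_funM => //; exact: meas_cy.
- by apply: measurable_funM => //; exact: meas_ct.
Qed.

Lemma meas_cosdot xi : measurable_fun setT (fun p => cos (dot3 p xi)).
Proof. by apply: meas_comp1 (meas_dot3 xi); exact: continuous_cos. Qed.

Lemma meas_sindot xi : measurable_fun setT (fun p => sin (dot3 p xi)).
Proof. by apply: meas_comp1 (meas_dot3 xi); exact: continuous_sin. Qed.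

Lemma tame_cos F xi : tame F -> tame (fun p => F p * cos (dot3 p xi)).
Proof.
move=> tF; apply: tame_mul => //; first exact: meas_cosdot.
by exists 1 => p; rewrite ler_norml cos_geN1 cos_le1.
Qed.

Lemma tame_sin F xi : tame F -> tame (fun p => F p * sin (dot3 p xi)).
Proof.
move=> tF; apply: tame_mul => //; first exact: meas_sindot.
by exists 1 => p; rewrite ler_norml sin_geN1 sin_le1.
Qed.

(** Up to a sign, the cosine and sine transforms are the real and imaginary parts of
    the Fourier integral of a real function. *)
Definition Fc F xi : R := \int[L3]_p (F p * cos (dot3 p xi)).
Definition Fs F xi : R := \int[L3]_p (F p * sin (dot3 p xi)).

Lemma RintD F G : tame F -> tame G ->
  \int[L3]_p (F p + G p) = \int[L3]_p F p + \int[L3]_p G p.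
Proof. by move=> tF tG; apply: RintegralD => //; exact: tame_integrable. Qed.

Lemma RintZ (k : R) F : tame F -> \int[L3]_p (k * F p) = k * \int[L3]_p F p.
Proof. by move=> tF; apply: RintegralZl => //; exact: tame_integrable. Qed.

Definition tameC u := tame (fun p => complex.Re (u p)) /\ tame (fun p => complex.Im (u p)).

Lemma fourierE u xi : tameC u -> fourier u xi =
  (Fc (fun p => complex.Re (u p)) xi + Fs (fun p => complex.Im (u p)) xi) +i*
  (Fc (fun p => complex.Im (u p)) xi - Fs (fun p => complex.Re (u p)) xi).
Proof.
move=> [ta tb]; rewrite /fourier /Fc /Fs -RintD; [|exact: tame_cos|exact: tame_sin].
rewrite -mulN1r -RintZ; last exact: tame_sin.
rewrite -RintD; [|exact: tame_cos|by apply: tame_scale; exact: tame_sin].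
by congr (_ +i* _); apply: eq_Rintegral => p _; case: (u p) => a b /=; ring.
Qed.

Lemma FcD F G xi : tame F -> tame G -> Fc (fun p => F p + G p) xi = Fc F xi + Fc G xi.
Proof.
move=> tF tG; rewrite /Fc -RintD; [|exact: tame_cos|exact: tame_cos].
by apply: eq_Rintegral => p _; rewrite mulrDl.
Qed.
Lemma FsD F G xi : tame F -> tame G -> Fs (fun p => F p + G p) xi = Fs F xi + Fs G xi.
Proof.
move=> tF tG; rewrite /Fs -RintD; [|exact: tame_sin|exact: tame_sin].
by apply: eq_Rintegral => p _; rewrite mulrDl.
Qed.
Lemma FcZ k F xi : tame F -> Fc (fun p => k * F p) xi = k * Fc F xi.
Proof.
move=> tF; rewrite /Fc -RintZ; last exact: tame_cos.
by apply: eq_Rintegral => p _; rewrite mulrA.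
Qed.
Lemma FsZ k F xi : tame F -> Fs (fun p => k * F p) xi = k * Fs F xi.
Proof.
move=> tF; rewrite /Fs -RintZ; last exact: tame_sin.
by apply: eq_Rintegral => p _; rewrite mulrA.
Qed.

Lemma tameC_add u v : tameC u -> tameC v -> tameC (fun p => u p + v p).
Proof.
move=> [a b] [c d]; split.
  rewrite (_ : (fun p => _) = fun p => complex.Re (u p) + complex.Re (v p)); first exact: tame_add.
  by apply/funext => p; case: (u p); case: (v p).
rewrite (_ : (fun p => _) = fun p => complex.Im (u p) + complex.Im (v p)); first exact: tame_add.
by apply/funext => p; case: (u p); case: (v p).
Qed.

Lemma tameC_scale (c : R[i]) u : tameC u -> tameC (fun p => c * u p).
Proof.
move=> [ta tb]; split.
  rewrite (_ : (fun p => _) = fun p => complex.Re c * complex.Re (u p) + (- complex.Im c) * complex.Im (u p)).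
    by apply: tame_add; exact: tame_scale.
  by apply/funext => p; case: (u p); case: c => * /=; ring.
rewrite (_ : (fun p => _) = fun p => complex.Re c * complex.Im (u p) + (complex.Im c) * complex.Re (u p)).
  by apply: tame_add; exact: tame_scale.
by apply/funext => p; case: (u p); case: c => * /=; ring.
Qed.

Lemma fourierD u v xi : tameC u -> tameC v ->
  fourier (fun p => u p + v p) xi = fourier u xi + fourier v xi.
Proof.
move=> tu tv; have tuv := tameC_add tu tv; rewrite !fourierE //.
have -> : (fun p => complex.Re (u p + v p)) = fun p => complex.Re (u p) + complex.Re (v p).
  by apply/funext => p; case: (u p); case: (v p).
have -> : (fun p => complex.Im (u p + v p)) = fun p => complex.Im (u p) + complex.Im (v p).
  by apply/funext => p; case: (u p); case: (v p).
case: tu tv => ? ? [? ?]; rewrite FcD // FsD // FcD // FsD //.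
by apply: eqC => /=; ring.
Qed.

Lemma fourierZ (c : R[i]) u xi : tameC u ->
  fourier (fun p => c * u p) xi = c * fourier u xi.
Proof.
move=> tu; have tuv := tameC_scale c tu; rewrite !fourierE //; case: tu => ta tb.
case: c tuv => c d _.
have -> : (fun p => complex.Re ((c +i* d) * u p)) = fun p => c * complex.Re (u p) + (- d) * complex.Im (u p).
  by apply/funext => p; case: (u p) => * /=; ring.
have -> : (fun p => complex.Im ((c +i* d) * u p)) = fun p => c * complex.Im (u p) + d * complex.Re (u p).
  by apply/funext => p; case: (u p) => * /=; ring.
have tZ k F : tame F -> tame (fun p => k * F p) by exact: tame_scale.
rewrite FcD ?FsD ?FcD ?FsD ?FcZ ?FsZ //; try exact: tZ.
by apply: eqC => /=; ring.
Qed.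

Lemma tame0 : tame (fun _ : R3 R => 0 : R).
Proof.
split; first exact: measurable_cst.
by exists 0, 0; split => // p; rewrite normr0 mul0r.
Qed.

Definition cplx F : R3 R -> R[i] := fun p => (F p)%:C%C.

Lemma tameC_real F : tame F -> tameC (cplx F).
Proof. by move=> tF; split=> //=; exact: tame0. Qed.

Lemma fourier_real F xi : tame F -> fourier (cplx F) xi = Fc F xi +i* (- Fs F xi).
Proof.
move=> tF; rewrite fourierE; last exact: tameC_real.
have F0 : Fc (fun p => complex.Im (cplx F p)) xi = 0.
  rewrite /Fc /= (@eq_Rintegral _ _ _ L3 setT (cst 0)) ?Rintegral_cst ?mul0r //.
  by move=> p _; rewrite mul0r.
have F1 : Fs (fun p => complex.Im (cplx F p)) xi = 0.
  rewrite /Fs /= (@eq_Rintegral _ _ _ L3 setT (cst 0)) ?Rintegral_cst ?mul0r //.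
  by move=> p _; rewrite mul0r.
by rewrite F0 F1 addr0 add0r.
Qed.

Lemma normc_le (a b B : R) : `|a| <= B -> `|b| <= B -> normc (a +i* b) <= 2 * B.
Proof.
move=> ha hb; have B0 : 0 <= B by exact: le_trans ha.
rewrite /normc.
rewrite -(ger0_norm (_ : 0 <= 2 * B)) ?mulr_ge0 // -sqrtr_sqr ler_wsqrtr //.
have := ler_pM (normr_ge0 a) (normr_ge0 a) ha ha.
have := ler_pM (normr_ge0 b) (normr_ge0 b) hb hb.
rewrite -!expr2 !real_normK ?num_real //; nra.
Qed.

Lemma Rint_bound F G (B : R) : tame F -> (forall p, `|F p| <= G p) ->
  (\int[L3]_p (G p)%:E <= B%:E)%E -> `|\int[L3]_p F p| <= B.
Proof.
move=> tF FG GB.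
rewrite (le_trans (le_normr_Rintegral _ (tame_integrable tF))) //.
rewrite -lee_fin; apply: le_trans GB.
rewrite /Rintegral fineK; last first.
  have /integrableP[_] := tame_integrable tF.
  rewrite ge0_fin_numE; first by [].
  by apply: integral_ge0 => p _; rewrite lee_fin.
by apply: ge0_le_int => p; rewrite lee_fin.
Qed.

Lemma fourier_bound F (B : R) xi : tame F ->
  (\int[L3]_p (`|F p|)%:E <= B%:E)%E -> normc (fourier (cplx F) xi) <= 2 * B.
Proof.
move=> tF FB; rewrite fourier_real //; apply: normc_le.
  apply: (@Rint_bound _ (fun p => `|F p|)) => //; first exact: tame_cos.
  move=> p; rewrite normrM ler_piMr // ler_norml cos_geN1 cos_le1 //.
rewrite normrN; apply: (@Rint_bound _ (fun p => `|F p|)) => //; first exact: tame_sin.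
by move=> p; rewrite normrM ler_piMr // ler_norml sin_geN1 sin_le1.
Qed.

(** Integration by parts: the integral of the derivative of [H] times a cosine or a
    sine vanishes by [int3_deriv0]. *)
Lemma fourier_deriv H K e xi : e \in @basis3 R -> tame H -> tame K ->
  (forall p, is_derive p e H (K p)) -> (forall p, derivable K p e) ->
  fourier (cplx K) xi = ('i%C * (dot3 e xi)%:C%C) * fourier (cplx H) xi.
Proof.
move=> eb tH tK HK dK.
set d := dot3 e xi.
have dd p : is_derive p e (fun q => dot3 q xi) d.
  by apply: is_derive_linear => h q; rewrite dot3D.
have dc p : is_derive p e (fun q => cos (dot3 q xi)) (- sin (dot3 p xi) * d).
  exact: (is_derive_comp1 (dd p) (is_derive_cos _)).
have ds p : is_derive p e (fun q => sin (dot3 q xi)) (cos (dot3 p xi) * d).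
  exact: (is_derive_comp1 (dd p) (is_derive_sin _)).
have dK' p : is_derive p e K ('D_e K p) by apply/derivableP.
have E1 : Fc K xi = d * Fs H xi.
  have : (\int[L3]_p ((K p * cos (dot3 p xi)) + H p * (- sin (dot3 p xi) * d))%:E = 0)%E.
    have h1 : tame (fun p => K p * cos (dot3 p xi) + H p * (- sin (dot3 p xi) * d)).
      apply: tame_add; first exact: tame_cos.
      rewrite (_ : (fun p => _) = fun p => (- d) * (H p * sin (dot3 p xi))).
        by apply: tame_scale; exact: tame_sin.
      by apply/funext => p; ring.
    have h2 : tame (fun p => H p * cos (dot3 p xi)) by exact: tame_cos.
    have h3 p : is_derive p e (fun p => H p * cos (dot3 p xi))
        (K p * cos (dot3 p xi) + H p * (- sin (dot3 p xi) * d)).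
      exact: (is_derive_mul (HK p) (dc p)).
    have h4 p : derivable (fun p => K p * cos (dot3 p xi) + H p * (- sin (dot3 p xi) * d)) p e.
      have [h _] := is_derive_add (is_derive_mul (dK' p) (dc p))
        (is_derive_mul (HK p) (is_derive_scale (- d) (ds p))).
      rewrite (_ : (fun p => _) = (fun q => K q * cos (dot3 q xi) + H q * ((- d) * sin (dot3 q xi)))) //.
      by apply/funext => q; ring.
    exact: (int3_deriv0 eb h1 h2 h3 h4).
  move=> /(congr1 fine) /= I0; rewrite /Fc /Fs -RintZ; last exact: tame_sin.
  apply/eqP; rewrite -subr_eq0 -mulN1r -RintZ; last by apply: tame_scale; exact: tame_sin.
  rewrite -RintD; [|exact: tame_cos|by do 2 apply: tame_scale; exact: tame_sin].
  by apply/eqP; rewrite -[RHS]I0; congr fine; apply: eq_integral => p _; congr EFin; ring.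
have E2 : Fs K xi = - d * Fc H xi.
  have : (\int[L3]_p ((K p * sin (dot3 p xi)) + H p * (cos (dot3 p xi) * d))%:E = 0)%E.
    have h1 : tame (fun p => K p * sin (dot3 p xi) + H p * (cos (dot3 p xi) * d)).
      apply: tame_add; first exact: tame_sin.
      rewrite (_ : (fun p => _) = fun p => (d) * (H p * cos (dot3 p xi))).
        by apply: tame_scale; exact: tame_cos.
      by apply/funext => p; ring.
    have h2 : tame (fun p => H p * sin (dot3 p xi)) by exact: tame_sin.
    have h3 p : is_derive p e (fun p => H p * sin (dot3 p xi))
        (K p * sin (dot3 p xi) + H p * (cos (dot3 p xi) * d)).
      exact: (is_derive_mul (HK p) (ds p)).
    have h4 p : derivable (fun p => K p * sin (dot3 p xi) + H p * (cos (dot3 p xi) * d)) p e.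
      have [h _] := is_derive_add (is_derive_mul (dK' p) (ds p))
        (is_derive_mul (HK p) (is_derive_scale (d) (dc p))).
      rewrite (_ : (fun p => _) = (fun q => K q * sin (dot3 q xi) + H q * ((d) * cos (dot3 q xi)))) //.
      by apply/funext => q; ring.
    exact: (int3_deriv0 eb h1 h2 h3 h4).
  move=> /(congr1 fine) /= I0; rewrite /Fc /Fs -RintZ; last exact: tame_cos.
  apply/eqP; rewrite -subr_eq0 -mulN1r -RintZ; last by apply: tame_scale; exact: tame_cos.
  rewrite -RintD; [|exact: tame_sin|by do 2 apply: tame_scale; exact: tame_cos].
  by apply/eqP; rewrite -[RHS]I0; congr fine; apply: eq_integral => p _; congr EFin; ring.
rewrite !fourier_real // E1 E2.
by apply: eqC => /=; ring.
Qed.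

Definition shift_t (tau : R) xi : R3 R := (xi.1.1, xi.1.2, xi.2 + tau).

Lemma expNiD (a b : R) : expNi a * expNi b = expNi (a + b).
Proof.
by rewrite /expNi cosD sinD; apply: eqC => /=; ring.
Qed.

(** Modulation in [t] by the frequency [- tau] is translation by [tau] of the
    transform. *)
Lemma fourier_shift F tau xi :
  fourier (fun p => (F p)%:C%C * expNi (tau * ct p)) xi = fourier (cplx F) (shift_t tau xi).
Proof.
have E p : (F p)%:C%C * expNi (tau * ct p) * expNi (dot3 p xi) =
           (cplx F p) * expNi (dot3 p (shift_t tau xi)).
  rewrite -mulrA expNiD; congr (_ * expNi _); rewrite /dot3 /shift_t /ct /=; ring.
by rewrite /fourier; congr (_ +i* _); apply: eq_Rintegral => p _; rewrite E.
Qed.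

End Fourier.

(** * Functions flat at the origin *)

Section Flat.
Context (R : realType) (alpha : R).
Hypothesis alpha0 : 0 < alpha.
Implicit Types (x b : R) (m n : nat).

(** With [x = |z|^2] this is [1 / |z|^alpha]. *)
Definition Sp x : R := expR (- (alpha / 2) * ln x).

Lemma Sp_gt0 x : 0 < Sp x. Proof. exact: expR_gt0. Qed.

Lemma is_derive_Sp x : 0 < x -> is_derive x (1 : R) Sp (Sp x * (- (alpha / 2) * x^-1)).
Proof.
move=> x0.
exact: (is_derive1_chain (is_derive1_scale (- (alpha / 2)) (is_derive1_ln x0)) (is_derive_expR _)).
Qed.

(** The functions [x^-m S^n exp (- b S)] with [S = x^(-alpha/2)], extended by 0 to
    [x <= 0].  With [b > 0] the exponential beats any power at the origin, so they
    are bounded near 0, smooth, and stable under differentiation up to linear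
    combinations; [fl 0 0 1] at [|z|^2] is the function [g]. *)
Definition fl m n b x : R :=
  if 0 < x then x^-1 ^+ m * Sp x ^+ n * expR (- b * Sp x) else 0.

Lemma fl_pos m n b x : 0 < x -> fl m n b x = x^-1 ^+ m * Sp x ^+ n * expR (- b * Sp x).
Proof. by rewrite /fl => ->. Qed.

Lemma fl_neg m n b x : x <= 0 -> fl m n b x = 0.
Proof. by rewrite /fl ltNge => ->. Qed.

Lemma fl_expE m n b x : 0 < x -> fl m n b x =
  expR (- m%:R * ln x + - (n%:R * (alpha / 2)) * ln x + - b * Sp x).
Proof.
move=> x0; rewrite (fl_pos m n b x0) {1}/Sp -expRM_natl -{1}(lnK x0) -expRN -expRM_natl -!expRD.
by congr expR; ring.
Qed.

Lemma fl_ge0 m n b x : 0 <= fl m n b x.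
Proof.
rewrite /fl; case: ifPn => // x0.
by rewrite !mulr_ge0 ?exprn_ge0 ?invr_ge0 ?(ltW x0) ?expR_ge0 ?(ltW (Sp_gt0 _)).
Qed.

Lemma expR_ge_sqr (y : R) : 0 <= y -> y ^+ 2 / 2 <= expR y.
Proof.
by move=> y0; have := expR_ge1Dxn 1 y0; rewrite /factorial /=; lra.
Qed.

(** In the variable [y = - ln x >= 0] the exponent is at most a linear function of
    [y] minus a positive multiple of [y^2], because [exp v >= v^2 / 2]. *)
Lemma fl_bound m n b : 0 < b -> exists2 C, 0 <= C & forall x, x <= 1 -> fl m n b x <= C.
Proof.
move=> b0.
pose k := b * (alpha / 2) ^+ 2 / 2.
have k0 : 0 < k by rewrite /k divr_gt0 // mulr_gt0 // exprn_gt0 // divr_gt0.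
pose c : R := m%:R + n%:R * (alpha / 2).
(* The maximum of [c * y - k * y^2]. *)
exists (expR (c ^+ 2 / (4 * k))); first exact: expR_ge0.
move=> x x1; rewrite /fl; case: ifPn => [x0|_]; last exact: expR_ge0.
have L0 : 0 <= - ln x by rewrite oppr_ge0 ln_le0.
rewrite -(fl_pos m n b x0) (fl_expE m n b x0) ler_expR /Sp.
have := @expR_ge_sqr (- (alpha / 2) * ln x).
have -> : - (alpha / 2) * ln x = alpha / 2 * (- ln x) by ring.
set y := - ln x; have a20 : 0 < alpha / 2 by rewrite divr_gt0.
move=> /(_ (mulr_ge0 (ltW a20) L0)).
set E := expR _ => hE.
apply: (@le_trans _ _ (c * y - k * y ^+ 2)).
  have : b * ((alpha / 2 * y) ^+ 2 / 2) <= b * E by rewrite ler_wpM2l // ltW.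
  have lnE : ln x = - y by rewrite /y opprK.
  rewrite /c /k lnE => h2.
  rewrite (_ : _ * y ^+ 2 = b * ((alpha / 2 * y) ^+ 2 / 2)); last by field.
  lra.
rewrite ler_pdivlMr; last by rewrite mulr_gt0.
have := sqr_ge0 (2 * k * y - c); nra.
Qed.

Lemma flS m n b x : fl m n b x = x * fl m.+1 n b x.
Proof.
rewrite /fl; case: ifPn => x0; last by rewrite mulr0.
by rewrite exprS !mulrA divff ?mul1r // gt_eqF.
Qed.

(** A function bounded by a square near 0 has derivative 0 there. *)
Lemma is_derive_flat0 (F : R -> R) C : F 0 = 0 ->
  (forall h, `|h| <= 1 -> `|F h| <= C * h ^+ 2) -> is_derive (0 : R) (1 : R) F 0.
Proof.
move=> F0 FC.
have C0 : 0 <= C.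
  have := FC 1; rewrite normr1 expr1n mulr1 => /(_ (lexx _)); exact: le_trans.
have lim : (fun h : R => h^-1 *: ((F \o shift 0) (h *: (1 : R)) - F 0)) @ 0^' --> (0 : R).
  apply/cvgrPdist_le => e e0; near=> h.
  rewrite /= sub0r normrN F0 subr0 addr0 /GRing.scale /= mulr1 normrM normfV.
  have h0 : h != 0 by near: h; exact: nbhs_dnbhs_neq.
  have h1 : `|h| < Num.min 1 (e / (C + 1)).
    near: h; apply: dnbhs0_lt; rewrite lt_min ltr01 divr_gt0 // ltr_wpDl //.
  move: h1; rewrite lt_min => /andP[h1 h2].
  rewrite mulrC ler_pdivrMr ?normr_gt0 //.
  rewrite (le_trans (FC _ (ltW h1))) // -real_normK ?num_real // expr2 mulrA.
  rewrite ler_wpM2r //.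
  have : (C + 1) * `|h| <= e.
    by rewrite mulrC -ler_pdivlMr ?(ltW h2) // ltr_wpDl.
  have := normr_ge0 h; nra.
apply: DeriveDef; first by apply/cvg_ex; exists 0.
exact/cvg_lim.
Unshelve. all: by end_near.
Qed.

Definition dfl m n b x : R :=
  - (m%:R + n%:R * (alpha / 2)) * fl m.+1 n b x + (b * (alpha / 2)) * fl m.+1 n.+1 b x.

(** At 0 the bound [fl m n b x <= C x^2] comes from pulling out two powers of [x]. *)
Lemma is_derive_fl m n b x : 0 < b -> is_derive x (1 : R) (fl m n b) (dfl m n b x).
Proof.
move=> b0; have [x0|x0|->] := ltgtP x 0.
- rewrite /dfl !fl_neg ?ltW // !mulr0 addr0.
  apply: (near_eq_is_derive _ (is_derive_cst (0 : R) x (1 : R))).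
  near=> y; rewrite fl_neg //; apply/ltW; near: y; exact: lt_nbhsl.
- have D1 := is_derive1_add (is_derive1_add (is_derive1_scale (- m%:R) (is_derive1_ln x0))
     (is_derive1_scale (- (n%:R * (alpha / 2))) (is_derive1_ln x0)))
     (is_derive1_scale (- b) (is_derive_Sp x0)).
  have D2 := is_derive1_chain D1 (is_derive_expR _).
  rewrite -(fl_expE m n b x0) in D2.
  have E : dfl m n b x = fl m n b x *
     (- m%:R * x^-1 + - (n%:R * (alpha / 2)) * x^-1 + - b * (Sp x * (- (alpha / 2) * x^-1))).
    by rewrite /dfl !fl_pos // !exprS; ring.
  rewrite -E in D2; apply: (near_eq_is_derive _ D2).
  near=> y; rewrite -fl_expE // -oppr_lt0; near: y.
  by apply: Nlt_nbhsl; rewrite oppr_lt0.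
- have [C C0 HC] := @fl_bound m.+2 n b b0.
  rewrite /dfl !fl_neg // !mulr0 addr0.
  apply: (@is_derive_flat0 _ C); first by rewrite fl_neg.
  move=> h h1; rewrite ger0_norm ?fl_ge0 // flS flS mulrA -expr2 mulrC ler_wpM2r ?sqr_ge0 //.
  by rewrite HC // (le_trans (ler_norm _)).
Unshelve. all: by end_near.
Qed.

Inductive flspan : (R -> R) -> Prop :=
| flspan_fl m n b of 0 < b : flspan (fl m n b)
| flspan_add F G of flspan F & flspan G : flspan (fun x => F x + G x)
| flspan_scale k F of flspan F : flspan (fun x => k * F x).

(** The span of the functions [fl] with positive exponent is closed under
    differentiation. *)
Lemma smooth1_fl m n b : 0 < b -> smooth1 (fl m n b).
Proof.
move=> b0; apply: (@smooth1_coind R flspan); last exact: flspan_fl.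
move=> F; elim=> {F m n b b0} [m n b b0|F G _ [F' SF dF] _ [G' SG dG]|k F _ [F' SF dF]].
- exists (dfl m n b); last by move=> x; exact: is_derive_fl.
  apply: (@flspan_add (fun x => _ * fl m.+1 n b x) (fun x => _ * fl m.+1 n.+1 b x)).
    by apply: (@flspan_scale _ (fl m.+1 n b)); exact: flspan_fl.
  by apply: (@flspan_scale _ (fl m.+1 n.+1 b)); exact: flspan_fl.
- exists (fun x => F' x + G' x); first exact: (@flspan_add F' G').
  by move=> x; exact: is_derive1_add (dF x) (dG x).
- exists (fun x => k * F' x); first exact: (@flspan_scale k F').
  by move=> x; exact: is_derive1_scale (dF x).
Qed.

Lemma fl_mul m n b m' n' b' x : fl m n b x * fl m' n' b' x = fl (m + m') (n + n') (b + b') x.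
Proof.
have [x0|x0] := ltP 0 x; last by rewrite !fl_neg // mulr0.
by rewrite !fl_pos // !exprD opprD mulrDl expRD; ring.
Qed.

End Flat.

(** * The radial profile exp(- tau g) at the critical scale *)

Section Theta.
Context (R : realType) (alpha : R).
Hypothesis alpha0 : 0 < alpha.
Implicit Types (x lam : R) (i m n : nat).
Local Notation Sp := (Sp alpha).
Local Notation fl := (fl alpha).

(** The radius of the circle where [g] equals [exp (- lam)]. *)
Definition del lam : R := expR (- (ln lam / alpha)).

(** The inverse width of the layer around [|z| = del] across which [tau g] passes
    from small to large values. *)
Definition mu lam : R := lam / del lam.

(** The frequency in [t], chosen so that [tau g = 1] on the circle [|z| = del]. *)
Definition tau lam : R := expR lam.

Lemma delE lam : del lam = expR (- (ln lam / alpha)). Proof. by []. Qed.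
Lemma muE lam : mu lam = lam / del lam. Proof. by []. Qed.
Lemma tauE lam : tau lam = expR lam. Proof. by []. Qed.

Lemma del_gt0 lam : 0 < del lam. Proof. exact: expR_gt0. Qed.
Lemma del_neq0 lam : del lam != 0. Proof. by rewrite gt_eqF // del_gt0. Qed.
Lemma del_le1 lam : 1 <= lam -> del lam <= 1.
Proof. by move=> l1; rewrite -expR0 ler_expR oppr_le0 divr_ge0 ?ln_ge0 // ltW. Qed.
Lemma tau_gt0 lam : 0 < tau lam. Proof. exact: expR_gt0. Qed.
Lemma tau_ge1 lam : 1 <= lam -> 1 <= tau lam.
Proof. by move=> l1; rewrite -expR0 ler_expR (le_trans _ l1). Qed.
Lemma mu_gt0 lam : 1 <= lam -> 0 < mu lam.
Proof. by move=> l1; rewrite divr_gt0 ?del_gt0 // (lt_le_trans _ l1). Qed.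
Lemma mu_ge lam : 1 <= lam -> lam <= mu lam.
Proof.
move=> l1; rewrite ler_pdivlMr ?del_gt0 // ler_piMr ?del_le1 //.
exact: le_trans l1.
Qed.
Lemma mu_ge1 lam : 1 <= lam -> 1 <= mu lam.
Proof. by move=> l1; rewrite (le_trans l1) // mu_ge. Qed.

(** This homogeneity is the reason for the choice of [del]. *)
Lemma Sp_scale lam s : 0 < lam -> 0 < s -> Sp (del lam ^+ 2 * s) = lam * Sp s.
Proof.
move=> l0 s0; have d0 := del_gt0 lam.
rewrite /Sp lnM ?posrE ?exprn_gt0 // lnXn // /del expRK mulrDr expRD.
congr (_ * _); rewrite -[RHS](lnK l0); congr expR.
by rewrite mulr2n; field; rewrite gt_eqF.
Qed.

(** At [x = |z|^2] this is [exp (- tau g (z))]. *)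
Definition E lam x : R := expR (- tau lam * fl 0 0 1 x).

Lemma E_gt0 lam x : 0 < E lam x. Proof. exact: expR_gt0. Qed.
Lemma E_le1 lam x : E lam x <= 1.
Proof. by rewrite -expR0 ler_expR mulNr oppr_le0 mulr_ge0 ?fl_ge0 ?ltW ?tau_gt0. Qed.

(** With [S = x^(-alpha/2)] and [h = tau exp (- S)] this is
    [(del^2 / x)^m (S / lam)^n h^i exp (- h)]: every factor is of order one in the
    layer, and these functions are stable under [del^2 * d/dx] up to factors of
    size [lam]. *)
Definition th i m n lam x : R :=
  (del lam ^+ 2) ^+ m * lam^-1 ^+ n * tau lam ^+ i *
  (if i is 0 then 1 else fl m n i%:R x) * E lam x.

(** Without a factor [h], which is flat at the origin, negative powers of [x] would
    be unbounded there. *)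
Definition admissible i m n := (i == 0)%N ==> (m == 0)%N && (n == 0)%N.

Lemma is_derive_E lam x :
  is_derive x (1 : R) (E lam) (E lam x * (- tau lam * (alpha / 2 * fl 1 1 1 x))).
Proof.
have D := is_derive1_chain (is_derive1_scale (- tau lam) (@is_derive_fl R alpha alpha0 0 0 1 x ltr01)) (is_derive_expR _).
apply: is_derive_eq D _; congr (_ * (_ * _)).
by rewrite /dfl !mul0r addr0 oppr0 mul0r add0r mul1r.
Qed.

Lemma is_derive_th i m n lam x : 0 < lam -> admissible i m n ->
  is_derive x (1 : R) (th i m n lam)
   ((del lam ^+ 2)^-1 * (- (m%:R + n%:R * (alpha / 2)) * th i m.+1 n lam x
     + lam * (i%:R * (alpha / 2)) * th i m.+1 n.+1 lam x
     - lam * (alpha / 2) * th i.+1 m.+1 n.+1 lam x)).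
Proof.
move=> l0; have d0 := del_neq0 lam; have l0' : lam != 0 by rewrite gt_eqF.
case: i => [|i] /=.
  move=> /andP[/eqP -> /eqP ->].
  have D := is_derive1_scale ((del lam ^+ 2) ^+ 0 * lam^-1 ^+ 0 * tau lam ^+ 0 * 1) (is_derive_E lam x).
  apply: is_derive_eq D _; rewrite /th /=.
  by rewrite !expr0 !expr1; field; rewrite l0' d0.
move=> _; set c := (del lam ^+ 2) ^+ m * lam^-1 ^+ n * tau lam ^+ i.+1.
have D := is_derive1_mul (is_derive1_scale c (@is_derive_fl R alpha alpha0 m n i.+1%:R x (ltr0Sn _ _))) (is_derive_E lam x).
apply: is_derive_eq D _.
have -> : c * dfl alpha m n i.+1%:R x * E lam x + c * fl m n i.+1%:R x *
    (E lam x * (- tau lam * (alpha / 2 * fl 1 1 1 x))) =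
  c * dfl alpha m n i.+1%:R x * E lam x + - (alpha / 2) * c * tau lam * E lam x * (fl m n i.+1%:R x * fl 1 1 1 x).
  by ring.
rewrite fl_mul /th /dfl /c /= !addn1 (_ : i.+1%:R + 1 = i.+2%:R); last by rewrite natr1.
rewrite !exprS !exprVn; field.
by rewrite d0 l0' expf_neq0.
Qed.

Lemma smooth1_E lam : smooth1 (E lam).
Proof.
apply: (@smooth1_comp R expR (fun x => - tau lam * fl 0 0 1 x)); first exact: smooth1_expR.
by apply: smooth1Z; exact: smooth1_fl.
Qed.

Lemma cont_th i m n lam : continuous (th i m n lam).
Proof.
apply: smooth1_cont.
apply: (@smooth1M R (fun x => _ * (if i is 0 then 1 else fl m n i%:R x))); last exact: smooth1_E.
apply: smooth1Z; case: i => [|i]; first exact: smooth1_cst.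
exact: smooth1_fl.
Qed.

(** The value of [h = tau g] in the rescaled variable [s = |z|^2 / del^2]. *)
Definition hh lam s : R := expR (lam * (1 - Sp s)).

Lemma tau_fl lam s : 0 < lam -> 0 < s -> tau lam * fl 0 0 1 (del lam ^+ 2 * s) = hh lam s.
Proof.
move=> l0 s0; rewrite fl_pos ?mulr_gt0 ?exprn_gt0 ?del_gt0 // Sp_scale //.
by rewrite !expr0 !mul1r mulN1r /tau -expRD; congr expR; ring.
Qed.

Lemma thE i m n lam s : 0 < lam -> 0 < s -> admissible i m n ->
  th i m n lam (del lam ^+ 2 * s) = s^-1 ^+ m * Sp s ^+ n * hh lam s ^+ i * expR (- hh lam s).
Proof.
move=> l0 s0; have d0 := del_neq0 lam; have l0' : lam != 0 by rewrite gt_eqF.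
have s0' : s != 0 by rewrite gt_eqF.
rewrite /th /E mulNr tau_fl // => oki; congr (_ * _).
case: i oki => [/andP[/eqP-> /eqP->]|i _]; first by rewrite !expr0 !mulr1.
rewrite fl_pos ?mulr_gt0 ?exprn_gt0 ?del_gt0 // Sp_scale // /hh /tau.
have -> : expR lam ^+ i.+1 = expR (i.+1%:R * lam) by rewrite expRM_natl.
have -> : expR (lam * (1 - Sp s)) ^+ i.+1 = expR (i.+1%:R * lam) * expR (- i.+1%:R * (lam * Sp s)).
  by rewrite -expRM_natl -expRD; congr expR; ring.
have : del lam ^+ 2 != 0 by rewrite expf_neq0.
move: (del lam ^+ 2) => D2 D20.
rewrite invfM !exprMn !exprVn; field.
by rewrite !expf_neq0.
Qed.

(** With [h = tau g] this is [sqrt h / (1 + sqrt h)^2], a bump of height 1/4 over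
    the layer where [h] is of order one.  It is chosen because it is comparable
    with the derivative of [1 / (1 + sqrt h)], so that its integral is a total
    variation. *)
Definition om lam x : R :=
  expR (lam / 2) * fl 0 0 2^-1 x / (1 + expR (lam / 2) * fl 0 0 2^-1 x) ^+ 2.

Lemma omE lam x : om lam x =
  expR (lam / 2) * fl 0 0 2^-1 x / (1 + expR (lam / 2) * fl 0 0 2^-1 x) ^+ 2.
Proof. by []. Qed.

Lemma om_ge0 lam x : 0 <= om lam x.
Proof. by rewrite /om divr_ge0 ?sqr_ge0 // mulr_ge0 ?expR_ge0 ?fl_ge0. Qed.

Lemma om_le1 lam x : om lam x <= 1.
Proof.
rewrite /om; set y := _ * fl _ _ _ _.
have y0 : 0 <= y by rewrite mulr_ge0 ?expR_ge0 ?fl_ge0.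
rewrite ler_pdivrMr; last by rewrite exprn_gt0 // ltr_pwDl.
by rewrite mul1r; nra.
Qed.

(** The square root of [h]. *)
Definition h2 lam s : R := expR (lam / 2 * (1 - Sp s)).

Lemma h2E lam s : 0 < lam -> 0 < s -> expR (lam / 2) * fl 0 0 2^-1 (del lam ^+ 2 * s) = h2 lam s.
Proof.
move=> l0 s0; rewrite fl_pos ?mulr_gt0 ?exprn_gt0 ?del_gt0 // Sp_scale //.
by rewrite !expr0 !mul1r -expRD /h2; congr expR; field.
Qed.

Lemma h2_sqr lam s : h2 lam s ^+ 2 = hh lam s.
Proof. by rewrite /h2 -expRM_natl /hh; congr expR; field. Qed.

Lemma Sp1 : Sp 1 = 1. Proof. by rewrite /Sp ln1 mulr0 expR0. Qed.

Lemma Sp_anti s t : 0 < s -> s <= t -> Sp t <= Sp s.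
Proof.
move=> s0 st; have a20 : 0 < alpha / 2 by rewrite divr_gt0.
rewrite /Sp ler_expR !mulNr lerN2 ler_wpM2l ?(ltW a20) //.
by rewrite ler_ln // posrE // (lt_le_trans s0).
Qed.

Lemma pow_exp_le i (y : R) : 0 <= y -> y ^+ i.+1 * expR (- y) <= (i.+1)`!%:R.
Proof.
move=> y0; rewrite expRN ler_pdivrMr ?expR_gt0 //.
have := expR_ge1Dxn i y0; have f0 : (0 : R) < (i.+1)`!%:R by rewrite ltr0n fact_gt0.
move=> h; rewrite mulrC -ler_pdivrMr //; apply: le_trans h; lra.
Qed.

(** Outside the circle, powers of [h] are absorbed by [exp (- h)], and one power of
    [1 / h] remains. *)
Lemma th_large i m n lam s : 0 < lam -> 1 <= s -> admissible i m n ->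
  th i m n lam (del lam ^+ 2 * s) <= (i.+1)`!%:R / hh lam s.
Proof.
move=> l0 s1 oki; have s0 : 0 < s by rewrite (lt_le_trans _ s1).
rewrite thE //; set h := hh lam s; have h0 : 0 < h by exact: expR_gt0.
have Ss : Sp s <= 1 by rewrite -Sp1 Sp_anti.
have S0 : 0 <= Sp s by rewrite ltW // Sp_gt0.
have P1 : s^-1 ^+ m * Sp s ^+ n <= 1.
  by rewrite mulr_ile1 ?exprn_ge0 ?invr_ge0 ?(ltW s0) // exprn_ile1 ?invr_ge0 ?(ltW s0) // invf_le1.
rewrite ler_pdivlMr //.
apply: le_trans (pow_exp_le i (ltW h0)).
rewrite exprSr -!mulrA -[leRHS]mul1r mulrA ler_pM //.
- by rewrite mulr_ge0 ?exprn_ge0 // invr_ge0 ltW.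
- by rewrite !mulr_ge0 ?exprn_ge0 ?expR_ge0 // ltW.
- by rewrite ler_wpM2l ?exprn_ge0 ?(ltW h0) // mulrC.
Qed.

Lemma th_ge0 i m n lam x : 0 < lam -> 0 <= th i m n lam x.
Proof.
move=> l0; rewrite /th; apply: mulr_ge0; last exact/ltW/E_gt0.
apply: mulr_ge0; last by case: i => // i; exact: fl_ge0.
apply: mulr_ge0; last exact/exprn_ge0/ltW/tau_gt0.
by apply: mulr_ge0; apply: exprn_ge0; rewrite ?sqr_ge0 // invr_ge0 ltW.
Qed.

(** With [h = tau g]: outside the circle [h >= 1], and the bound is [th_large],
    since [1 / h] is at most [4 * om].  Inside, [h <= 1] and the power of [h] is at
    most [sqrt h * sqrt h]; one factor controls the singular powers of [x], through
    the flatness estimate [fl_bound], and the other is at most [4 * om]. *)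
Lemma th_flat i m n : exists2 C, 0 <= C & forall lam x, 1 <= lam ->
  th i.+1 m n lam x <= C * om lam x.
Proof.
have h20 : (0 : R) < 2^-1 by rewrite invr_gt0.
have [C C0 HC] := fl_bound alpha0 m n h20.
have hC : 0 <= expR (2^-1 : R) * C by rewrite mulr_ge0 ?expR_ge0.
exists (4 * (expR (2^-1) * C + (i.+2)`!%:R)); first by rewrite mulr_ge0 ?addr_ge0 // ler0n.
move=> lam x l1; have l0 : 0 < lam by exact: lt_le_trans l1.
have [x0|x0] := ltP 0 x; last first.
  rewrite /th /om !fl_neg // !mulr0 !mul0r mulr0 //.
have d0 := del_gt0 lam.
pose s := x / del lam ^+ 2.
have s0 : 0 < s by rewrite divr_gt0 // exprn_gt0.
have -> : x = del lam ^+ 2 * s by rewrite /s mulrC divfK // gt_eqF // exprn_gt0.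
rewrite /om h2E //; set h := h2 lam s.
have h0 : 0 < h by exact: expR_gt0.
have p1 : 0 < (1 + h) ^+ 2 by rewrite exprn_gt0 // addr_gt0.
have f0 : (0 : R) <= (i.+2)`!%:R by rewrite ler0n.
have [s1|s1] := leP 1 s.
  have h1 : 1 <= h.
    rewrite -expR0 ler_expR mulr_ge0 ?divr_ge0 ?(ltW l0) // subr_ge0.
    by rewrite -Sp1 Sp_anti.
  apply: le_trans (th_large l0 s1 _) _ => //.
  rewrite -h2_sqr -/h.
  have h3 : h^-1 <= 4 * (h / (1 + h) ^+ 2).
    by rewrite mulrA ler_pdivlMr // ler_pdivrMl //; nra.
  apply: (@le_trans _ _ ((i.+2)`!%:R * h^-1)).
    rewrite ler_wpM2l // lef_pV2 ?posrE ?exprn_gt0 //; nra.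
  apply: (@le_trans _ _ ((i.+2)`!%:R * (4 * (h / (1 + h) ^+ 2)))).
    by rewrite ler_wpM2l.
  rewrite mulrCA -!mulrA ler_wpM2l // ler_wpM2r //.
    by rewrite divr_ge0 ?sqr_ge0 // ltW.
  by rewrite lerDr.
have h1 : h <= 1.
  rewrite -expR0 ler_expR mulr_ge0_le0 ?divr_ge0 ?(ltW l0) // subr_le0.
  by rewrite -Sp1 Sp_anti // ltW.
have h3 : h <= 4 * (h / (1 + h) ^+ 2).
  rewrite mulrA ler_pdivlMr //; nra.
rewrite thE // -h2_sqr -/h.
(* Inside the circle [h = exp (lam / 2 * (1 - Sp s))] is at most
   [exp (1/2) * exp (- Sp s / 2)] because [lam >= 1] and [Sp s >= 1]. *)
have h4 : s^-1 ^+ m * Sp s ^+ n * h <= expR 2^-1 * C.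
  apply: (@le_trans _ _ (expR 2^-1 * fl m n 2^-1 s)); last first.
    by rewrite ler_wpM2l ?expR_ge0 // HC // ltW.
  rewrite fl_pos // mulrC [leRHS]mulrCA [leLHS]mulrC -expRD.
  rewrite ler_wpM2l ?mulr_ge0 ?exprn_ge0 ?invr_ge0 ?(ltW s0) ?(ltW (Sp_gt0 _ _)) //.
  rewrite ler_expR.
  have S1 : 1 <= Sp s by rewrite -Sp1 Sp_anti // ltW.
  nra.
have A0 : 0 <= s^-1 ^+ m * Sp s ^+ n.
  by apply: mulr_ge0; apply: exprn_ge0; [rewrite invr_ge0 ltW|exact/ltW/Sp_gt0].
have e1 : expR (- h ^+ 2) <= 1 by rewrite -expR0 ler_expR oppr_le0 sqr_ge0.
have e0 : 0 <= expR (- h ^+ 2) by exact: expR_ge0.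
have q1 : (h ^+ 2) ^+ i.+1 <= h * h.
  rewrite exprS -expr2 ler_piMr ?sqr_ge0 // exprn_ile1 ?sqr_ge0 //.
  by rewrite exprn_ile1 // ltW.
have q0 : 0 <= (h ^+ 2) ^+ i.+1 by rewrite exprn_ge0 ?sqr_ge0.
move: A0 h4 e1 e0 q1 q0 h3 hC f0 h0; clear.
move: (_ * Sp s ^+ n) (expR (- _)) ((h ^+ 2) ^+ _) (h / (1 + h) ^+ 2) (_ * C) ((i.+2)`!%:R) => A e q w B f.
move: h => h A0 h4 e1 e0 q1 q0 h3 B0 f0 h0.
apply: (@le_trans _ _ (A * (h * h))).
  by rewrite -[leRHS]mulr1; apply: ler_pM => //; [exact: mulr_ge0|exact: ler_wpM2l].
rewrite mulrA (@le_trans _ _ (B * (4 * w))) //.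
  by apply: ler_pM => //; [rewrite mulr_ge0 // ltW|exact: ltW].
have w0 : 0 <= w by lra.
nra.
Qed.

(** Where [|z| >= 2 del], scaling gives [1 / |z|^alpha <= lam * Sp 4], hence
    [tau g >= exp (kap * lam)]. *)
Definition kap : R := 1 - Sp 4.

Lemma kap_gt0 : 0 < kap.
Proof.
rewrite /kap subr_gt0 /Sp -[ltRHS]expR0 ltr_expR mulNr oppr_lt0 mulr_gt0 //.
  by rewrite divr_gt0.
by rewrite ln_gt0 // ltr1n.
Qed.

Lemma th_far i m n lam x : 1 <= lam -> admissible i m n -> 4 * del lam ^+ 2 <= x ->
  th i m n lam x <= (i.+1)`!%:R * expR (- (kap * lam)).
Proof.
move=> l1 oki hx; have l0 : 0 < lam by exact: lt_le_trans l1.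
have d0 := del_gt0 lam.
pose s := x / del lam ^+ 2.
have s4 : 4 <= s by rewrite ler_pdivlMr // exprn_gt0.
have -> : x = del lam ^+ 2 * s by rewrite /s mulrC divfK // gt_eqF // exprn_gt0.
apply: le_trans (th_large l0 _ oki) _; first by rewrite (le_trans _ s4) // ler1n.
rewrite ler_wpM2l ?ler0n // /hh -expRN ler_expR lerN2 mulrC ler_wpM2l ?(ltW l0) //.
by rewrite /kap lerD2l lerN2 Sp_anti.
Qed.

End Theta.

(** * Families of amplitudes, stable under differentiation *)

Section Bump.
Context (R : realType).
Implicit Types (X Y : R -> R).

Definition bump1 X := smooth1 X /\ exists2 r, 0 <= r & forall x, r < `|x| -> X x = 0.

(** The cut-off [psi] equals 1 on [[-2, 2]], so its derivatives vanish near 0; this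
    is what makes the terms where it is differentiated negligible. *)
Definition zero_near X := forall x, `|x| < 2 -> X x = 0.

Lemma bump_bounded X : bump1 X -> exists2 B, 0 <= B & forall x, `|X x| <= B.
Proof.
move=> [sX [r r0 X0]].
have c1 : {within `[- r, r], continuous (fun x => `|X x|)}.
  apply: continuous_subspaceT => x; apply: cvg_norm.
  exact: (smooth1_cont sX).
have rr : - r <= r by lra.
have [c _ hc] := EVT_max rr c1.
exists `|X c| => // x; have [xr|xr] := leP `|x| r.
  by apply: hc; rewrite in_itv /= -ler_norml.
by rewrite X0 // normr0.
Qed.

Lemma derive_zero_on X x : (\near x, X x = 0) -> smooth1 X ->
  (X^`())%classic x = 0.
Proof.
move=> nx sX; rewrite derive1E.
have nx' : \near x, cst 0 x = X x by near=> y; apply/esym; near: y.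
by have [] := near_eq_is_derive nx' (is_derive_cst (0 : R) x (1 : R)).
Unshelve. all: by end_near.
Qed.

Lemma bump_derive X : bump1 X -> bump1 (X^`())%classic.
Proof.
move=> [sX [r r0 X0]]; split; first exact: smooth1_derive.
exists r => // x rx; apply: derive_zero_on => //.
near=> y; apply: X0; near: y.
have H : (fun y => `|y|) @ x --> `|x| by apply: cvg_norm; exact: cvg_id.
exact: (cvgr_gt _ H _ rx).
Unshelve. all: by end_near.
Qed.

Lemma zero_near_derive X : smooth1 X -> zero_near X -> zero_near (X^`())%classic.
Proof.
move=> sX X0 x rx; apply: derive_zero_on => //.
near=> y; apply: X0; near: y.
have H : (fun y => `|y|) @ x --> `|x| by apply: cvg_norm; exact: cvg_id.
exact: (cvgr_lt _ H _ rx).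
Unshelve. all: by end_near.
Qed.

Lemma bump_idM X : bump1 X -> bump1 (fun x => x * X x).
Proof.
move=> [sX [r r0 X0]]; split; first by apply: smooth1M => //; exact: smooth1_id.
by exists r => // x rx; rewrite X0 // mulr0.
Qed.

Lemma zero_near_idM X : zero_near X -> zero_near (fun x => x * X x).
Proof. by move=> X0 x rx; rewrite X0 // mulr0. Qed.

(** Exchanging [x] and [y] transfers every statement on [x]-derivatives to [y]. *)
Definition swp (p : R3 R) : R3 R := (p.1.2, p.1.1, p.2).

Lemma is_derive_swap (f : R3 R -> R) p (d : R) :
  is_derive (swp p) ex (fun q => f (swp q)) d -> is_derive p ey f d.
Proof.
have p0 (q e : R3 R) : q = 0 *: e + q by rewrite scale0r add0r.
rewrite (p0 p ey) {1}(p0 (swp (0 *: ey + p)) ex) => /is_derive_line H.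
apply/is_derive_line; move: (H).
rewrite (_ : (fun h : R => f (swp _)) = (fun h : R => f (h *: ey + p))) //.
apply/funext => h; congr f; rewrite /swp /ex /ey.
case: p H => [[x y] t] _; congr (_, _, _) => /=; rewrite /GRing.scale /=.
all: by rewrite ?mulr0 ?mulr1 ?mul0r; ring.
Qed.

End Bump.

Section Class.
Context (R : realType) (alpha : R).
Hypothesis alpha0 : 0 < alpha.
Implicit Types (X Y : R -> R) (F G : R -> R3 R -> R) (p : R3 R) (lam : R).
Local Notation del := (del alpha).
Local Notation mu := (mu alpha).
Local Notation th := (th alpha).

Definition nsq p : R := cx p ^+ 2 + cy p ^+ 2.

Lemma is_derive_nsq_ex p : is_derive p ex nsq (2 * cx p).
Proof.
have D := is_derive_add (is_derive_mul (is_derive_cx p ex) (is_derive_cx p ex))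
  (is_derive_mul (is_derive_cy p ex) (is_derive_cy p ex)).
have E : nsq = fun q => cx q * cx q + cy q * cy q by apply/funext => q; rewrite /nsq !expr2.
rewrite E; apply: is_derive_eq D _; rewrite /cx /cy /=; ring.
Qed.

Lemma meas_nsq : measurable_fun setT nsq.
Proof.
by apply: measurable_funD; apply: measurable_funX; [exact: meas_cx|exact: meas_cy].
Qed.

Definition mono i m n X Y lam p : R :=
  th i m n lam (nsq p) * X (cx p / del lam) * Y (cy p / del lam).

Lemma monoE i m n X Y lam p : mono i m n X Y lam p =
  th i m n lam (nsq p) * X (cx p / del lam) * Y (cy p / del lam).
Proof. by []. Qed.

(** The three sizes of amplitudes: bounded ones, ones concentrated in the layer
    around [|z| = del], and exponentially small ones, supported where [|x|] or [|y|]
    is at least [2 del]. *)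
Inductive kind := gen | flat | far.

(** The amplitudes are indexed by [lam], and constants must not depend on it.
    Generating them from the monomials [mono] makes every statement on a class an
    induction, with constants depending on the generating expression only. *)
Inductive family : kind -> (R -> R3 R -> R) -> Prop :=
| family_flat i m n X Y of bump1 X & bump1 Y : family flat (mono i.+1 m n X Y)
| family_gen X Y of bump1 X & bump1 Y : family gen (mono 0 0 0 X Y)
| family_far i m n X Y of admissible i m n & bump1 X & bump1 Y & (zero_near X \/ zero_near Y) :
    family far (mono i m n X Y)
| family_add t F G of family t F & family t G : family t (fun lam p => F lam p + G lam p)
| family_scale t (k : R -> R) F of (exists B, forall lam, 1 <= lam -> `|k lam| <= B) & family t F :
    family t (fun lam p => k lam * F lam p).

Lemma family_scalec t (k : R) F : family t F -> family t (fun lam p => k * F lam p).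
Proof. by move=> cF; apply: (@family_scale t (fun=> k)) => //; exists `|k|. Qed.

Lemma family_eq t F G : (forall lam p, F lam p = G lam p) -> family t F -> family t G.
Proof. by move=> H; rewrite (_ : F = G) //; apply/funext => lam; apply/funext => p. Qed.

Lemma family_swp t F : family t F -> family t (fun lam p => F lam (swp p)).
Proof.
have E i m n X Y lam p : mono i m n Y X lam p = mono i m n X Y lam (swp p).
  by rewrite /mono /nsq /swp /cx /cy /= mulrAC [_ ^+ 2 + _]addrC.
elim=> {t F} [i m n X Y bX bY|X Y bX bY|i m n X Y oki bX bY fXY|t F G _ IF _ IG|t k F hk _ IF].
- by apply: (family_eq (E i.+1 m n X Y)); exact: family_flat.
- by apply: (family_eq (E 0%N 0%N 0%N X Y)); exact: family_gen.
- by apply: (family_eq (E i m n X Y)); apply: family_far => //; case: fXY; [right|left].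
- exact: (family_add IF IG).
- exact: (family_scale hk IF).
Qed.

Lemma family_mulx t F : family t F -> family t (fun lam p => cx p / del lam * F lam p).
Proof.
have E i m n X Y lam p : mono i m n (fun x => x * X x) Y lam p = cx p / del lam * mono i m n X Y lam p.
  by rewrite /mono; ring.
elim=> {t F} [i m n X Y bX bY|X Y bX bY|i m n X Y oki bX bY fXY|t F G _ IF _ IG|t k F hk _ IF].
- by apply: (family_eq (E i.+1 m n X Y)); apply: family_flat => //; exact: bump_idM.
- by apply: (family_eq (E 0%N 0%N 0%N X Y)); apply: family_gen => //; exact: bump_idM.
- apply: (family_eq (E i m n X Y)); apply: family_far => //; first exact: bump_idM.
  by case: fXY => [/zero_near_idM|]; [left|right].
- by apply: (family_eq _ (family_add IF IG)) => lam p /=; rewrite mulrDr.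
- by apply: (family_eq _ (family_scale hk IF)) => lam p /=; rewrite mulrCA.
Qed.

Lemma family_muly t F : family t F -> family t (fun lam p => cy p / del lam * F lam p).
Proof. by move=> /family_swp/family_mulx/family_swp; apply: family_eq => lam [[x y] z]. Qed.

Lemma inv_bounded : exists B : R, forall lam, 1 <= lam -> `|lam^-1| <= B.
Proof.
exists 1 => lam l1; rewrite ger0_norm ?invr_ge0 ?(le_trans _ l1) //.
by rewrite invf_le1 // (lt_le_trans _ l1).
Qed.

Lemma is_derive_scalex (X : R -> R) p (d : R) : smooth1 X ->
  is_derive p ex (fun q => X (cx q / d)) ((X^`())%classic (cx p / d) / d).
Proof.
move=> sX.
have D1 : is_derive p ex (fun q => cx q / d) (1 / d).
  have := is_derive_scale d^-1 (is_derive_cx p ex).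
  by rewrite (_ : (fun q => d^-1 * cx q) = (fun q => cx q / d)) ?[_ * cx ex]mulrC //;
     apply/funext => q; rewrite mulrC.
have := is_derive_comp1 D1 (smooth1_is_derive (cx p / d) sX).
by rewrite mulrA mulr1.
Qed.

Lemma is_derive_scaley (X : R -> R) p (d : R) : smooth1 X ->
  is_derive p ex (fun q => X (cy q / d)) 0.
Proof.
move=> sX.
have D1 : is_derive p ex (fun q => cy q / d) 0.
  have := is_derive_scale d^-1 (is_derive_cy p ex).
  by rewrite (_ : (fun q => d^-1 * cy q) = (fun q => cy q / d)) ?[_ * cy ex]mulr0 //;
     apply/funext => q; rewrite mulrC.
have := is_derive_comp1 D1 (smooth1_is_derive (cy p / d) sX).
by rewrite mulr0.
Qed.

(** The chain rule through [|z|^2].  Differentiating the profile costs [mu], and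
    differentiating the cut-off at scale [del] costs only [1 / del]. *)
Lemma is_derive_mono i m n X Y lam p : 1 <= lam -> admissible i m n -> bump1 X -> bump1 Y ->
  is_derive p ex (mono i m n X Y lam)
  (mu lam * (lam^-1 * (- (2 * (m%:R + n%:R * (alpha / 2))) * mono i m.+1 n (fun x => x * X x) Y lam p)
            + i%:R * alpha * mono i m.+1 n.+1 (fun x => x * X x) Y lam p
            + (- alpha) * mono i.+1 m.+1 n.+1 (fun x => x * X x) Y lam p)
   + (del lam)^-1 * mono i m n (X^`())%classic Y lam p).
Proof.
move=> l1 oki [sX _] [sY _]; have l0 : 0 < lam by exact: lt_le_trans l1.
have d0 := del_neq0 alpha lam; have l0' : lam != 0 by rewrite gt_eqF.
have Dth := is_derive_comp1 (is_derive_nsq_ex p) (@is_derive_th R alpha alpha0 i m n lam (nsq p) l0 oki).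
have D := is_derive_mul (is_derive_mul Dth (is_derive_scalex p (del lam) sX)) (is_derive_scaley p (del lam) sY).
apply: is_derive_eq D _; rewrite /mono /mu; field.
by rewrite d0 l0'.
Qed.

Lemma is_derive_monot i m n X Y lam p : 0 < lam -> admissible i m n -> smooth1 X -> smooth1 Y ->
  is_derive p et (mono i m n X Y lam) 0.
Proof.
move=> l0 oki sX sY.
have nt (f : R3 R -> R) : (forall h q, f (h *: et + q) = f q) -> is_derive p et f 0.
  move=> fE; rewrite (_ : p = 0 *: et + p); last by rewrite scale0r add0r.
  apply/is_derive_line; under [X in is_derive _ _ X _]eq_fun do rewrite fE.
  exact: is_derive_cst.
apply: nt => h [[x y] t]; rewrite /mono /nsq /cx /cy /=.
by rewrite /GRing.scale /= /GRing.scale /= mulr0 !add0r.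
Qed.

(** On the kinds [flat] and [far] every derivative costs [mu]; for the cut-offs this
    is because [1 / del = mu / lam]. *)
Lemma family_derive_ex t F : t <> gen -> family t F -> exists2 G, family t G &
  forall lam p, 1 <= lam -> is_derive p ex (F lam) (mu lam * G lam p).
Proof.
move=> tg cF; elim: cF tg => {t F} [i m n X Y bX bY _|//|i m n X Y oki bX bY fXY _|t F G _ IF _ IG tg|t k F hk _ IF tg].
- pose C j a b Z := @family_flat j a b Z Y.
  exists (fun lam p => (lam^-1 * (- (2 * (m%:R + n%:R * (alpha / 2))) * mono i.+1 m.+1 n (fun x => x * X x) Y lam p)
            + i.+1%:R * alpha * mono i.+1 m.+1 n.+1 (fun x => x * X x) Y lam p
            + (- alpha) * mono i.+2 m.+1 n.+1 (fun x => x * X x) Y lam p)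
            + lam^-1 * mono i.+1 m n (X^`())%classic Y lam p).
    apply: (@family_add flat (fun lam p => _ * _ + _ * _ + _ * _) (fun lam p => _ * _)).
      apply: (@family_add flat (fun lam p => _ * _ + _ * _) (fun lam p => _ * _)).
        apply: (@family_add flat (fun lam p => _ * _) (fun lam p => _ * _)).
          apply: (@family_scale flat (fun lam => lam^-1) (fun lam p => _ * _) inv_bounded).
          by apply: (@family_scalec flat _ (mono _ _ _ _ _)); apply: C => //; exact: bump_idM.
        by apply: (@family_scalec flat _ (mono _ _ _ _ _)); apply: C => //; exact: bump_idM.
      by apply: (@family_scalec flat _ (mono _ _ _ _ _)); apply: C => //; exact: bump_idM.
    apply: (@family_scale flat (fun lam => lam^-1) (mono _ _ _ _ _) inv_bounded).
    by apply: C => //; exact: bump_derive.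
  move=> lam p l1; apply: is_derive_eq (is_derive_mono p l1 _ bX bY) _ => //.
  have l0 : lam != 0 by rewrite gt_eqF // (lt_le_trans _ l1).
  by rewrite /mu; field; rewrite l0 del_neq0.
- have C j a b : admissible j a b -> family far (mono j a b (fun x => x * X x) Y).
    move=> okj; apply: family_far => //; first exact: bump_idM.
    by case: fXY => [/zero_near_idM|]; [left|right].
  have okS a b : admissible i.+1 a b by [].
  have C' : family far (mono i m n (X^`())%classic Y).
    apply: family_far => //; first exact: bump_derive.
    by case: fXY => [fX|]; [left; apply: zero_near_derive => //; case: bX|right].
  have D1 : family far (fun lam p => lam^-1 * (- (2 * (m%:R + n%:R * (alpha / 2))) * mono i m.+1 n (fun x => x * X x) Y lam p)).
    case: i oki {C' okS} C => [/andP[/eqP-> /eqP->] C|i _ C].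
      apply: (@family_eq _ (fun lam p => 0 * mono 1 0 0 (fun x => x * X x) Y lam p)).
        by move=> lam p; rewrite !mul0r addr0 mulr0 oppr0 !mul0r mulr0.
      exact: (@family_scalec far 0 (mono 1 0 0 (fun x => x * X x) Y) (C _ _ _ _)).
    apply: (@family_scale far (fun lam => lam^-1) (fun lam p => _ * _) inv_bounded).
    by apply: (@family_scalec far _ (mono _ _ _ _ _)); exact: C.
  have D2 : family far (fun lam p => i%:R * alpha * mono i m.+1 n.+1 (fun x => x * X x) Y lam p).
    case: i oki {C' okS D1} C => [/andP[/eqP-> /eqP->] C|i _ C].
      apply: (@family_eq _ (fun lam p => 0 * mono 1 0 0 (fun x => x * X x) Y lam p)).
        by move=> lam p; rewrite !mul0r.
      exact: (@family_scalec far 0 (mono 1 0 0 (fun x => x * X x) Y) (C _ _ _ _)).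
    by apply: (@family_scalec far _ (mono _ _ _ _ _)); exact: C.
  exists (fun lam p => (lam^-1 * (- (2 * (m%:R + n%:R * (alpha / 2))) * mono i m.+1 n (fun x => x * X x) Y lam p)
            + i%:R * alpha * mono i m.+1 n.+1 (fun x => x * X x) Y lam p
            + (- alpha) * mono i.+1 m.+1 n.+1 (fun x => x * X x) Y lam p)
            + lam^-1 * mono i m n (X^`())%classic Y lam p).
    apply: (@family_add far (fun lam p => _ * _ + _ * _ + _ * _) (fun lam p => _ * _)).
      apply: (family_add (family_add D1 D2)).
      by apply: (@family_scalec far _ (mono _ _ _ _ _)); exact: C.
    exact: (@family_scale far (fun lam => lam^-1) (mono _ _ _ _ _) inv_bounded).
  move=> lam p l1; apply: is_derive_eq (is_derive_mono p l1 _ bX bY) _ => //.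
  have l0 : lam != 0 by rewrite gt_eqF // (lt_le_trans _ l1).
  by rewrite /mu; field; rewrite l0 del_neq0.
- have [F' cF' dF'] := IF tg; have [G' cG' dG'] := IG tg.
  exists (fun lam p => F' lam p + G' lam p); first exact: family_add.
  move=> lam p l1; rewrite mulrDr; exact: is_derive_add (dF' lam p l1) (dG' lam p l1).
- have [F' cF' dF'] := IF tg.
  exists (fun lam p => k lam * F' lam p); first exact: family_scale.
  move=> lam p l1; rewrite mulrCA; exact: is_derive_scale (dF' lam p l1).
Qed.

(** On bounded amplitudes the expensive part of the derivative is concentrated in
    the layer.  Separating it from the part of size [1 / del] is what gains a
    factor [mu] in [decay]. *)
Lemma family_derive_ex_gen F : family gen F -> exists G1 G2, [/\ family flat G1, family gen G2 &
  forall lam p, 1 <= lam ->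
    is_derive p ex (F lam) (mu lam * G1 lam p + (del lam)^-1 * G2 lam p)].
Proof.
move E : gen => t cF; elim: cF E => {t F} [//|X Y bX bY _|//|t F G _ IF _ IG tg|t k F hk _ IF tg].
- exists (fun lam p => - alpha * mono 1 1 1 (fun x => x * X x) Y lam p), (mono 0 0 0 (X^`())%classic Y); split.
  + by apply: (@family_scalec flat _ (mono _ _ _ _ _)); apply: family_flat => //; exact: bump_idM.
  + by apply: family_gen => //; exact: bump_derive.
  + move=> lam p l1; apply: is_derive_eq (is_derive_mono p l1 _ bX bY) _ => //.
    ring.
- have [F' [F'' [cF' cF'' dF']]] := IF tg; have [G' [G'' [cG' cG'' dG']]] := IG tg.
  rewrite -tg in cF'' cG'' *.
  exists (fun lam p => F' lam p + G' lam p), (fun lam p => F'' lam p + G'' lam p); split; try exact: family_add.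
  move=> lam p l1; apply: is_derive_eq (is_derive_add (dF' lam p l1) (dG' lam p l1)) _; ring.
- have [F' [F'' [cF' cF'' dF']]] := IF tg.
  exists (fun lam p => k lam * F' lam p), (fun lam p => k lam * F'' lam p); split; try exact: family_scale.
  move=> lam p l1; apply: is_derive_eq (is_derive_scale (k lam) (dF' lam p l1)) _; ring.
Qed.

Lemma family_derive_ey t F : t <> gen -> family t F -> exists2 G, family t G &
  forall lam p, 1 <= lam -> is_derive p ey (F lam) (mu lam * G lam p).
Proof.
move=> tg /family_swp /(family_derive_ex tg)[G /family_swp cG dG]; exists (fun lam p => G lam (swp p)) => //.
by move=> lam p l1; apply: is_derive_swap; exact: dG.
Qed.

Lemma family_derive_ey_gen F : family gen F -> exists G1 G2, [/\ family flat G1, family gen G2 &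
  forall lam p, 1 <= lam ->
    is_derive p ey (F lam) (mu lam * G1 lam p + (del lam)^-1 * G2 lam p)].
Proof.
move=> /family_swp /family_derive_ex_gen[G1 [G2 [/family_swp c1 /family_swp c2 dG]]].
exists (fun lam p => G1 lam (swp p)), (fun lam p => G2 lam (swp p)); split => //.
by move=> lam p l1; apply: is_derive_swap; exact: dG.
Qed.

Lemma family_derive_et t F lam p : family t F -> 0 < lam -> is_derive p et (F lam) 0.
Proof.
move=> cF l0; elim: cF => {t F} [i m n X Y [sX _] [sY _]|X Y [sX _] [sY _]|i m n X Y oki [sX _] [sY _] _|t F G _ IF _ IG|t k F hk _ IF].
- exact: is_derive_monot.
- exact: is_derive_monot.
- exact: is_derive_monot.
- by rewrite -[0]addr0; exact: is_derive_add.
- by rewrite -(mulr0 (k lam)); exact: is_derive_scale.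
Qed.

Definition zbx (a : R) p : R := ind a (cx p) * ind a (cy p).
Lemma zbx_ge0 a p : 0 <= zbx a p. Proof. by rewrite mulr_ge0 ?ind_ge0. Qed.
Lemma zbx_mono a b p : a <= b -> zbx a p <= zbx b p.
Proof. by move=> ab; rewrite ler_pM ?ind_ge0 ?ind_mono. Qed.

(** The pointwise size of a class of amplitudes. *)
Definition bd t lam p : R := match t with
  | gen => 1 | flat => om alpha lam (nsq p) | far => expR (- (kap alpha * lam)) end.
Lemma bd_ge0 t lam p : 0 <= bd t lam p.
Proof. by case: t => /=; [exact: ler01|exact: om_ge0|exact: expR_ge0]. Qed.

Lemma family_meas t F lam : family t F -> measurable_fun setT (F lam).
Proof.
have M i m n X Y : bump1 X -> bump1 Y -> measurable_fun setT (mono i m n X Y lam).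
  move=> [sX _] [sY _].
  apply: measurable_funM; first apply: measurable_funM.
  - by apply: meas_comp1; [exact: cont_th|exact: meas_nsq].
  - apply: (@meas_comp1 _ X (fun p => cx p / del lam)); first exact: smooth1_cont.
    by apply: measurable_funM => //; exact: meas_cx.
  - apply: (@meas_comp1 _ Y (fun p => cy p / del lam)); first exact: smooth1_cont.
    by apply: measurable_funM => //; exact: meas_cy.
elim=> {t F} [i m n X Y bX bY|X Y bX bY|i m n X Y oki bX bY fXY|t F G _ IF _ IG|t k F hk _ IF].
- exact: M.
- exact: M.
- exact: M.
- exact: measurable_funD.
- exact: measurable_funM.
Qed.

Lemma bump_ind X : bump1 X -> exists B r, [/\ 0 <= B, 0 <= r &
  forall lam x, `|X (x / del lam)| <= B * ind (r * del lam) x].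
Proof.
move=> bX; have [B B0 XB] := bump_bounded bX; case: bX => sX [r r0 X0].
exists B, r; split => // lam x; have d0 := del_gt0 alpha lam.
have [xr|xr] := leP `|x| (r * del lam); first by rewrite (ind1 xr) mulr1.
rewrite X0 ?normr0 ?mulr_ge0 ?ind_ge0 //.
by rewrite normrM normfV (gtr0_norm d0) ltr_pdivlMr.
Qed.

(** Only the values of the profile on the support of the cut-offs matter, which is
    where [th_far] applies for the exponentially small class. *)
Lemma family_bound t F : family t F -> exists C r, [/\ 0 <= C, 0 <= r &
  forall lam p, 1 <= lam -> `|F lam p| <= C * bd t lam p * zbx (r * del lam) p].
Proof.
have M i m n X Y D (b : R -> R3 R -> R) : bump1 X -> bump1 Y -> 0 <= D -> (forall lam p, 0 <= b lam p) ->
   (forall lam p, 1 <= lam -> X (cx p / del lam) != 0 -> Y (cy p / del lam) != 0 ->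
      th i m n lam (nsq p) <= D * b lam p) ->
   exists C r, [/\ 0 <= C, 0 <= r &
    forall lam p, 1 <= lam -> `|mono i m n X Y lam p| <= C * b lam p * zbx (r * del lam) p].
  move=> bX bY D0 b0 hb.
  have [B [r [B0 r0 XB]]] := bump_ind bX; have [B' [r' [B0' r0' YB]]] := bump_ind bY.
  exists (D * B * B'), (r + r'); split; rewrite ?mulr_ge0 ?addr_ge0 // => lam p l1.
  have d0 := del_gt0 alpha lam; have l0 : 0 < lam by exact: lt_le_trans l1.
  rewrite /mono 2!normrM.
  have [x0|x0] := eqVneq (X (cx p / del lam)) 0.
    by rewrite x0 normr0 mulr0 mul0r !mulr_ge0 ?ind_ge0.
  have [y0|y0] := eqVneq (Y (cy p / del lam)) 0.
    by rewrite y0 normr0 mulr0 !mulr_ge0 ?ind_ge0.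
  rewrite (ger0_norm (th_ge0 _ _ _ _ _ l0)).
  have -> : D * B * B' * b lam p * zbx ((r + r') * del lam) p =
    (D * b lam p) * (B * ind ((r + r') * del lam) (cx p)) * (B' * ind ((r + r') * del lam) (cy p)).
    by rewrite /zbx; ring.
  have e1 := ler_wpM2l B0 (ind_mono (cx p) (_ : r * del lam <= (r + r') * del lam)).
  have e2 := ler_wpM2l B0' (ind_mono (cy p) (_ : r' * del lam <= (r + r') * del lam)).
  apply: ler_pM.
  - by rewrite mulr_ge0 // th_ge0.
  - exact: normr_ge0.
  - apply: ler_pM => //; [exact: th_ge0|exact: hb|].
    by apply: le_trans (XB lam (cx p)) (e1 _); rewrite ler_wpM2r ?(ltW d0) // lerDl.
  - by apply: le_trans (YB lam (cy p)) (e2 _); rewrite ler_wpM2r ?(ltW d0) // lerDr.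
elim=> {t F} [i m n X Y bX bY|X Y bX bY|i m n X Y oki bX bY fXY|t F G _ [C [r [C0 r0 FC]]] _ [D [s [D0 s0 GD]]]|t k F [B kB] _ [C [r [C0 r0 FC]]]].
- have [C C0 HC] := th_flat alpha0 i m n.
  apply: (M _ _ _ _ _ C (bd flat) bX bY C0 (@bd_ge0 flat)).
  by move=> lam p l1 _ _; exact: HC.
- apply: (M _ _ _ _ _ 1 (bd gen) bX bY ler01 (@bd_ge0 gen)).
  by move=> lam p l1 _ _; rewrite /th /= !expr0 !mul1r; exact: E_le1.
- apply: (M _ _ _ _ _ (i.+1)`!%:R (bd far) bX bY (ler0n _ _) (@bd_ge0 far)).
  move=> lam p l1 Xn0 Yn0; apply: th_far => //.
  have d0 := del_gt0 alpha lam.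
  have sq (x : R) : ~ `|x / del lam| < 2 -> 4 * del lam ^+ 2 <= x ^+ 2.
    move=> /negP; rewrite -leNgt normrM normfV (gtr0_norm d0) ler_pdivlMr // => h.
    rewrite -[leRHS]real_normK ?num_real // (_ : 4 * _ = (2 * del lam) ^+ 2); last by ring.
    by rewrite ler_pXn2r // ?nnegrE ?mulr_ge0 // ltW.
  case: fXY => [fX|fY].
    rewrite (le_trans (sq (cx p) _)) //; last by rewrite lerDl sqr_ge0.
    by move=> h; move: Xn0; rewrite fX ?eqxx.
  rewrite (le_trans (sq (cy p) _)) //; last by rewrite lerDr sqr_ge0.
  by move=> h; move: Yn0; rewrite fY ?eqxx.
- exists (C + D), (r + s); split; rewrite ?addr_ge0 // => lam p l1.
  have d0 := del_gt0 alpha lam.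
  rewrite (le_trans (ler_normD _ _)) // !mulrDl lerD //.
    rewrite (le_trans (FC lam p l1)) // ler_wpM2l ?mulr_ge0 ?bd_ge0 // zbx_mono //.
    by rewrite lerDl mulr_ge0 // ltW.
  rewrite (le_trans (GD lam p l1)) // ler_wpM2l ?mulr_ge0 ?bd_ge0 // zbx_mono //.
  by rewrite lerDr mulr_ge0 // ltW.
- have B0 : 0 <= B by exact: le_trans (kB 1 (lexx _)).
  exists (B * C), r; split; rewrite ?mulr_ge0 // => lam p l1.
  rewrite normrM -!mulrA ler_pM // ?kB //.
  by rewrite mulrA FC.
Qed.

End Class.

(** * Total variation across the layer where tau g is of order one *)

Section TV.
Context (R : realType) (alpha : R).
Hypothesis alpha0 : 0 < alpha.
Local Notation L1 := (@lebesgue_measure R).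
Implicit Types (X Y T : R -> R) (F G : R -> R3 R -> R) (p : R3 R) (lam : R).
Local Notation del := (del alpha).
Local Notation mu := (mu alpha).
Local Notation fl := (fl alpha).
Local Notation om := (om alpha).

(** With [h = tau g] this is [1 + sqrt h]. *)
Definition den lam (x : R) : R := 1 + expR (lam / 2) * fl 0 0 2^-1 x.

(** Up to the factor [- alpha / 4], the derivative of [1 / (1 + sqrt h)] with
    respect to [|z|^2]. *)
Definition Wt lam (x : R) : R := expR (lam / 2) * fl 1 1 2^-1 x / den lam x ^+ 2.

Lemma den_ge1 lam x : 1 <= den lam x.
Proof. by rewrite lerDl mulr_ge0 ?expR_ge0 ?fl_ge0. Qed.
Lemma den_gt0 lam x : 0 < den lam x.
Proof. exact: lt_le_trans (den_ge1 _ _). Qed.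

Let h20 : (0 : R) < 2^-1. Proof. by rewrite invr_gt0. Qed.

Lemma cont_den lam : continuous (den lam).
Proof.
apply: smooth1_cont; apply: (@smooth1D R (fun=> 1)); first exact: smooth1_cst.
by apply: smooth1Z; exact: smooth1_fl.
Qed.

Lemma is_derive_invden lam (x : R) :
  is_derive x (1 : R) (fun y => (den lam y)^-1) (- (alpha / 4 * Wt lam x)).
Proof.
have D := is_derive1_add (is_derive_cst (1 : R) x (1 : R))
  (is_derive1_scale (expR (lam / 2)) (is_derive_fl alpha0 0 0 x h20)).
have d0 : den lam x != 0 by rewrite gt_eqF // den_gt0.
case: D => D1 D2; apply: DeriveDef; first exact: derivableV.
rewrite deriveV // /den D2 /Wt /dfl /GRing.scale /=.
by rewrite mul0r addr0 oppr0 mul0r add0r add0r -/(den lam x); field.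
Qed.

Lemma Wt_ge0 lam x : 0 <= Wt lam x.
Proof. by rewrite divr_ge0 ?sqr_ge0 // mulr_ge0 ?expR_ge0 ?fl_ge0. Qed.

Lemma cont_Wt lam : continuous (Wt lam).
Proof.
move=> x; apply: cvgM.
  apply: cvgM; first exact: cvg_cst.
  by apply: smooth1_cont; exact: smooth1_fl.
apply: cvgV; first by rewrite expf_neq0 // gt_eqF // den_gt0.
by apply: cvgM; exact: cont_den.
Qed.

Lemma Wt_om lam x : 0 < x -> Wt lam x = x^-1 * Sp alpha x * om lam x.
Proof.
move=> x0; rewrite /Wt /om !fl_pos // !expr0 !expr1; rewrite -/(den lam x).
by rewrite /den fl_pos // !expr0; ring.
Qed.

(** Up to a constant the derivative of [1 / (1 + sqrt h)] in [|z|^2] is [om] times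
    [S / |z|^2], and [S / |z|] is at least a multiple of [mu] at distance at most a
    multiple of [del] from the origin. *)
Lemma om_le_grad r : 0 < r -> exists2 K, 0 <= K & forall lam p, 1 <= lam ->
  om lam (nsq p) * zbx (r * del lam) p <=
  K / mu lam * ((`|cx p| + `|cy p|) * Wt lam (nsq p)) * zbx (r * del lam) p.
Proof.
(* The largest value of [|z|^2 / del^2] on the box. *)
move=> r0; pose Rr := 2 * r ^+ 2.
have SR := Sp_gt0 alpha Rr.
exists (2 * r / Sp alpha Rr); first by rewrite divr_ge0 ?mulr_ge0 ?ltW.
move=> lam p l1; have d0 := del_gt0 alpha lam; have l0 : 0 < lam by exact: lt_le_trans l1.
have m0 := mu_gt0 alpha l1.
have [xr|xr] := leP `|cx p| (r * del lam); last by rewrite /zbx (ind0 xr) mul0r !mulr0.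
have [yr|yr] := leP `|cy p| (r * del lam); last by rewrite /zbx (ind0 yr) !mulr0.
rewrite ler_wpM2r ?zbx_ge0 //.
have [n0|n0] := ltP 0 (nsq p); last first.
  by rewrite omE /Wt !fl_neg // !mulr0 !mul0r !mulr0.
rewrite Wt_om //.
pose s := nsq p / del lam ^+ 2.
have s0 : 0 < s by rewrite divr_gt0 // exprn_gt0.
have nE : nsq p = del lam ^+ 2 * s by rewrite /s mulrC divfK // gt_eqF // exprn_gt0.
have x2 : cx p ^+ 2 <= (r * del lam) ^+ 2.
  by rewrite -[leLHS]real_normK ?num_real // ler_pXn2r ?nnegrE ?mulr_ge0 ?(ltW r0) ?(ltW d0).
have y2 : cy p ^+ 2 <= (r * del lam) ^+ 2.
  by rewrite -[leLHS]real_normK ?num_real // ler_pXn2r ?nnegrE ?mulr_ge0 ?(ltW r0) ?(ltW d0).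
have sR : s <= Rr.
  rewrite /s ler_pdivrMr ?exprn_gt0 // /Rr /nsq; move: x2 y2; rewrite exprMn; lra.
have SsR : Sp alpha Rr <= Sp alpha s by exact: Sp_anti.
have SE : Sp alpha (nsq p) = lam * Sp alpha s by rewrite nE Sp_scale.
set a := `|cx p| + `|cy p|.
have a2 : nsq p <= a ^+ 2.
  rewrite /nsq /a -(real_normK (num_real (cx p))) -(real_normK (num_real (cy p))).
  have := normr_ge0 (cx p); have := normr_ge0 (cy p); nra.
have a1 : a <= 2 * r * del lam by rewrite /a; lra.
have a0 : 0 < a.
  rewrite lt_neqAle addr_ge0 // andbT; apply/eqP => aE.
  by move: a2; rewrite -aE expr0n /= leNgt n0.
have := om_ge0 alpha lam (nsq p); move: (om lam (nsq p)) => o o0.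
rewrite SE -[leLHS]mul1r !mulrA ler_wpM2r //.
have -> : 2 * r / Sp alpha Rr / mu lam * a / nsq p * lam * Sp alpha s =
   (2 * r * del lam / a) * (Sp alpha s / Sp alpha Rr) * (a ^+ 2 / nsq p).
  rewrite muE; field; rewrite !gt_eqF //.
rewrite -[leLHS]mulr1 -[leLHS]mulr1.
by apply: ler_pM => //; [apply: ler_pM => //|]; rewrite ler_pdivlMr // mul1r.
Qed.

(** On each half-line the integrand is, up to a constant, the derivative of a
    monotone function with values in [[0, 1]]; the integral is bounded by a total
    variation, uniformly in [lam], [a] and [y]. *)
Lemma int1_grad lam (a y : R) : 0 < a ->
  (\int[L1]_x (`|x| * Wt lam (x ^+ 2 + y ^+ 2) * ind a x)%:E <= (4 / alpha)%:E)%E.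
Proof.
move=> a0.
pose h (x : R) := - (den lam (x ^+ 2 + y ^+ 2))^-1.
pose k (x : R) := alpha / 2 * (x * Wt lam (x ^+ 2 + y ^+ 2)).
have hk x : is_derive x (1 : R) h (k x).
  have Ds : is_derive x (1 : R) (fun x => x ^+ 2 + y ^+ 2) (2 * x).
    have := is_derive1_add (is_derive1_mul (is_derive_id x (1 : R)) (is_derive_id x (1 : R)))
      (is_derive_cst (y ^+ 2) x (1 : R)).
    rewrite addr0 mul1r mulr1 (_ : x + x = 2 * x); last by ring.
    by rewrite (_ : (fun q => id q * id q + cst (y ^+ 2) q) = (fun x => x ^+ 2 + y ^+ 2)).
  have D := is_derive1_scale (-1) (is_derive1_chain Ds (is_derive_invden lam (x ^+ 2 + y ^+ 2))).
  rewrite /h (_ : (fun x => - _) = fun x => -1 * (den lam (x ^+ 2 + y ^+ 2))^-1); last first.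
    by apply/funext => z; rewrite mulN1r.
  by apply: is_derive_eq D _; rewrite /k; field.
have cn : continuous (fun x : R => x ^+ 2 + y ^+ 2).
  by move=> x; apply: cvgD; [apply: cvgM; exact: cvg_id|exact: cvg_cst].
have ck : continuous k.
  move=> x; apply: cvgM; first exact: cvg_cst.
  apply: cvgM; first exact: cvg_id.
  by apply: (continuous_comp (cn x)); exact: cont_Wt.
have hle x : -1 <= h x <= 0.
  by rewrite /h lerN2 oppr_le0 invr_ge0 (ltW (den_gt0 _ _)) andbT invf_le1 ?den_ge1 // den_gt0.
have FTC (q l : R -> R) u v : (forall x, is_derive x (1 : R) q (l x)) -> continuous l ->
    u < v -> (\int[L1]_(x in `[u, v]) (l x)%:E = (q v - q u)%:E)%E.
  move=> ql cl uv.
  have cq : continuous q by apply: derivable_cont1 => x; have [] := ql x.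
  rewrite (@continuous_FTC2 _ l q) ?EFinB //.
  - exact: continuous_subspaceT.
  - split.
    + by move=> x _; have [] := ql x.
    + by apply: cvg_at_right_filter; exact: cq.
    + by apply: cvg_at_left_filter; exact: cq.
  - by move=> x _; rewrite (is_derive_derive1 ql).
have hkN x : is_derive x (1 : R) (fun x => - h x) (- k x) by exact: is_deriveN.
have ckN : continuous (fun x => - k x) by move=> x; apply: cvgN; exact: ck.
have mk : measurable_fun setT k by exact: continuous_measurable_fun.
have mpat (A : set R) (f : R -> R) : measurable A -> measurable_fun setT f ->
    measurable_fun setT ((fun x => (f x)%:E) \_ A).
  move=> mA mf; apply/(measurable_restrictT _ _).1 => //.
  by apply/measurable_EFinP; apply: measurable_funTS.
have mNk : measurable_fun setT (fun x => - k x) by exact: measurableT_comp.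
have k0 x : 0 <= x -> 0 <= k x.
  by move=> x0; rewrite mulr_ge0 ?divr_ge0 ?(ltW alpha0) // mulr_ge0 // Wt_ge0.
have k0' x : x <= 0 -> 0 <= - k x.
  move=> x0; rewrite /k oppr_ge0 mulr_ge0_le0 ?divr_ge0 ?(ltW alpha0) //.
  by rewrite mulr_le0_ge0 // Wt_ge0.
have A0 x : (0 <= ((fun x => (k x)%:E) \_ `[0%R, a]) x)%E.
  rewrite patchE; case: ifPn => //; rewrite inE /= in_itv/= => /andP[x0 _].
  by rewrite lee_fin k0.
have B0 x : (0 <= ((fun x => (- k x)%:E) \_ `[(- a)%R, 0%R]) x)%E.
  rewrite patchE; case: ifPn => //; rewrite inE /= in_itv/= => /andP[_ x0].
  by rewrite lee_fin k0'.
apply: (@le_trans _ _ (\int[L1]_x ((2 / alpha)%:E * (((fun x => (k x)%:E) \_ `[0%R, a]) x +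
    ((fun x => (- k x)%:E) \_ `[(- a)%R, 0%R]) x)))%E).
  apply: ge0_le_int => x; first (rewrite lee_fin; apply: mulr_ge0; last exact: ind_ge0).
    by apply: mulr_ge0 => //; exact: Wt_ge0.
  have [xa|xa] := leP `|x| a; last first.
    rewrite (ind0 xa) mulr0; apply: mule_ge0; last exact: adde_ge0.
    by rewrite lee_fin divr_ge0 ?(ltW alpha0).
  rewrite (ind1 xa) mulr1.
  have kE : `|x| * Wt lam (x ^+ 2 + y ^+ 2) = 2 / alpha * `|k x|.
    rewrite /k; have := Wt_ge0 lam (x ^+ 2 + y ^+ 2); move: (Wt _ _) => w w0.
    have a2 : 0 <= alpha / 2 by rewrite divr_ge0 // ltW.
    rewrite normrM (ger0_norm a2) normrM (ger0_norm w0); field.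
    by rewrite gt_eqF.
  rewrite kE EFinM; apply: lee_wpmul2l; first by rewrite lee_fin divr_ge0 ?(ltW alpha0).
  move: (xa); rewrite ler_norml => /andP[x1 x2].
  have [x0|x0] := leP 0 x.
    have p1 : ((fun x => (k x)%:E) \_ `[0%R, a]) x = (k x)%:E.
      by rewrite patchE mem_set //= in_itv/= x0.
    by rewrite (ger0_norm (k0 _ x0)) p1; apply: leeDl; exact: B0.
  have p1 : ((fun x => (- k x)%:E) \_ `[(- a)%R, 0%R]) x = (- k x)%:E.
    by rewrite patchE mem_set //= in_itv/= x1 ltW.
  have kn : `|k x| = - k x by rewrite ler0_norm // -oppr_ge0 k0' // ltW.
  by rewrite kn p1; apply: leeDr; exact: A0.
rewrite ge0_integralZl //=; last 3 first.
- by apply: emeasurable_funD; apply: mpat.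
- by move=> x _; rewrite adde_ge0.
- by rewrite lee_fin divr_ge0 ?(ltW alpha0).
rewrite ge0_integralD //=; [|exact: mpat|exact: mpat].
rewrite -!integral_mkcond (FTC _ _ _ _ hk ck) // (FTC _ _ _ _ hkN ckN) ?oppr_lt0 //.
rewrite -EFinD -EFinM lee_fin.
have /andP[h1 h2] := hle 0; have /andP[h3 h4] := hle a; have /andP[h5 h6] := hle (- a).
rewrite (_ : 4 / alpha = 2 / alpha * 2); last by field; rewrite gt_eqF.
have a2 : 0 <= 2 / alpha by rewrite divr_ge0 // ltW.
apply: (ler_wpM2l a2).
move: h1 h2 h3 h4 h5 h6; move: (h 0) (h a) (h (- a)); clear => u v w *; lra.
Qed.

End TV.

(** * Decay of the Fourier transforms of a family *)

Section Decay.
Context (R : realType) (alpha : R).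
Hypothesis alpha0 : 0 < alpha.
Local Notation L1 := (@lebesgue_measure R).
Local Notation L3 := (@leb3 R).
Local Notation normc := ComplexField.Normc.normc.
Implicit Types (X Y T : R -> R) (F G : R -> R3 R -> R) (p : R3 R) (lam : R).
Local Notation del := (del alpha).
Local Notation mu := (mu alpha).
Local Notation om := (om alpha).
Local Notation family := (family alpha).
Local Notation Wt := (Wt alpha).
Local Notation bd := (bd alpha).

Lemma ge0_intZ d (T : measurableType d) (m : {measure set T -> \bar R}) (k : R) (u : T -> R) :
  0 <= k -> measurable_fun setT u -> (forall x, 0 <= u x) ->
  (\int[m]_x (k * u x)%:E = k%:E * \int[m]_x (u x)%:E)%E.
Proof.
move=> k0 mu u0; rewrite -ge0_integralZl //; first exact/measurable_EFinP.
by move=> x _; rewrite lee_fin.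
Qed.

Lemma ge0_intD d (T : measurableType d) (m : {measure set T -> \bar R}) (u v : T -> R) :
  measurable_fun setT u -> measurable_fun setT v -> (forall x, 0 <= u x) -> (forall x, 0 <= v x) ->
  (\int[m]_x (u x + v x)%:E = \int[m]_x (u x)%:E + \int[m]_x (v x)%:E)%E.
Proof.
move=> mu mv u0 v0; rewrite -ge0_integralD //.
- by move=> x _; rewrite lee_fin.
- exact/measurable_EFinP.
- by move=> x _; rewrite lee_fin.
- exact/measurable_EFinP.
Qed.

Lemma int3_grad lam a b : 0 < a -> 0 <= b ->
  (\int[L3]_p ((`|cx p| * Wt lam (nsq p)) * bx a b p)%:E <= (16 / alpha * a * b)%:E)%E /\
  (\int[L3]_p ((`|cy p| * Wt lam (nsq p)) * bx a b p)%:E <= (16 / alpha * a * b)%:E)%E.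
Proof.
move=> a0 b0.
have mW (l : R3 R -> R) : measurable_fun setT l ->
    measurable_fun setT (fun p => ((`|l p| * Wt lam (nsq p)) * bx a b p)%:E).
  move=> ml; apply/measurable_EFinP; apply: measurable_funM; last exact: meas_bx.
  apply: measurable_funM; first exact: measurableT_comp.
  by apply: meas_comp1; [exact: cont_Wt|exact: meas_nsq].
have pos (l : R3 R -> R) p : (0 <= ((`|l p| * Wt lam (nsq p)) * bx a b p)%:E)%E.
  by rewrite lee_fin; apply: mulr_ge0; [apply: mulr_ge0 => //; exact: Wt_ge0|exact: bx_ge0].
have mind c d : measurable_fun setT (fun x => (c * ind d x)%:E).
  by apply/measurable_EFinP; apply: measurable_funM => //; exact: meas_ind.
have Zind c d : 0 <= c -> 0 <= d -> (\int[L1]_x (c * ind d x)%:E = (c * (2 * d))%:E)%E.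
  move=> c0 d0; rewrite ge0_intZ ?integral_ind //; exact: meas_ind.
have a40 : 0 <= 4 / alpha by rewrite divr_ge0 // ltW.
have inner (t y : R) :
   (\int[L1]_x (`|x| * Wt lam (x ^+ 2 + y ^+ 2) * (ind a x * ind a y * ind b t))%:E
     <= (4 / alpha * ind b t * ind a y)%:E)%E.
  apply: (@le_trans _ _ (\int[L1]_x ((ind b t * ind a y)%:E * (`|x| * Wt lam (x ^+ 2 + y ^+ 2) * ind a x)%:E))%E).
    apply: ge0_le_int => x.
      rewrite lee_fin; apply: mulr_ge0; last by rewrite !mulr_ge0 ?ind_ge0.
      by apply: mulr_ge0 => //; exact: Wt_ge0.
    rewrite -EFinM lee_fin; apply: le_eq.
    by move: (Wt _ _) => w; ring.
  under eq_integral do rewrite -EFinM.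
  rewrite ge0_intZ ?mulr_ge0 ?ind_ge0 //; last 2 first.
  - apply: measurable_funM; last exact: meas_ind.
    apply: measurable_funM.
      by apply: continuous_measurable_fun => x; apply: cvg_norm; exact: cvg_id.
    apply: (@measurableT_comp _ _ _ _ _ _ (Wt lam)); last first.
      by apply: measurable_funD => //; exact: measurable_funX.
    by apply: continuous_measurable_fun; exact: cont_Wt.
  - move=> x; apply: mulr_ge0; last exact: ind_ge0.
    by apply: mulr_ge0 => //; exact: Wt_ge0.
  apply: (@le_trans _ _ ((ind b t * ind a y)%:E * (4 / alpha)%:E)%E).
    apply: lee_wpmul2l; first by rewrite lee_fin mulr_ge0 ?ind_ge0.
    exact: int1_grad.
  by rewrite -EFinM lee_fin; apply: le_eq; ring.
have outer (g : R -> R -> R -> R) : (forall t y x, 0 <= g t y x) ->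
    (forall t y, (\int[L1]_x (g t y x)%:E <= (4 / alpha * ind b t * ind a y)%:E)%E) ->
    (\int[L1]_t \int[L1]_y \int[L1]_x (g t y x)%:E <= (16 / alpha * a * b)%:E)%E.
  move=> g0 hg.
  apply: (@le_trans _ _ (\int[L1]_t (4 / alpha * (2 * a) * ind b t)%:E)%E).
    apply: ge0_le_int => t.
      by apply: integral_ge0 => y _; apply: integral_ge0 => x _; rewrite lee_fin.
    apply: (@le_trans _ _ (\int[L1]_y (4 / alpha * ind b t * ind a y)%:E)%E).
      apply: ge0_le_int => y //.
      by apply: integral_ge0 => x _; rewrite lee_fin.
    have c1 : 0 <= 4 / alpha * ind b t by rewrite mulr_ge0 ?ind_ge0.
    rewrite (Zind _ _ c1 (ltW a0)) lee_fin; apply: le_eq; ring.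
  have c2 : 0 <= 4 / alpha * (2 * a) by rewrite mulr_ge0 // mulr_ge0 // ltW.
  rewrite (Zind _ _ c2 b0) lee_fin; apply: le_eq; ring.
split.
  rewrite tonelli_tyx; [|by apply: mW; exact: meas_cx|by move=> p; exact: (pos (@cx R))].
  apply: (outer (fun t y x => `|x| * Wt lam (x ^+ 2 + y ^+ 2) * (ind a x * ind a y * ind b t))) => //.
  move=> t y x; apply: mulr_ge0; last by rewrite !mulr_ge0 ?ind_ge0.
  by apply: mulr_ge0 => //; exact: Wt_ge0.
rewrite tonelli_txy; [|by apply: mW; exact: meas_cy|by move=> p; exact: (pos (@cy R))].
apply: (outer (fun t x y => `|y| * Wt lam (x ^+ 2 + y ^+ 2) * (ind a x * ind a y * ind b t))) => //.
  move=> t y x; apply: mulr_ge0; last by rewrite !mulr_ge0 ?ind_ge0.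
  by apply: mulr_ge0 => //; exact: Wt_ge0.
move=> t x; apply: le_trans (inner t x); apply: ge0_le_int => y.
  rewrite lee_fin; apply: mulr_ge0; last by rewrite !mulr_ge0 ?ind_ge0.
  by apply: mulr_ge0 => //; exact: Wt_ge0.
rewrite lee_fin (addrC (x ^+ 2)) (mulrC (ind a x)) //.
Qed.

Lemma bxE a b p : bx a b p = zbx a p * ind b (ct p). Proof. by []. Qed.

(** The layer has width [1 / mu]: the gradient bound [om_le_grad] reduces the claim
    to the total variation [int1_grad] along horizontal and vertical lines. *)
Lemma int3_om r b : 0 < r -> 0 <= b -> exists2 K, 0 <= K & forall lam, 1 <= lam ->
  (\int[L3]_p (om lam (nsq p) * bx (r * del lam) b p)%:E <= (K * (del lam / mu lam))%:E)%E.
Proof.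
move=> r0 b0; have [K K0 HK] := om_le_grad alpha0 r0.
exists (K * (32 / alpha * r * b)); first by rewrite !mulr_ge0 ?invr_ge0 ?(ltW r0) ?(ltW alpha0).
move=> lam l1; have d0 := del_gt0 alpha lam; have m0 := mu_gt0 alpha l1.
have a0 : 0 < r * del lam by rewrite mulr_gt0.
have [h1 h2] := int3_grad lam a0 b0.
have mW (l : R3 R -> R) : measurable_fun setT l ->
    measurable_fun setT (fun p => ((`|l p| * Wt lam (nsq p)) * bx (r * del lam) b p)).
  move=> ml; apply: measurable_funM; last exact: meas_bx.
  apply: measurable_funM; first exact: measurableT_comp.
  by apply: meas_comp1; [exact: cont_Wt|exact: meas_nsq].
have pos (l : R3 R -> R) p : (0 <= ((`|l p| * Wt lam (nsq p)) * bx (r * del lam) b p)).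
  by apply: mulr_ge0; [apply: mulr_ge0 => //; exact: Wt_ge0|exact: bx_ge0].
have Km : 0 <= K / mu lam by rewrite divr_ge0 // ltW.
have mX := mW _ (@meas_cx R); have mY := mW _ (@meas_cy R).
apply: (@le_trans _ _ (\int[L3]_p (K / mu lam * (`|cx p| * Wt lam (nsq p) * bx (r * del lam) b p
   + `|cy p| * Wt lam (nsq p) * bx (r * del lam) b p))%:E)%E).
  apply: ge0_le_int => p.
    by rewrite lee_fin; apply: mulr_ge0; [exact: om_ge0|exact: bx_ge0].
  rewrite lee_fin bxE.
  have := ler_wpM2r (ind_ge0 b (ct p)) (HK lam p l1).
  by move: (om _ _) (Wt _ _) (zbx _ _) => o w z h; rewrite mulrA (le_trans h) //; apply: le_eq; ring.
rewrite ge0_intZ //; last 2 first.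
- exact: measurable_funD.
- by move=> p; apply: addr_ge0; [exact: (pos (@cx R))|exact: (pos (@cy R))].
have ED := ge0_intD L3 mX mY (pos (@cx R)) (pos (@cy R)).
rewrite /= in ED; rewrite ED.
apply: (@le_trans _ _ ((K / mu lam)%:E * ((16 / alpha * (r * del lam) * b)%:E + (16 / alpha * (r * del lam) * b)%:E))%E).
  by apply: lee_wpmul2l; [rewrite lee_fin|exact: leeD].
rewrite -EFinD -EFinM lee_fin; apply: le_eq; ring.
Qed.

(** The size of the [L^1] norm of a class of amplitudes. *)
Definition nrm t lam : R := match t with
  | gen => del lam ^+ 2 | flat => del lam / mu lam | far => expR (- (kap alpha * lam)) * del lam ^+ 2 end.

Lemma bump_bound T : bump1 T -> exists B b, [/\ 0 <= B, 0 <= b & forall x, `|T x| <= B * ind b x].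
Proof.
move=> bT; have [B B0 TB] := bump_bounded bT; case: bT => _ [b b0 T0].
exists B, b; split => // x; have [xb|xb] := leP `|x| b; first by rewrite ind1 ?mulr1.
by rewrite T0 // normr0 mulr_ge0 ?ind_ge0.
Qed.

Lemma family_bx t F T : family t F -> bump1 T -> exists C r b, [/\ 0 <= C, 0 < r, 0 <= b &
  forall lam p, 1 <= lam -> `|F lam p * T (ct p)| <= C * (bd t lam p * bx (r * del lam) b p)].
Proof.
move=> /(family_bound alpha0)[C [r [C0 r0 FC]]] /bump_bound[B [b [B0 b0 TB]]].
exists (C * B), (r + 1), b; split; rewrite ?mulr_ge0 ?ltr_wpDl // => lam p l1.
have d0 := del_gt0 alpha lam.
rewrite normrM bxE.
have -> : C * B * (bd t lam p * (zbx ((r + 1) * del lam) p * ind b (ct p))) =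
  C * bd t lam p * zbx ((r + 1) * del lam) p * (B * ind b (ct p)) by move: (bd _ _ _) => *; ring.
apply: ler_pM => //; apply: le_trans (FC lam p l1) _.
apply: ler_wpM2l; first by apply: mulr_ge0 => //; exact: bd_ge0.
by apply: zbx_mono; rewrite ler_wpM2r ?(ltW d0) // lerDl.
Qed.

Lemma bd_le1 t lam p : 1 <= lam -> bd t lam p <= 1.
Proof.
move=> l1; case: t => //=; first exact: om_le1.
by rewrite -expR0 ler_expR oppr_le0 mulr_ge0 ?(ltW (kap_gt0 alpha0)) // (le_trans _ l1).
Qed.

Lemma meas_T T : bump1 T -> measurable_fun setT (fun p : R3 R => T (ct p)).
Proof. by move=> [sT _]; apply: meas_comp1; [exact: smooth1_cont|exact: meas_ct]. Qed.

Lemma family_tame t F T lam : family t F -> bump1 T -> 1 <= lam -> tame (fun p => F lam p * T (ct p)).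
Proof.
move=> cF bT l1; split.
  by apply: measurable_funM; [exact: family_meas cF|exact: meas_T].
have [C [r [b [C0 r0 b0 FC]]]] := family_bx cF bT.
have d0 := del_gt0 alpha lam.
exists C, (r * del lam + b); split => //; first by rewrite addr_ge0 // mulr_ge0 // ltW.
move=> p; apply: le_trans (FC lam p l1) _; apply: ler_wpM2l => //.
rewrite -[leRHS]mul1r; apply: ler_pM; [exact: bd_ge0|exact: bx_ge0|exact: bd_le1|].
by apply: bx_mono; rewrite ?lerDl ?lerDr ?mulr_ge0 // ltW.
Qed.

Lemma meas_bd t lam : measurable_fun setT (bd t lam).
Proof.
case: t; [exact: measurable_cst| |exact: measurable_cst].
apply: (@meas_comp1 R (om lam) (@nsq R)); last exact: meas_nsq.
move=> x; apply: cvgM.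
  apply: cvgM; first exact: cvg_cst.
  by apply: smooth1_cont; apply: smooth1_fl => //; rewrite invr_gt0.
apply: cvgV; first by rewrite expf_neq0 // gt_eqF // (den_gt0 alpha lam).
by apply: cvgM; exact: (cont_den alpha0).
Qed.

Lemma family_L1 t F T : family t F -> bump1 T -> exists2 C, 0 <= C & forall lam, 1 <= lam ->
  (\int[L3]_p (`|F lam p * T (ct p)|)%:E <= (C * nrm t lam)%:E)%E.
Proof.
move=> cF bT; have [C [r [b [C0 r0 b0 FC]]]] := family_bx cF bT.
suff [K K0 HK] : exists2 K, 0 <= K & forall lam, 1 <= lam ->
    (\int[L3]_p (bd t lam p * bx (r * del lam) b p)%:E <= (K * nrm t lam)%:E)%E.
  exists (C * K); first exact: mulr_ge0.
  move=> lam l1.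
  have pos p : (0 <= (bd t lam p * bx (r * del lam) b p)%:E)%E.
    by rewrite lee_fin; apply: mulr_ge0; [exact: bd_ge0|exact: bx_ge0].
  apply: (@le_trans _ _ (\int[L3]_p (C * (bd t lam p * bx (r * del lam) b p))%:E)%E).
    by apply: ge0_le_int => p; rewrite ?lee_fin // FC.
  rewrite ge0_intZ //.
  - rewrite -mulrA EFinM; apply: lee_wpmul2l; [by rewrite lee_fin|exact: HK].
  - apply: measurable_funM; last exact: meas_bx.
    exact: meas_bd.
have cst_case (c : R -> R) : (forall lam, 0 <= c lam) -> exists2 K, 0 <= K & forall lam, 1 <= lam ->
    (\int[L3]_p (c lam * bx (r * del lam) b p)%:E <= (K * (c lam * del lam ^+ 2))%:E)%E.
  move=> c0; exists (8 * r ^+ 2 * b); first by apply: mulr_ge0 => //; apply: mulr_ge0 => //; exact: sqr_ge0.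
  move=> lam l1; have d0 := del_gt0 alpha lam.
  rewrite ge0_intZ //; [|exact: meas_bx|exact: bx_ge0].
  rewrite int_bx // ?mulr_ge0 ?(ltW r0) ?(ltW d0) // -EFinM lee_fin.
  by apply: le_eq; ring.
case: t {cF FC}.
- have [K K0 HK] := cst_case (fun=> 1) (fun=> ler01).
  by exists K => // lam l1; have := HK lam l1; rewrite /= mul1r.
- exact: int3_om.
- exact: (cst_case (fun lam => expR (- (kap alpha * lam))) (fun=> expR_ge0 _)).
Qed.

(** The modulus of the transform; [F] is an amplitude in [z], and [T] a profile in
    [t] that does not depend on [lam]. *)
Definition FT F T lam xi : R := normc (fourier (cplx (fun p => F lam p * T (ct p))) xi).

Lemma normcM (a b : R[i]) : normc (a * b) = normc a * normc b.
Proof. exact: ComplexField.Normc.normcM. Qed.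
Lemma normc_ge0 (a : R[i]) : 0 <= normc a.
Proof. by case: a => x y; exact: sqrtr_ge0. Qed.
Lemma normc_real (x : R) : normc (x%:C%C) = `|x|.
Proof. by rewrite /normc /= expr0n /= addr0 sqrtr_sqr. Qed.
Lemma normci : normc ('i%C : R[i]) = 1.
Proof. by rewrite /normc /= expr0n /= expr1n add0r sqrtr1. Qed.
Lemma normcD (a b : R[i]) : normc (a + b) <= normc a + normc b.
Proof.
have := ler_normD a b; rewrite -!/(normc _) /=.
by rewrite -[`|a + b|]/((normc (a + b))%:C%C) -[`|a|]/((normc a)%:C%C) -[`|b|]/((normc b)%:C%C) -rmorphD /= lecR.
Qed.

Lemma FT_ge0 F T lam xi : 0 <= FT F T lam xi. Proof. exact: normc_ge0. Qed.

Lemma FT_deriv_t t F T lam xi : family t F -> bump1 T -> 1 <= lam ->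
  FT F T lam xi * `|xi.2| = FT F (T^`())%classic lam xi.
Proof.
move=> cF bT l1; have l0 : 0 < lam by exact: lt_le_trans l1.
have D Z p : smooth1 Z -> is_derive p et (fun q => F lam q * Z (ct q)) (F lam p * (Z^`())%classic (ct p)).
  move=> sZ; have D := is_derive_mul (family_derive_et p cF l0)
    (is_derive_comp1 (is_derive_ct p et) (smooth1_is_derive (ct p) sZ)).
  by apply: is_derive_eq D _; rewrite mul0r add0r /ct /= mulr1.
have [sT _] := bT.
have etb : et \in @basis3 R by rewrite !inE eqxx !orbT.
have t1 := family_tame cF bT l1; have t2 := family_tame cF (bump_derive bT) l1.
have dK p : derivable (fun q => F lam q * (T^`())%classic (ct q)) p et.
  by have [] := D _ p (smooth1_derive sT).
rewrite /FT (fourier_deriv xi etb t1 t2 (fun p => D T p sT) dK).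
rewrite normcM normcM normci mul1r normc_real mulrC; congr (`|_| * _).
by rewrite /dot3 /et /=; ring.
Qed.

Lemma flat_gen : flat <> gen. Proof. by []. Qed.
Lemma far_gen : far <> gen. Proof. by []. Qed.

Section Direction.
Variables (e : R3 R) (eb : e \in @basis3 R) (et0 : ct e = 0).
Hypothesis family_derive_e : forall t F, t <> gen -> family t F -> exists2 G, family t G &
  forall lam p, 1 <= lam -> is_derive p e (F lam) (mu lam * G lam p).
Hypothesis family_derive_e_gen : forall F, family gen F -> exists G1 G2, [/\ family flat G1, family gen G2 &
  forall lam p, 1 <= lam ->
    is_derive p e (F lam) (mu lam * G1 lam p + (del lam)^-1 * G2 lam p)].

Let is_derive_FT (F : R3 R -> R) T p (d : R) : smooth1 T -> is_derive p e F d ->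
  is_derive p e (fun q => F q * T (ct q)) (d * T (ct p)).
Proof.
move=> sT dF; have D := is_derive_mul dF
    (is_derive_comp1 (is_derive_ct p e) (smooth1_is_derive (ct p) sT)).
by apply: is_derive_eq D _; rewrite et0 !mulr0 addr0.
Qed.

Lemma FT_deriv_e t F G T lam xi : t <> gen -> family t F -> family t G -> bump1 T -> 1 <= lam ->
  (forall lam p, 1 <= lam -> is_derive p e (F lam) (mu lam * G lam p)) ->
  FT F T lam xi * `|dot3 e xi| = mu lam * FT G T lam xi.
Proof.
move=> tg cF cG bT l1 dF; have m0 := mu_gt0 alpha l1; have [sT _] := bT.
have E : fourier (cplx (fun p => mu lam * (G lam p * T (ct p)))) xi =
   ('i%C * (dot3 e xi)%:C%C) * fourier (cplx (fun p => F lam p * T (ct p))) xi.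
  have t1 := family_tame cF bT l1; have t2 := tame_scale (mu lam) (family_tame cG bT l1).
  have HK p : is_derive p e (fun p => F lam p * T (ct p)) (mu lam * (G lam p * T (ct p))).
    by rewrite mulrA; apply: is_derive_FT => //; exact: dF.
  have dK p : derivable (fun p => mu lam * (G lam p * T (ct p))) p e.
    have [G' _ dG] := family_derive_e tg cG.
    by have [] := is_derive_scale (mu lam) (is_derive_FT sT (dG lam p l1)).
  exact: (fourier_deriv xi eb t1 t2 HK dK).
have E2 : fourier (cplx (fun p => mu lam * (G lam p * T (ct p)))) xi =
   (mu lam)%:C%C * fourier (cplx (fun p => G lam p * T (ct p))) xi.
  rewrite -fourierZ; last by apply: tameC_real; exact: family_tame cG bT l1.
  by congr (fourier _ _); apply/funext => p; rewrite /cplx -rmorphM.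
rewrite /FT mulrC -(normc_real (dot3 e xi)) -[normc _ * _]mul1r -normci -!normcM mulrA -E E2 normcM normc_real.
by rewrite gtr0_norm.
Qed.

(** The transform of a bounded amplitude times [xi_e] splits according to
    [family_derive_ex_gen]. *)
Lemma FT_deriv_e_gen F G1 G2 T lam xi : family gen F -> family flat G1 -> family gen G2 -> bump1 T -> 1 <= lam ->
  (forall lam p, 1 <= lam -> is_derive p e (F lam) (mu lam * G1 lam p + (del lam)^-1 * G2 lam p)) ->
  FT F T lam xi * `|dot3 e xi| <= mu lam * FT G1 T lam xi + (del lam)^-1 * FT G2 T lam xi.
Proof.
move=> cF cG1 cG2 bT l1 dF; have m0 := mu_gt0 alpha l1; have [sT _] := bT.
have d0 := del_gt0 alpha lam.
pose K p := mu lam * (G1 lam p * T (ct p)) + (del lam)^-1 * (G2 lam p * T (ct p)).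
have t1 := family_tame cG1 bT l1. have t2 := family_tame cG2 bT l1.
have E : fourier (cplx K) xi =
   ('i%C * (dot3 e xi)%:C%C) * fourier (cplx (fun p => F lam p * T (ct p))) xi.
  have t3 := family_tame cF bT l1.
  have t4 : tame K by apply: tame_add; apply: tame_scale.
  have HK p : is_derive p e (fun p => F lam p * T (ct p)) (K p).
    by rewrite /K !mulrA -mulrDl; apply: is_derive_FT => //; exact: dF.
  have fg : flat <> gen by [].
  have dK p : derivable K p e.
    have [G' _ dG] := family_derive_e fg cG1.
    have [G2' [G2'' [_ _ dG2]]] := family_derive_e_gen cG2.
    by have [] := is_derive_add (is_derive_scale (mu lam) (is_derive_FT sT (dG lam p l1)))
      (is_derive_scale (del lam)^-1 (is_derive_FT sT (dG2 lam p l1))).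
  exact: (fourier_deriv xi eb t3 t4 HK dK).
have E2 : fourier (cplx K) xi =
   (mu lam)%:C%C * fourier (cplx (fun p => G1 lam p * T (ct p))) xi +
   ((del lam)^-1)%:C%C * fourier (cplx (fun p => G2 lam p * T (ct p))) xi.
  rewrite -!fourierZ; [|exact: tameC_real|exact: tameC_real].
  rewrite -fourierD; [|by apply: tameC_scale; exact: tameC_real|by apply: tameC_scale; exact: tameC_real].
  by congr (fourier _ _); apply/funext => p; rewrite /cplx /K rmorphD !rmorphM.
rewrite /FT mulrC -(normc_real (dot3 e xi)) -[normc _ * _]mul1r -normci -!normcM mulrA -E E2.
rewrite (le_trans (normcD _ _)) // normcM normcM !normc_real gtr0_norm //.
by rewrite gtr0_norm // invr_gt0.
Qed.

Lemma decay_t t F T M : family t F -> bump1 T -> exists2 C, 0 <= C & forall lam xi, 1 <= lam ->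
  FT F T lam xi * `|xi.2| ^+ M <= C * nrm t lam.
Proof.
move=> cF; elim: M T => [|M IH] T bT.
  have [C C0 HC] := family_L1 cF bT; exists (2 * C); first by rewrite mulr_ge0.
  move=> lam xi l1; rewrite expr0 mulr1 -mulrA; apply: fourier_bound; first exact: family_tame cF bT l1.
  exact: HC.
have [C C0 HC] := IH _ (bump_derive bT); exists C => // lam xi l1.
by rewrite exprS mulrA (FT_deriv_t xi cF bT l1) HC.
Qed.

Lemma decay_ng t F T j M : t <> gen -> family t F -> bump1 T -> exists2 C, 0 <= C & forall lam xi, 1 <= lam ->
  FT F T lam xi * `|dot3 e xi| ^+ j * `|xi.2| ^+ M <= C * nrm t lam * mu lam ^+ j.
Proof.
move=> tg cF bT; elim: j F cF => [|j IH] F cF.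
  have [C C0 HC] := decay_t M cF bT; exists C => // lam xi l1.
  by rewrite !expr0 !mulr1 HC.
have [G cG dG] := family_derive_e tg cF; have [C C0 HC] := IH _ cG.
exists C => // lam xi l1.
rewrite exprS mulrA (FT_deriv_e xi tg cF cG bT l1 dG).
have m0 := mu_gt0 alpha l1; have h := ler_wpM2l (ltW m0) (HC lam xi l1).
rewrite (_ : _ * _ * _ * _ = mu lam * (FT G T lam xi * `|dot3 e xi| ^+ j * `|xi.2| ^+ M)).
  by apply: le_trans h _; rewrite exprS; apply: le_eq; ring.
by ring.
Qed.

(** The derivatives are taken one at a time.  The part concentrated in the layer has
    [L^1] norm [del / mu], and leaves for good with [decay_ng]; the other part only
    costs [1 / del] per derivative. *)
Lemma decay_gen F T j M : family gen F -> bump1 T -> exists2 C, 0 <= C & forall lam xi, 1 <= lam ->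
  FT F T lam xi * `|dot3 e xi| ^+ j * `|xi.2| ^+ M <=
  C * (if j is j'.+1 then del lam * mu lam ^+ j' else del lam ^+ 2).
Proof.
move=> cF bT; elim: j F cF => [|j IH] F cF.
  have [C C0 HC] := decay_t M cF bT; exists C => // lam xi l1.
  by rewrite !expr0 !mulr1 HC.
have [G1 [G2 [cG1 cG2 dG]]] := family_derive_e_gen cF; have [C C0 HC] := IH _ cG2.
have [C1 C10 HC1] := @decay_ng flat G1 T j M flat_gen cG1 bT.
exists (C + C1); first by rewrite addr_ge0.
move=> lam xi l1; have m0 := mu_gt0 alpha l1; have d0 := del_gt0 alpha lam.
rewrite exprS mulrA.
have h := FT_deriv_e_gen xi cF cG1 cG2 bT l1 dG.
have q0 : 0 <= `|dot3 e xi| ^+ j * `|xi.2| ^+ M by rewrite mulr_ge0 ?exprn_ge0.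
apply: (@le_trans _ _ ((mu lam * FT G1 T lam xi + (del lam)^-1 * FT G2 T lam xi) *
   (`|dot3 e xi| ^+ j * `|xi.2| ^+ M))).
  by rewrite -mulrA ler_wpM2r.
rewrite mulrDl addrC mulrDl; apply: lerD.
  have -> : (del lam)^-1 * FT G2 T lam xi * (`|dot3 e xi| ^+ j * `|xi.2| ^+ M) =
    (del lam)^-1 * (FT G2 T lam xi * `|dot3 e xi| ^+ j * `|xi.2| ^+ M) by ring.
  rewrite mulrC ler_pdivrMr //; apply: le_trans (HC lam xi l1) _.
  (* Here [1 / del <= mu], because [mu * del = lam >= 1]. *)
  rewrite -mulrA ler_wpM2l //; case: j {IH HC HC1 q0} => [|j]; first by rewrite expr0 mulr1 expr2.
  have ml : mu lam * del lam = lam by rewrite muE divfK // gt_eqF.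
  rewrite exprSr mulrA -[leRHS]mulrA ml ler_peMr // mulr_ge0 ?exprn_ge0 //; exact: ltW.
rewrite -mulrA.
have -> : FT G1 T lam xi * (`|dot3 e xi| ^+ j * `|xi.2| ^+ M) =
    FT G1 T lam xi * `|dot3 e xi| ^+ j * `|xi.2| ^+ M by ring.
rewrite mulrC -ler_pdivlMr //; apply: le_trans (HC1 lam xi l1) _ => /=.
apply: le_eq; field.
by rewrite gt_eqF.
Qed.

(** The coefficient in the decay estimate [decay] of a class. *)
Definition Dn t lam : R := match t with
  | far => expR (- (kap alpha * lam)) * del lam ^+ 2 * mu lam | _ => del lam end.

(** The exponent [j.-1] instead of [j] is the gain due to the concentration in the
    layer; without it the integral of the squares would lose a power of [mu]. *)
Lemma decay t F T j M : family t F -> bump1 T -> exists2 C, 0 <= C & forall lam xi, 1 <= lam ->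
  FT F T lam xi * `|dot3 e xi| ^+ j * `|xi.2| ^+ M <= C * Dn t lam * mu lam ^+ j.-1.
Proof.
move=> cF bT.
have m1 lam : 1 <= lam -> 1 <= mu lam by exact: mu_ge1.
case: t cF => cF.
- have [C C0 HC] := decay_gen j M cF bT; exists C => // lam xi l1.
  apply: le_trans (HC lam xi l1) _; rewrite -mulrA ler_wpM2l //.
  case: j {HC} => [|j] //=; rewrite expr0 mulr1 expr2 ler_piMr ?del_le1 //.
  exact/ltW/del_gt0.
- have [C C0 HC] := @decay_ng flat F T j M flat_gen cF bT; exists C => // lam xi l1.
  have m0 := mu_gt0 alpha l1; have d0 := del_gt0 alpha lam.
  apply: le_trans (HC lam xi l1) _; rewrite /nrm /Dn -!mulrA ler_wpM2l // ler_wpM2l ?(ltW d0) //.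
  case: j {HC} => [|j] /=; first by rewrite !expr0 mulr1 invf_le1 // m1.
  by rewrite exprS mulKf ?gt_eqF.
- have [C C0 HC] := @decay_ng far F T j M far_gen cF bT; exists C => // lam xi l1.
  have m0 := mu_gt0 alpha l1; have d0 := del_gt0 alpha lam.
  apply: le_trans (HC lam xi l1) _; rewrite /nrm /Dn -!mulrA ler_wpM2l //.
  rewrite ler_wpM2l ?expR_ge0 // ler_wpM2l ?(ltW d0) // ler_wpM2l ?(ltW d0) //.
  by case: j {HC} => [|j]; [rewrite !expr0 mulr1; exact: m1|rewrite exprS mulrA].
Qed.

End Direction.

Lemma decay_x t F T j M : family t F -> bump1 T -> exists2 C, 0 <= C & forall lam xi, 1 <= lam ->
  FT F T lam xi * `|xi.1.1| ^+ j * `|xi.2| ^+ M <= C * Dn t lam * mu lam ^+ j.-1.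
Proof.
move=> cF bT.
have [C C0 HC] := @decay ex (mem_head _ _) erefl (family_derive_ex alpha0) (family_derive_ex_gen alpha0) t F T j M cF bT.
exists C => // lam xi l1; have := HC lam xi l1.
by rewrite (_ : dot3 ex xi = xi.1.1) // /dot3 /=; ring.
Qed.

Lemma decay_y t F T j M : family t F -> bump1 T -> exists2 C, 0 <= C & forall lam xi, 1 <= lam ->
  FT F T lam xi * `|xi.1.2| ^+ j * `|xi.2| ^+ M <= C * Dn t lam * mu lam ^+ j.-1.
Proof.
move=> cF bT.
have eyb : ey \in @basis3 R by rewrite !inE eqxx orbT.
have [C C0 HC] := @decay ey eyb erefl (family_derive_ey alpha0) (family_derive_ey_gen alpha0) t F T j M cF bT.
exists C => // lam xi l1; have := HC lam xi l1.
by rewrite (_ : dot3 ey xi = xi.1.2) // /dot3 /=; ring.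
Qed.

End Decay.

(** * Weights on the frequency side and a Peetre-type inequality *)

Section Weights.
Context (R : realType).
Local Notation L1 := (@lebesgue_measure R).
Local Notation L3 := (@leb3 R).
Implicit Types (x y t th : R).

(** An integrable power of [1 + |x|], written as an exponential. *)
Definition pw th x : R := expR (- (1 + th) * ln (1 + `|x|)).

Lemma ln1D_ge0 x : 0 <= ln (1 + `|x|).
Proof. by rewrite ln_ge0 // lerDl. Qed.

Lemma cont_pw th : continuous (pw th).
Proof.
move=> x; apply: continuous_comp; last exact: continuous_expR.
apply: cvgM; first exact: cvg_cst.
have p1 : 0 < 1 + `|x| by rewrite ltr_pwDl.
apply: (@continuous_comp _ _ _ (fun x => 1 + `|x|)); last exact: continuous_ln.
by apply: cvgD; [exact: cvg_cst|apply: cvg_norm; exact: cvg_id].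
Qed.

Lemma int_pw th : 0 < th -> (\int[L1]_x (pw th x)%:E = (2 / th)%:E)%E.
Proof.
move=> th0.
rewrite ge0_symfun_integralT; [|by move=> x; exact: expR_ge0|exact: cont_pw|]; last first.
  by move=> x /=; rewrite /pw normrN.
pose F (x : R) := - th^-1 * expR (- th * ln (1 + x)).
have dF x : 0 <= x -> is_derive x (1 : R) F (pw th x).
  move=> x0; have p1 : 0 < 1 + x by rewrite ltr_pwDl.
  have D1 : is_derive x (1 : R) (fun x => 1 + x) 1.
    by have := is_derive1_add (is_derive_cst (1 : R) x (1 : R)) (is_derive_id x (1 : R)); rewrite add0r.
  have D := is_derive1_scale (- th^-1) (is_derive1_chain (is_derive1_scale (- th) (is_derive1_chain D1 (is_derive1_ln p1))) (is_derive_expR _)).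
  apply: is_derive_eq D _; rewrite /pw (ger0_norm x0) mulNr mulr1.
  have -> : - (1 + th) * ln (1 + x) = - th * ln (1 + x) + - ln (1 + x) by ring.
  by rewrite expRD [expR (- ln _)]expRN lnK ?posrE //; field; rewrite !gt_eqF.
have FTC := @ge0_continuous_FTC2y R (pw th) F 0 0.
rewrite -set_itvcy (_ : (2 / th)%:E = (2%:E * (0%:E - (F 0)%:E))%E); last first.
  by rewrite -EFinB -EFinM /F addr0 ln1 mulr0 expR0; congr EFin; ring.
congr (_ * _)%E; apply: FTC.
- by move=> x _; exact: expR_ge0.
- exact/continuous_subspaceT/cont_pw.
- apply/cvgrPdist_le => e e0; near=> x.
  have x0 : 0 < x by near: x; exact: nbhs_pinfty_gt.
  have xe : expR (- (ln (e * th) / th)) <= x by near: x; apply: nbhs_pinfty_ge; rewrite num_real.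
  rewrite sub0r /F mulNr opprK ger0_norm ?mulr_ge0 ?invr_ge0 ?expR_ge0 ?(ltW th0) //.
  rewrite mulrC ler_pdivrMr // -[leRHS]lnK ?posrE ?mulr_gt0 // ler_expR.
  have h : - (ln (e * th) / th) <= ln (1 + x).
    rewrite -[leLHS]expRK ler_ln ?posrE ?expR_gt0 ?ltr_pwDl ?(ltW x0) //.
    by rewrite (le_trans xe) // lerDr.
  have := ler_wpM2l (ltW th0) h; rewrite mulrN mulrCA divff ?gt_eqF // mulr1; lra.
- by move=> x x0; have [] := dF x (ltW x0).
- apply: cvg_at_right_filter; apply: differentiable_continuous; apply/derivable1_diffP.
  by have [] := dF 0 (lexx _).
- by move=> x; rewrite in_itv/= andbT => x0; rewrite derive1E; have [] := dF x (ltW x0).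
Unshelve. all: by end_near.
Qed.

Lemma int_pw_shift th c : 0 < th -> (\int[L1]_x (pw th (x + c)%R)%:E = (2 / th)%:E)%E.
Proof.
move=> th0; rewrite -(int_pw th0).
have dF x : is_derive x (1 : R) (fun x => x + c) 1.
  by have := is_derive1_add (is_derive_id x (1 : R)) (is_derive_cst c x (1 : R)); rewrite addr0.
have dE : ((fun x : R => x + c)^`())%classic = fun=> 1 by exact: is_derive_derive1.
rewrite (@increasing_ge0_integration_by_substitutionT R (fun x => x + c) (pw th)).
- by apply: eq_integral => x _; rewrite dE /= mulr1.
- by move=> x y xy; rewrite ltrD2r.
- by rewrite dE => x; exact: cvg_cst.
- by rewrite dE; exact: is_cvg_cst.
- by rewrite dE; exact: is_cvg_cst.
- by move=> x; have [] := dF x.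
- apply/cvgrNyPle => A; near=> x; rewrite -lerBrDr; near: x.
  by apply: nbhs_ninfty_le; rewrite num_real.
- apply/cvgryPge => A; near=> x; rewrite -lerBlDr; near: x.
  by apply: nbhs_pinfty_ge; rewrite num_real.
- exact: cont_pw.
- by move=> x; exact: expR_ge0.
Unshelve. all: by end_near.
Qed.

(** The decay of the square of a transform in one variable: as [1 / |x|] up to
    [|x| = mu], and integrable beyond. *)
Definition wt (mu x : R) : R := ((1 + `|x|) * (1 + `|x| / mu))^-1.
Definition vt (x : R) : R := ((1 + `|x|) ^+ 2)^-1.

Lemma wt_ge0 mu x : 0 < mu -> 0 <= wt mu x.
Proof. by move=> m0; rewrite invr_ge0 mulr_ge0 ?addr_ge0 // divr_ge0 // ltW. Qed.

Lemma vt_ge0 x : 0 <= vt x. Proof. by rewrite invr_ge0 sqr_ge0. Qed.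

(** Interpolation: [(1 + |x|)^theta <= mu^theta * (1 + |x| / mu)^theta]. *)
Lemma wt_pw th mu x : 0 <= th -> th <= 1 -> 1 <= mu -> wt mu x <= mu `^ th * pw th x.
Proof.
move=> th0 th1 m1; have m0 : 0 < mu by exact: lt_le_trans m1.
have y1 : 0 < 1 + `|x| by rewrite ltr_pwDl.
have y2 : 0 < 1 + `|x| / mu by rewrite ltr_pwDl // divr_ge0 // ltW.
have mE : mu `^ th = expR (th * ln mu) by rewrite /powR gt_eqF.
have key : expR (th * ln (1 + `|x|)) <= mu `^ th * (1 + `|x| / mu).
  apply: (@le_trans _ _ (expR (th * ln (mu * (1 + `|x| / mu))))).
    rewrite ler_expR; apply: ler_wpM2l => //; rewrite ler_ln ?posrE ?mulr_gt0 //.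
    by rewrite mulrDr mulr1 mulrCA divff ?gt_eqF // mulr1 lerD2r.
  rewrite lnM ?posrE // mulrDr expRD mE; apply: ler_wpM2l; first exact: expR_ge0.
  have lb : 0 <= ln (1 + `|x| / mu) by rewrite ln_ge0 // lerDl divr_ge0 // ltW.
  by rewrite -[leRHS]lnK ?posrE // ler_expR ler_piMl.
rewrite /wt /pw.
have -> : - (1 + th) * ln (1 + `|x|) = - ln (1 + `|x|) + - (th * ln (1 + `|x|)) by ring.
rewrite expRD [expR (- ln _)]expRN [expR (- (th * _))]expRN lnK ?posrE // invfM mulrCA.
apply: ler_wpM2l; first by rewrite invr_ge0 ltW.
by rewrite ler_pdivlMr ?expR_gt0 // mulrC ler_pdivrMr.
Qed.

Lemma vt_pw th x : th <= 1 -> vt x <= pw th x.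
Proof.
move=> th1; have y1 : 0 < 1 + `|x| by rewrite ltr_pwDl.
rewrite /vt /pw mulNr expRN lef_pV2 ?posrE ?exprn_gt0 ?expR_gt0 //.
rewrite -{2}(lnK y1) -expRM_natl ler_expR ler_wpM2r ?ln1D_ge0 //; lra.
Qed.

(** A square root, because transforms are bounded pointwise by [weight3] and it is
    their squares that are integrated. *)
Definition weight3 (mu tau : R) (xi : R3 R) : R :=
  Num.sqrt (wt mu xi.1.1 * wt mu xi.1.2 * vt (xi.2 + tau)).

Lemma weight3_ge0 mu tau xi : 0 <= weight3 mu tau xi. Proof. exact: sqrtr_ge0. Qed.

Lemma weight3_sqr mu tau xi : 0 < mu -> weight3 mu tau xi ^+ 2 = wt mu xi.1.1 * wt mu xi.1.2 * vt (xi.2 + tau).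
Proof. by move=> m0; rewrite sqr_sqrtr // mulr_ge0 ?vt_ge0 // mulr_ge0 ?wt_ge0. Qed.

(** The square of [weight3] has an integral of the order of the square of [ln mu];
    any power of [mu] is good enough here. *)
Lemma int_weight3 th mu tau (H : R3 R -> R) (B : R) : 0 < th -> th <= 1 -> 1 <= mu ->
  (forall xi, 0 <= H xi) -> (forall xi, H xi <= B * weight3 mu tau xi) ->
  (\int[L3]_xi ((H xi) ^+ 2)%:E <= ((2 / th) ^+ 3 * (B * mu `^ th) ^+ 2)%:E)%E.
Proof.
move=> th0 th1 m1 H0 HB; have m0 : 0 < mu by exact: lt_le_trans m1.
pose c := (B * mu `^ th) ^+ 2.
have mpw : measurable_fun setT (pw th) by apply: continuous_measurable_fun; exact: cont_pw.
have mpws : measurable_fun setT (fun x => pw th (x + tau)).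
  apply: continuous_measurable_fun => x.
  apply: (@continuous_comp _ _ _ (fun x => x + tau)); last exact: cont_pw.
  by apply: cvgD; [exact: cvg_id|exact: cvg_cst].
have pw0 x : 0 <= pw th x by exact: expR_ge0.
apply: (@le_trans _ _ (\int[L3]_xi (c * (pw th (cx xi) * pw th (cy xi) * pw th (ct xi + tau)))%:E)%E).
  apply: ge0_le_int => xi; rewrite lee_fin ?sqr_ge0 //.
  have h : H xi ^+ 2 <= (B * weight3 mu tau xi) ^+ 2.
    by rewrite ler_pXn2r ?nnegrE ?HB ?H0 //; exact: le_trans (H0 xi) (HB xi).
  apply: le_trans h _; rewrite exprMn weight3_sqr //.
  have h1 := wt_pw xi.1.1 (ltW th0) th1 m1; have h2 := wt_pw xi.1.2 (ltW th0) th1 m1.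
  have h3 := vt_pw (xi.2 + tau) th1.
  have h4 := ler_pM (wt_ge0 _ m0) (wt_ge0 _ m0) h1 h2.
  have h5 := ler_pM (mulr_ge0 (wt_ge0 xi.1.1 m0) (wt_ge0 xi.1.2 m0)) (vt_ge0 (xi.2 + tau)) h4 h3.
  apply: le_trans (ler_wpM2l (sqr_ge0 B) h5) _.
  by rewrite /c /cx /cy /ct; apply: le_eq; ring.
rewrite ge0_intZ ?sqr_ge0 //; last 2 first.
- apply: measurable_funM; first apply: measurable_funM.
  + by apply: measurableT_comp => //; exact: meas_cx.
  + by apply: measurableT_comp => //; exact: meas_cy.
  + by apply: (@measurableT_comp _ _ _ _ _ _ (fun x => pw th (x + tau))) => //; exact: meas_ct.
- by move=> p; rewrite !mulr_ge0.
rewrite (@tonelli_prod R (pw th) (pw th) (fun x => pw th (x + tau))) // int_pw // int_pw_shift //.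
by rewrite -!EFinM lee_fin /c; apply: le_eq; ring.
Qed.

Lemma ln_leB1 x : 0 < x -> ln x <= x - 1.
Proof. by move=> x0; have := expR_ge1Dx (ln x); rewrite lnK ?posrE //; lra. Qed.

Definition peetre_weight (mu tau : R) (xi : R3 R) : R :=
  (1 + `|xi.2 + tau|) * (1 + `|xi.1.1| / mu) * (1 + `|xi.1.2| / mu).

Lemma peetre_weight_ge mu tau xi : 0 < mu ->
  [/\ 1 <= peetre_weight mu tau xi, 1 + `|xi.2 + tau| <= peetre_weight mu tau xi, 1 + `|xi.1.1| / mu <= peetre_weight mu tau xi &
      1 + `|xi.1.2| / mu <= peetre_weight mu tau xi].
Proof.
move=> m0; rewrite /peetre_weight.
have a1 : 1 <= 1 + `|xi.2 + tau| by rewrite lerDl.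
have b1 : 1 <= 1 + `|xi.1.1| / mu by rewrite lerDl divr_ge0 // ltW.
have c1 : 1 <= 1 + `|xi.1.2| / mu by rewrite lerDl divr_ge0 // ltW.
move: a1 b1 c1; move: (1 + `|xi.2 + tau|) (1 + _ / mu) (1 + _ / mu) => a b c a1 b1 c1.
have ab : 1 <= a * b by rewrite mulr_ege1.
have abc : 1 <= a * b * c by rewrite mulr_ege1.
split => //; nra.
Qed.

Lemma dot3_ge0 (xi : R3 R) : 0 <= dot3 xi xi.
Proof. by rewrite /dot3 -!expr2 !addr_ge0 ?sqr_ge0. Qed.

(** The logarithmic symbol is bounded above by [lam] up to powers of the weight.  It
    vanishes at frequency 0, but is bounded below by a multiple of the square of
    [y = |xi_t| / tau] when [y] is small; such frequencies are far from the peak, and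
    their weight is at least [lam / 2]. *)
Lemma symbol_bounds lam mu xi : 2 <= lam -> 0 < mu -> mu <= expR lam ->
  let Q := peetre_weight mu (expR lam) xi in let y := `|xi.2| / expR lam in
  let l := ln ((1 + dot3 xi xi) `^ 2^-1) in
  [/\ 1 + dot3 xi xi <= 4 * expR lam ^+ 2 * Q ^+ 2, y <= Q, 0 <= l, l <= 3 * lam * Q & lam * y ^+ 2 <= 8 * Q ^+ 2 * l].
Proof.
move=> l2 m0 mt Q y l.
have t0 : 0 < expR lam by exact: expR_gt0.
have l0 : 0 <= lam by lra.
have tl : lam <= expR lam by have := expR_ge1Dx lam; lra.
have [Q1 Qt Q11 Q12] := peetre_weight_ge (expR lam) xi m0; rewrite -/Q in Q1 Qt Q11 Q12.
set tau := expR lam in mt t0 tl Q Q1 Qt Q11 Q12 y *.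
have tau1 : 1 <= tau by lra.
have A1 : 1 <= 1 + dot3 xi xi by rewrite lerDl dot3_ge0.
have A0 : 0 < 1 + dot3 xi xi by lra.
have lE : l = 2^-1 * ln (1 + dot3 xi xi) by rewrite /l ln_powR.
have bx (x : R) : 1 + `|x| / mu <= Q -> `|x| <= tau * Q.
  move=> h; have : `|x| / mu <= Q by lra.
  rewrite ler_pdivrMr // => h2; apply: le_trans h2 _; rewrite mulrC ler_wpM2r //; lra.
have bt : `|xi.2| <= tau * Q.
  have h : `|xi.2| <= `|xi.2 + tau| + tau.
    by have := ler_normB (xi.2 + tau) tau; rewrite addrK (gtr0_norm t0).
  apply: le_trans h _; apply: (@le_trans _ _ (tau * (1 + `|xi.2 + tau|))); last by rewrite ler_wpM2l // ltW.
  have := normr_ge0 (xi.2 + tau); nra.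
have yQ : y <= Q by rewrite /y ler_pdivrMr // mulrC.
have y0 : 0 <= y by rewrite divr_ge0 // ltW.
have sq (x : R) : `|x| <= tau * Q -> x * x <= (tau * Q) ^+ 2.
  move=> h; rewrite -expr2 -real_normK ?num_real // ler_pXn2r ?nnegrE //.
  by rewrite mulr_ge0 // ?(ltW t0) //; lra.
have AQ : 1 + dot3 xi xi <= 4 * tau ^+ 2 * Q ^+ 2.
  rewrite /dot3; have := sq _ (bx _ Q11); have := sq _ (bx _ Q12); have := sq _ bt.
  have : 1 <= (tau * Q) ^+ 2 by rewrite exprn_ege1 // mulr_ege1.
  rewrite exprMn; lra.
have ll0 : 0 <= l by rewrite lE mulr_ge0 // ln_ge0.
have Q0 : 0 < Q by lra.
have p2 : 0 < 2 * tau * Q by rewrite mulr_gt0 // mulr_gt0.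
have lu : l <= 3 * lam * Q.
  have h : ln (1 + dot3 xi xi) <= ln ((2 * tau * Q) ^+ 2).
    rewrite ler_ln ?posrE ?exprn_gt0 //.
    by apply: le_trans AQ _; rewrite !exprMn; apply: le_eq; ring.
  have p3 : 0 < 2 * tau by rewrite mulr_gt0.
  have e1 : ln (2 * tau * Q) = ln 2 + lam + ln Q.
    rewrite lnM ?posrE //; congr (_ + _).
    by rewrite lnM ?posrE //; congr (_ + _); rewrite /tau expRK.
  rewrite lnXn // e1 in h.
  have h1 : ln (2 : R) <= 1 by have := @ln_leB1 2 (ltr0Sn _ _); lra.
  have h2 : ln Q <= Q by have := ln_leB1 Q0; lra.
  rewrite lE; move: h h1 h2; rewrite mulr2n; nra.
split => //.
have [yh|yh] := leP 2^-1 y.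
  have h : lam - 1 <= l.
    rewrite lE; have h1 : ln ((tau / 2) ^+ 2) <= ln (1 + dot3 xi xi).
      rewrite ler_ln ?posrE ?exprn_gt0 ?divr_gt0 //.
      have h2 : tau / 2 <= `|xi.2|.
        by move: yh; rewrite /y ler_pdivlMr // mulrC.
      apply: (@le_trans _ _ (`|xi.2| ^+ 2)).
        by rewrite ler_pXn2r ?nnegrE ?divr_ge0 // ltW.
      rewrite real_normK ?num_real // /dot3.
      have := sqr_ge0 xi.1.1; have := sqr_ge0 xi.1.2; rewrite !expr2; lra.
    rewrite lnXn ?divr_gt0 // ln_div ?posrE // /tau expRK in h1.
    have h3 : ln (2 : R) <= 1 by have := @ln_leB1 2 (ltr0Sn _ _); lra.
    move: h1; rewrite mulr2n; lra.
  have y2 : y ^+ 2 <= Q ^+ 2 by rewrite ler_pXn2r ?nnegrE //; lra.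
  have Q2 : 0 <= Q ^+ 2 by exact: sqr_ge0.
  apply: (@le_trans _ _ (2 * l * Q ^+ 2)); last by nra.
  apply: ler_pM => //; [exact: sqr_ge0|lra].
have zt : tau / 2 <= Q.
  apply: le_trans Qt.
  have := ler_normD (xi.2 + tau) (- xi.2); rewrite addrAC subrr add0r normrN (gtr0_norm t0).
  move: yh; rewrite /y ltr_pdivrMr // => h1 h2; lra.
have hl : y ^+ 2 / 4 <= l.
  rewrite lE.
  set a := xi.2 ^+ 2.
  have a0 : 0 <= a by exact: sqr_ge0.
  have h1 : ln (1 + a) <= ln (1 + dot3 xi xi).
    rewrite ler_ln ?posrE //; last by lra.
    rewrite /dot3 /a; have := sqr_ge0 xi.1.1; have := sqr_ge0 xi.1.2; rewrite !expr2; lra.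
  have h2 : a / (1 + a) <= ln (1 + a).
    have p : 0 < 1 + a by lra.
    have h3 : ln ((1 + a)^-1) <= (1 + a)^-1 - 1 by apply: ln_leB1; rewrite invr_gt0.
    rewrite lnV ?posrE // in h3.
    have -> : a / (1 + a) = 1 - (1 + a)^-1 by field; rewrite gt_eqF.
    lra.
  have aE : a = (y * tau) ^+ 2.
    by rewrite /y divfK ?gt_eqF // real_normK ?num_real.
  have h4 : 1 + a <= 2 * tau ^+ 2.
    rewrite aE exprMn; have : y ^+ 2 <= 1 by rewrite exprn_ile1 //; lra.
    have : 1 <= tau ^+ 2 by rewrite exprn_ege1.
    nra.
  have h5 : y ^+ 2 / 2 <= a / (1 + a).
    rewrite ler_pdivlMr; last by lra.
    have y20 : 0 <= y ^+ 2 / 2 by rewrite divr_ge0 ?sqr_ge0.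
    apply: le_trans (ler_wpM2l y20 h4) _; rewrite [leRHS]aE.
    by apply: le_eq; field.
  lra.
have Ql : lam <= 2 * Q by lra.
have Q2 : Q <= Q ^+ 2 by rewrite expr2 ler_peMl //; lra.
have : y ^+ 2 <= 4 * l by lra.
have := sqr_ge0 y; nra.
Qed.

(** At the peak [xi_t = - tau] the symbol has size [tau^s lam^r]; elsewhere it is
    compared with this value through powers of the weight.  For [r < 0] the factor
    [y^N] with [N >= 2 |r|] pays for the zero of the logarithm. *)
Lemma peetre s r N : 0 <= s -> (1 <= N)%N -> 2 * `|r| <= N%:R ->
  exists C K, 0 <= C /\ forall lam mu xi, 2 <= lam -> 0 < mu -> mu <= expR lam ->
   LambdaS s xi * logLambdaS r xi * (`|xi.2| / expR lam) ^+ N <=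
   C * (expR lam `^ s * lam `^ r) * peetre_weight mu (expR lam) xi ^+ K.
Proof.
move=> s0 N1 rN.
have [K1 hK1] : exists K : nat, s <= K%:R.
  by exists (Num.bound s); apply: ltW; exact: archi_boundP.
pose K2 : nat := (Num.bound `|r|).
have hK2 : `|r| <= K2%:R by apply: ltW; exact: archi_boundP.
exists (2 `^ s * (3 `^ `|r| + 8 `^ `|r|)), (K1 + (K2 + N + 2 * K2))%N; split.
  by rewrite mulr_ge0 ?addr_ge0 ?powR_ge0.
move=> lam mu xi l2 m0 mt.
have /= [AQ yQ l0 lu ly] := symbol_bounds xi l2 m0 mt.
have [Q1 _ _ _] := peetre_weight_ge (expR lam) xi m0.
move: AQ yQ l0 lu ly; rewrite /LambdaS /logLambdaS.
set Q := peetre_weight _ _ _ in Q1 *; set y := _ / _; set l := ln _; set A := 1 + _.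
move=> AQ yQ l0 lu ly.
have t0 : 0 < expR lam by exact: expR_gt0.
have A0 : 0 <= A by rewrite addr_ge0 // dot3_ge0.
have y0 : 0 <= y by rewrite divr_ge0 // ltW.
have Q0 : 0 < Q by lra.
have lam0 : 0 < lam by lra.
have S1 : A `^ (s / 2) <= 2 `^ s * expR lam `^ s * Q ^+ K1.
  apply: (@le_trans _ _ ((4 * expR lam ^+ 2 * Q ^+ 2) `^ (s / 2))).
    have R0 : 0 <= 4 * expR lam ^+ 2 * Q ^+ 2.
      by apply: mulr_ge0; [apply: mulr_ge0 => //|]; exact: sqr_ge0.
    by apply: ge0_ler_powR => //; rewrite divr_ge0.
  have tt0 : 0 <= 2 * expR lam by rewrite mulr_ge0 // ltW.
  have tq0 : 0 <= 2 * expR lam * Q by rewrite mulr_ge0 // ltW.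
  have -> : 4 * expR lam ^+ 2 * Q ^+ 2 = (2 * expR lam * Q) `^ 2.
    by rewrite (@powR_mulrn R _ 2) //; ring.
  rewrite -powRrM (_ : 2 * (s / 2) = s); last by field.
  rewrite powRM ?(ltW Q0) // powRM ?(ltW t0) // ler_wpM2l ?mulr_ge0 ?powR_ge0 //.
  by rewrite -powR_mulrn ?(ltW Q0) // ler_powR.
have S2 : l `^ r * y ^+ N <= (3 `^ `|r| + 8 `^ `|r|) * lam `^ r * Q ^+ (K2 + N + 2 * K2).
  have QN : y ^+ N <= Q ^+ N by rewrite ler_pXn2r // nnegrE // ltW.
  have lr0 : 0 <= lam `^ r by exact: powR_ge0.
  have [r0|r0] := leP 0 r.
    rewrite (ger0_norm r0) in hK2 *.
    have h : l `^ r <= 3 `^ r * lam `^ r * Q ^+ K2.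
      apply: (@le_trans _ _ ((3 * lam * Q) `^ r)).
        apply: ge0_ler_powR => //.
        by rewrite nnegrE; apply: mulr_ge0; [apply: mulr_ge0 => //|]; exact: ltW.
      have l30 : 0 <= 3 * lam by rewrite mulr_ge0 // ltW.
      rewrite powRM ?(ltW Q0) // powRM ?(ltW lam0) // ler_wpM2l ?mulr_ge0 ?powR_ge0 //.
      by rewrite -powR_mulrn ?(ltW Q0) // ler_powR.
    have h2 := ler_pM (powR_ge0 _ _) (exprn_ge0 N y0) h QN.
    apply: le_trans h2 _; rewrite -[leLHS]mulrA -(exprD Q).
    apply: ler_pM; rewrite ?mulr_ge0 ?powR_ge0 ?exprn_ge0 ?(ltW Q0) //.
      by rewrite ler_wpM2r // lerDl powR_ge0.
    by rewrite ler_weXn2l // leq_addr.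
  rewrite (ltr0_norm r0) in hK2 rN *.
  have [y00|yn0] := eqVneq y 0.
    rewrite y00 expr0n gtn_eqF // mulr0.
    by rewrite !mulr_ge0 ?addr_ge0 ?powR_ge0 ?exprn_ge0 // ltW.
  have yp : 0 < y by rewrite lt_neqAle eq_sym yn0.
  have lp : 0 < l.
    rewrite lt_neqAle l0 andbT; apply/eqP => le0; move: ly; rewrite -le0 mulr0 leNgt.
    by rewrite mulr_gt0 // exprn_gt0.
  have q0 : 0 <= - r by rewrite oppr_ge0 ltW.
  have h1 : (lam * y ^+ 2) `^ (- r) <= (8 * Q ^+ 2 * l) `^ (- r).
    apply: ge0_ler_powR => //.
    - by rewrite nnegrE; apply: mulr_ge0; [exact: ltW|exact: sqr_ge0].
    - by rewrite nnegrE; apply: mulr_ge0 => //; apply: mulr_ge0 => //; exact: sqr_ge0.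
  have Q20 : 0 <= 8 * Q ^+ 2 by apply: mulr_ge0 => //; exact: sqr_ge0.
  rewrite (powRM _ Q20 l0) (powRM _ (ltW lam0) (sqr_ge0 y)) (@powRM _ 8) ?sqr_ge0 // in h1.
  have yE : y ^+ N = (y ^+ 2) `^ (- r) * y `^ (N%:R - 2 * - r).
    rewrite -powR_mulrn // -powR_mulrn // -powRrM -powRD ?yn0 ?implybT //.
    by congr (_ `^ _); ring.
  have hy : y `^ (N%:R - 2 * - r) <= Q ^+ N.
    apply: (@le_trans _ _ (Q `^ (N%:R - 2 * - r))).
      by apply: ge0_ler_powR => //; rewrite ?nnegrE ?subr_ge0 // ltW.
    by rewrite -powR_mulrn ?(ltW Q0) // ler_powR // gerBl mulr_ge0.
  have hQ : (Q ^+ 2) `^ (- r) <= Q ^+ (2 * K2).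
    by rewrite exprM -(@powR_mulrn R (Q ^+ 2) K2) ?sqr_ge0 // ler_powR // exprn_ege1.
  have lq : 0 < l `^ (- r) by exact: powR_gt0.
  have lamq : 0 < lam `^ (- r) by exact: powR_gt0.
  have e1 : l `^ r = (l `^ (- r))^-1 by rewrite -powRN opprK.
  have e2 : lam `^ r = (lam `^ (- r))^-1 by rewrite -powRN opprK.
  have h2 : (y ^+ 2) `^ (- r) / l `^ (- r) <= 8 `^ (- r) * Q ^+ (2 * K2) / lam `^ (- r).
    rewrite ler_pdivrMr // mulrAC ler_pdivlMr // mulrC; apply: le_trans h1 _.
    by rewrite ler_wpM2r ?(ltW lq) // ler_wpM2l ?powR_ge0.
  rewrite yE e1 mulrA [_^-1 * _]mulrC.
  have h3 := ler_pM (divr_ge0 (powR_ge0 _ _) (ltW lq)) (powR_ge0 _ _) h2 hy.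
  apply: le_trans h3 _; rewrite e2.
  have Qa : Q ^+ (2 * K2) * Q ^+ N <= Q ^+ (K2 + N + 2 * K2).
    by rewrite -exprD ler_weXn2l // addnC -addnA leq_addl.
  have h8 : 8 `^ (- r) <= 3 `^ (- r) + 8 `^ (- r) by rewrite lerDr powR_ge0.
  have h9 := ler_pM (powR_ge0 _ _) (mulr_ge0 (exprn_ge0 (2 * K2) (ltW Q0)) (exprn_ge0 N (ltW Q0))) h8 Qa.
  have li0 : 0 <= (lam `^ (- r))^-1 by rewrite invr_ge0 ltW.
  have h10 := ler_wpM2l li0 h9.
  apply: (@le_trans _ _ ((lam `^ (- r))^-1 * (8 `^ (- r) * (Q ^+ (2 * K2) * Q ^+ N)))).
    by apply: le_eq; ring.
  apply: le_trans h10 _.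
  by apply: le_eq; ring.
have h := ler_pM (powR_ge0 _ _) (mulr_ge0 (powR_ge0 _ _) (exprn_ge0 N y0)) S1 S2.
rewrite -mulrA; apply: le_trans h _.
by rewrite (exprD Q K1); apply: le_eq; ring.
Qed.

End Weights.

(** * Symbols against decay, and a lower bound near the peak *)

Section Key.
Context (R : realType) (alpha : R).
Hypothesis alpha0 : 0 < alpha.
Local Notation L1 := (@lebesgue_measure R).
Local Notation L3 := (@leb3 R).
Local Notation normc := ComplexField.Normc.normc.
Implicit Types (X Y T : R -> R) (F G : R -> R3 R -> R) (p xi : R3 R) (lam : R).
Local Notation del := (del alpha).
Local Notation mu := (mu alpha).
Local Notation family := (family alpha).
Local Notation Dn := (Dn alpha).

(** Reduces polynomial weights to moments. *)
Lemma pow1D_le (a : R) M : 0 <= a -> (1 + a) ^+ M <= 2 ^+ M * (1 + a ^+ M).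
Proof.
move=> a0; have [a1|a1] := leP a 1.
  apply: (@le_trans _ _ (2 ^+ M)); first by apply: lerXn2r; rewrite ?nnegrE //; lra.
  by rewrite ler_peMr ?exprn_ge0 // lerDl exprn_ge0.
apply: (@le_trans _ _ ((2 * a) ^+ M)); first by apply: lerXn2r; rewrite ?nnegrE //; lra.
by rewrite exprMn ler_wpM2l ?exprn_ge0 // lerDr.
Qed.

(** The product of weights is controlled by the moments of order 0, 1, [M] and
    [M + 1]. *)
Lemma weight_poly (g y m C D : R) M : 0 <= g -> 0 <= y -> 1 <= m -> (0 < M)%N -> 0 <= C -> 0 <= D ->
  g <= C * D -> g * y <= C * D -> g * y ^+ M <= C * D * m ^+ M.-1 -> g * y ^+ M.+1 <= C * D * m ^+ M ->
  g * ((1 + y) * (1 + y / m) ^+ M) <= 2 ^+ M * (4 * (C * D)).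
Proof.
move=> g0 y0 m1 M0 C0 D0 h0 h1 hM hM1.
have m0 : 0 < m by lra.
have p2 : 0 <= (2 : R) ^+ M by rewrite exprn_ge0.
have mM : 0 < m ^+ M by rewrite exprn_gt0.
have CD : 0 <= C * D by rewrite mulr_ge0.
have hb := pow1D_le M (divr_ge0 y0 (ltW m0)).
have h2 := ler_wpM2l (mulr_ge0 g0 (addr_ge0 ler01 y0)) hb.
rewrite mulrA; apply: le_trans h2 _.
rewrite mulrCA ler_wpM2l //.
have e1 : g * y ^+ M / m ^+ M <= C * D.
  rewrite ler_pdivrMr //; apply: le_trans hM _; rewrite ler_wpM2l //.
  by rewrite ler_weXn2l // leq_pred.
have e2 : g * y ^+ M.+1 / m ^+ M <= C * D by rewrite ler_pdivrMr.
rewrite expr_div_n (_ : g * (1 + y) * (1 + y ^+ M / m ^+ M) =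
  g + g * y + g * y ^+ M / m ^+ M + g * y ^+ M.+1 / m ^+ M); first by lra.
by rewrite exprS; ring.
Qed.

Lemma decay_w t F T M Mt (pr : R3 R -> R) : (0 < M)%N ->
  (forall j m, exists2 C, 0 <= C & forall lam xi, 1 <= lam ->
    FT F T lam xi * `|pr xi| ^+ j * `|xi.2| ^+ m <= C * Dn t lam * mu lam ^+ j.-1) ->
  exists2 C, 0 <= C & forall lam xi, 1 <= lam ->
    FT F T lam xi * ((1 + `|pr xi|) * (1 + `|pr xi| / mu lam) ^+ M) * (1 + `|xi.2|) ^+ Mt <= C * Dn t lam.
Proof.
move=> M0 H.
have Dn0 lam : 1 <= lam -> 0 <= Dn t lam.
  move=> l1; have d0 := del_gt0 alpha lam; have m0 := mu_gt0 alpha l1.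
  case: t {H} => /=; try exact: ltW.
  by apply: mulr_ge0; [apply: mulr_ge0; [exact: expR_ge0|exact: sqr_ge0]|exact: ltW].
have one m : exists2 C, 0 <= C & forall lam xi, 1 <= lam ->
    FT F T lam xi * `|xi.2| ^+ m * ((1 + `|pr xi|) * (1 + `|pr xi| / mu lam) ^+ M) <= C * Dn t lam.
  have [C0 C00 H0] := H 0%N m; have [C1 C10 H1] := H 1%N m.
  have [C2 C20 H2] := H M m; have [C3 C30 H3] := H M.+1 m.
  exists (2 ^+ M * (4 * (C0 + C1 + C2 + C3))).
    by rewrite mulr_ge0 ?exprn_ge0 // mulr_ge0 // !addr_ge0.
  move=> lam xi l1; have D0 := Dn0 lam l1.
  have c0 : 0 <= C0 + C1 + C2 + C3 by rewrite !addr_ge0.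
  have m1 := mu_ge1 alpha0 l1; have m0 := mu_gt0 alpha l1.
  have big c A : 0 <= c -> c <= C0 + C1 + C2 + C3 -> 0 <= A -> c * Dn t lam * A <= (C0 + C1 + C2 + C3) * Dn t lam * A.
    by move=> c00 cc A0; rewrite ler_wpM2r // ler_wpM2r.
  have -> : 2 ^+ M * (4 * (C0 + C1 + C2 + C3)) * Dn t lam = 2 ^+ M * (4 * ((C0 + C1 + C2 + C3) * Dn t lam)) by ring.
  apply: weight_poly => //.
  - by rewrite mulr_ge0 ?exprn_ge0 // FT_ge0.
  - have := H0 lam xi l1; rewrite !expr0 !mulr1 => h; apply: le_trans h _.
    by have := big C0 1 C00; rewrite !mulr1; apply => //; lra.
  - have := H1 lam xi l1; rewrite !expr0 expr1 mulr1 mulrAC => h; apply: le_trans h _.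
    by have := big C1 1 C10; rewrite !mulr1; apply => //; lra.
  - have := H2 lam xi l1; rewrite mulrAC => h; apply: le_trans h _.
    by apply: big; rewrite ?exprn_ge0 ?(ltW m0) //; lra.
  - have := H3 lam xi l1; rewrite mulrAC => h; apply: le_trans h _.
    by apply: big; rewrite ?exprn_ge0 ?(ltW m0) //; lra.
have [C C0 HC] := one 0%N; have [C' C0' HC'] := one Mt.
exists (2 ^+ Mt * (C + C')); first by rewrite mulr_ge0 ?exprn_ge0 ?addr_ge0.
move=> lam xi l1; have := HC lam xi l1; have := HC' lam xi l1; rewrite expr0 mulr1.
have m0 := mu_gt0 alpha l1.
have w0 : 0 <= (1 + `|pr xi|) * (1 + `|pr xi| / mu lam) ^+ M.
  by rewrite mulr_ge0 ?exprn_ge0 ?addr_ge0 // divr_ge0 // ltW.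
have := pow1D_le Mt (normr_ge0 xi.2); have := FT_ge0 F T lam xi.
have := exprn_ge0 Mt (ler0n R 2).
move: w0; move: (FT _ _ _ _) ((1 + `|pr xi|) * _) (`|xi.2| ^+ Mt) ((1 + `|xi.2|) ^+ Mt) ((2 : R) ^+ Mt) (Dn t lam).
clear => f w z zz p d w0 p0 f0 hz h1 h2.
have fw : 0 <= f * w by rewrite mulr_ge0.
apply: le_trans (ler_wpM2l fw hz) _.
rewrite (_ : f * w * (p * (1 + z)) = p * (f * w + f * z * w)); last by ring.
by rewrite -[leRHS]mulrA ler_wpM2l // mulrDl lerD.
Qed.

Lemma Dn_ge0 t lam : 1 <= lam -> 0 <= Dn t lam.
Proof.
move=> l1; have d0 := del_gt0 alpha lam; have m0 := mu_gt0 alpha l1.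
case: t => /=; try exact: ltW.
by apply: mulr_ge0; [apply: mulr_ge0; [exact: expR_ge0|exact: sqr_ge0]|exact: ltW].
Qed.

(** The decay in [x] and the decay in [y] cannot be used together at full strength;
    their geometric mean can, which is why [weight3] is a square root. *)
Lemma FT_weight3 t F T K : family t F -> bump1 T -> exists2 C, 0 <= C & forall lam xi, 1 <= lam ->
  (1 + `|xi.2 + tau lam|) * FT F T lam (shift_t (tau lam) xi) * peetre_weight (mu lam) (tau lam) xi ^+ K <=
  C * Dn t lam * weight3 (mu lam) (tau lam) xi.
Proof.
move=> cF bT.
have [C C0 HC] := @decay_w t F T (2 * K).+1 (K + 2) (fun xi => xi.1.1) isT (fun j m => decay_x alpha0 j m cF bT).
have [C' C0' HC'] := @decay_w t F T (2 * K).+1 (K + 2) (fun xi => xi.1.2) isT (fun j m => decay_y alpha0 j m cF bT).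
exists (C + C'); first by rewrite addr_ge0.
move=> lam xi l1; have m0 := mu_gt0 alpha l1; have D0 := Dn_ge0 t l1.
have := HC lam (shift_t (tau lam) xi) l1; have := HC' lam (shift_t (tau lam) xi) l1.
rewrite /shift_t /peetre_weight /=; have f0 := FT_ge0 F T lam (xi.1.1, xi.1.2, xi.2 + tau lam).
move: f0; move: (FT _ _ _ _) => f f0.
have a1 : 1 <= 1 + `|xi.2 + tau lam| by rewrite lerDl.
have b1 : 1 <= 1 + `|xi.1.1| / mu lam by rewrite lerDl divr_ge0 // ltW.
have c1 : 1 <= 1 + `|xi.1.2| / mu lam by rewrite lerDl divr_ge0 // ltW.
have b1' : 1 <= 1 + `|xi.1.1| by rewrite lerDl.
have c1' : 1 <= 1 + `|xi.1.2| by rewrite lerDl.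
move=> hy hx.
rewrite -[leLHS](@ger0_norm R); last first.
  by rewrite !mulr_ge0 ?exprn_ge0 ?mulr_ge0 //; lra.
rewrite -[leRHS](@ger0_norm R); last first.
  by rewrite mulr_ge0 ?weight3_ge0 // mulr_ge0 // addr_ge0.
rewrite -ler_sqr ?nnegrE ?normr_ge0 // !real_normK ?num_real //.
rewrite [leRHS]exprMn weight3_sqr // /wt /vt.
move: hy hx; move: a1 b1 c1 b1' c1'.
move: (1 + `|xi.2 + _|) (1 + `|xi.1.1| / mu lam) (1 + `|xi.1.2| / mu lam) (1 + `|xi.1.1|) (1 + `|xi.1.2|) D0.
clear -f f0 C0 C0' => a b c x y.
move: (Dn t lam) => D D0 a1 b1 c1 x1 y1 hy hx.
have a0 : 0 < a by lra.
have b0 : 0 < b by lra.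
have c0 : 0 < c by lra.
have x0 : 0 < x by lra.
have y0 : 0 < y by lra.
have hxy : (f * (x * b ^+ (2 * K).+1) * a ^+ (K + 2)) * (f * (y * c ^+ (2 * K).+1) * a ^+ (K + 2)) <=
   ((C + C') * D) ^+ 2.
  rewrite expr2; apply: ler_pM.
  - by rewrite !mulr_ge0 ?exprn_ge0 // ltW.
  - by rewrite !mulr_ge0 ?exprn_ge0 // ltW.
  - by apply: le_trans hx _; rewrite ler_wpM2r // lerDl.
  - by apply: le_trans hy _; rewrite ler_wpM2r // lerDr.
have p0 : 0 < (x * b) * (y * c) * a ^+ 2 by rewrite !mulr_gt0 // exprn_gt0.
rewrite (_ : (x * b)^-1 * (y * c)^-1 * (a ^+ 2)^-1 = ((x * b) * (y * c) * a ^+ 2)^-1); last first.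
  by rewrite !invfM.
rewrite ler_pdivlMr //; apply: le_trans hxy.
apply: le_eq.
have oddE (w : R) : w ^+ (2 * K).+1 = w * (w ^+ K) ^+ 2 by rewrite exprS mulnC exprM.
rewrite !oddE exprD (exprMn K) (exprMn K); ring.
Qed.

(** Combines [peetre] with [FT_weight3], the latter at the power of the weight that
    the former produces. *)
Lemma symbol_decay t F T s r N : family t F -> bump1 T -> 0 <= s -> (1 <= N)%N -> 2 * `|r| <= N%:R ->
  exists2 C, 0 <= C & forall lam xi, 2 <= lam -> mu lam <= tau lam ->
  LambdaS s xi * logLambdaS r xi * ((`|xi.2| / tau lam) ^+ N *
    ((1 + `|xi.2 + tau lam|) * FT F T lam (shift_t (tau lam) xi))) <=
  C * (tau lam `^ s * lam `^ r) * Dn t lam * weight3 (mu lam) (tau lam) xi.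
Proof.
move=> cF bT s0 N1 rN.
have [C1 [K [C10 H1]]] := peetre s0 N1 rN.
have [C2 C20 H2] := FT_weight3 K cF bT.
exists (C1 * C2); first exact: mulr_ge0.
move=> lam xi l2 mt; have l1 : 1 <= lam by lra.
have m0 := mu_gt0 alpha l1.
rewrite [leLHS]mulrA.
have h1 := H1 lam (mu lam) xi l2 m0 mt; have h2 := H2 lam xi l1.
have f0 : 0 <= (1 + `|xi.2 + tau lam|) * FT F T lam (shift_t (tau lam) xi).
  by rewrite mulr_ge0 ?FT_ge0 // addr_ge0.
apply: le_trans (ler_wpM2r f0 h1) _.
have p0 : 0 <= C1 * (tau lam `^ s * lam `^ r) by rewrite mulr_ge0 ?mulr_ge0 ?powR_ge0.
have h3 := ler_wpM2l p0 h2.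
apply: le_trans (le_trans h3 _); apply: le_eq; rewrite /tau; ring.
Qed.

Lemma cos_near0 : exists2 th0 : R, 0 < th0 & forall x : R, `|x| <= th0 -> 2^-1 <= cos x.
Proof.
have c := @continuous_cos R 0.
have h : 2^-1 < cos (0 : R) by rewrite cos0; lra.
have hn : \forall x \near (0 : R), 2^-1 < cos x by exact: (cvgr_gt _ c _ h).
have [e /= e0 he] := (nbhs_ballP (0 : R) _).1 hn.
exists (e / 2); first by rewrite divr_gt0.
move=> x xe; apply: ltW; apply: (he x).
by rewrite /ball /= sub0r normrN; lra.
Qed.

Lemma int_shift_ind (a c : R) : 0 <= a -> (\int[L1]_x (ind a (x + c)%R)%:E = (2 * a)%:E)%E.
Proof.
move=> a0.
have -> : (fun x : R => (ind a (x + c)%R)%:E) = (fun x => (\1_(`[(- a - c)%R, (a - c)%R]) x)%:E).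
  apply/funext => x; rewrite indicE /ind; congr (_%:R%:E); congr nat_of_bool.
  by rewrite mem_setE in_itv /= ler_norml lerBlDr lerBrDr.
rewrite integral_indic // setIT.
apply: (etrans (lebesgue_measure_itv _)); rewrite /= lte_fin.
case: ifPn => h; first by rewrite -EFinB; congr EFin; ring.
congr EFin; move: h; rewrite -leNgt; lra.
Qed.

(** On a box of frequencies of size [1 / del] in [z] and 1 in [t] the phase stays
    close to 0 on the support of the integrand, so the cosine transform is at least
    half the integral. *)
Lemma FT_lower (psi T : R -> R) (Y t0 : R) : smooth1 psi -> 0 < Y -> (forall x, Y < `|x| -> psi x = 0) ->
  (forall x, `|x| <= 2 -> psi x = 1) -> (forall x, 0 <= psi x) -> bump1 T ->
  (forall x, 0 <= T x) -> 0 < t0 -> (forall x, `|x| <= t0 -> T x = 1) ->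
  exists c a, [/\ 0 < c, 0 < a & forall lam zeta, 1 <= lam ->
    `|zeta.1.1| <= a / del lam -> `|zeta.1.2| <= a / del lam -> `|zeta.2| <= a ->
    c * del lam ^+ 2 <= FT (mono alpha 0 0 0 psi psi) T lam zeta].
Proof.
move=> sp Y0 psi0 psi1 psige [sT [Yt Yt0 T0]] Tge t00 T1.
have bp : bump1 psi by split => //; exists Y => //; exact: ltW.
have bT : bump1 T by split => //; exists Yt.
have cF : family gen (mono alpha 0 0 0 psi psi) by exact: family_gen.
have [th0 th00 hcos] := cos_near0.
(* The phase is at most [a * (2 * Y + Yt)], which has to stay below [th0]. *)
pose a := th0 / (2 * Y + Yt + 1).
have S0 : 0 < 2 * Y + Yt + 1 by lra.
have a0 : 0 < a by rewrite divr_gt0.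
exists (expR (-1) * t0), a; split => //; first by rewrite mulr_gt0 // expR_gt0.
move=> lam z l1 z1 z2 z3; have d0 := del_gt0 alpha lam; have l0 : 0 < lam by lra.
set F := mono _ _ _ _ _ _ in cF *.
pose q p := F lam p * T (ct p).
have tq : tame q by exact: family_tame cF bT l1.
have q0 p : 0 <= q p.
  by rewrite /q /F /mono; apply: mulr_ge0 => //; apply: mulr_ge0 => //; apply: mulr_ge0 => //; apply: th_ge0; lra.
have qz p : q p != 0 -> [/\ `|cx p| <= Y * del lam, `|cy p| <= Y * del lam & `|ct p| <= Yt].
  move=> qn; split; rewrite leNgt; apply/negP => h; move: qn; apply/negP; rewrite negbK /q /F /mono.
  - rewrite (psi0 (cx p / del lam)) ?mulr0 ?mul0r ?eqxx //.
    by rewrite normrM normfV (gtr0_norm d0) ltr_pdivlMr.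
  - rewrite (psi0 (cy p / del lam)) ?mulr0 ?mul0r ?eqxx //.
    by rewrite normrM normfV (gtr0_norm d0) ltr_pdivlMr.
  - by rewrite T0 // mulr0.
have qcos p : 2^-1 * q p <= q p * cos (dot3 p z).
  have [->|qn] := eqVneq (q p) 0; first by rewrite mulr0 mul0r.
  have [h1 h2 h3] := qz p qn.
  rewrite mulrC ler_wpM2l // hcos //.
  have n (x y A B : R) : `|x| <= A -> `|y| <= B -> `|x * y| <= A * B by move=> ? ?; rewrite normrM ler_pM.
  have e1 := n _ _ _ _ h1 z1; have e2 := n _ _ _ _ h2 z2; have e3 := n _ _ _ _ h3 z3.
  rewrite /dot3; apply: le_trans (ler_normD _ _) _.
  have := ler_normD (p.1.1 * z.1.1) (p.1.2 * z.1.2).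
  have aE : a * (2 * Y + Yt + 1) = th0 by rewrite /a divfK // gt_eqF.
  have YE : Y * del lam * (a / del lam) = Y * a by field; rewrite gt_eqF.
  rewrite YE in e1 e2; rewrite /cx /cy /ct in e1 e2 e3; lra.
have qlow p : expR (-1) * bx (del lam / 2) t0 p <= q p.
  rewrite /bx.
  have [xr|xr] := leP `|cx p| (del lam / 2); last by rewrite (ind0 xr) !mul0r mulr0.
  have [yr|yr] := leP `|cy p| (del lam / 2); last by rewrite (ind0 yr) mulr0 mul0r mulr0.
  have [tr|tr] := leP `|ct p| t0; last by rewrite (ind0 tr) !mulr0.
  rewrite !ind1 // !mulr1 /q T1 // mulr1 /F /mono !psi1 ?mulr1; last 2 first.
  - by rewrite normrM normfV (gtr0_norm d0) ler_pdivrMr //; lra.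
  - by rewrite normrM normfV (gtr0_norm d0) ler_pdivrMr //; lra.
  rewrite /th !expr0 !mul1r /E ler_expR mulNr lerN2.
  have [n0|n0] := ltP 0 (nsq p); last by rewrite fl_neg // mulr0.
  have nd : nsq p <= del lam ^+ 2.
    have sq (x : R) : `|x| <= del lam / 2 -> x ^+ 2 <= (del lam / 2) ^+ 2.
      by move=> h; rewrite -real_normK ?num_real // ler_pXn2r ?nnegrE //; lra.
    have := sq _ xr; have := sq _ yr; rewrite /nsq expr_div_n.
    have := sqr_ge0 (del lam); lra.
  pose s := nsq p / del lam ^+ 2.
  have s0 : 0 < s by rewrite divr_gt0 // exprn_gt0.
  have s1 : s <= 1 by rewrite ler_pdivrMr ?exprn_gt0 // mul1r.
  have nE : nsq p = del lam ^+ 2 * s by rewrite /s mulrC divfK // gt_eqF // exprn_gt0.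
  rewrite nE tau_fl // /hh -[leRHS]expR0 ler_expR pmulr_rle0 // subr_le0.
  by rewrite -(Sp1 alpha) Sp_anti.
have I1 : (\int[L3]_p (bx (del lam / 2) t0 p)%:E = (8 * (del lam / 2) ^+ 2 * t0)%:E)%E.
  by rewrite int_bx //; lra.
have Fcl : expR (-1) * t0 * del lam ^+ 2 <= Fc q z.
  rewrite /Fc /Rintegral -lee_fin fineK; last first.
    exact: integrable_fin_num (tame_integrable (tame_cos z tq)).
  apply: (@le_trans _ _ (\int[L3]_p (2^-1 * expR (-1) * bx (del lam / 2) t0 p)%:E)%E).
    rewrite ge0_intZ ?mulr_ge0 ?expR_ge0 //; [|exact: meas_bx|exact: bx_ge0].
    by rewrite I1 -EFinM lee_fin; apply: le_eq; field.
  apply: le_integral => //.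
  - apply: tame_integrable; apply: tame_scale.
    split; first exact: meas_bx.
    exists 1, (del lam / 2 + t0); split => //; first lra.
    by move=> p; rewrite mul1r ger0_norm ?bx_ge0 // bx_mono //; lra.
  - exact: tame_integrable (tame_cos z tq).
  - move=> p _; rewrite lee_fin; apply: le_trans (qcos p).
    by rewrite -mulrA ler_wpM2l.
rewrite /FT -/q fourier_real //; apply: le_trans Fcl _.
rewrite /normc; apply: le_trans (ler_norm _) _.
rewrite -sqrtr_sqr ler_wsqrtr // lerDl sqr_ge0 //.
Qed.

End Key.

(** * The action of L and of its conjugate on the probe *)

Section Operators.
Context (R : realType) (alpha : R).
Hypothesis alpha0 : 0 < alpha.
Implicit Types (X Y T b c : R -> R) (F G : R3 R -> R) (p xi : R3 R) (lam : R).
Local Notation del := (del alpha).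
Local Notation mu := (mu alpha).
Local Notation tau := (@tau R).
Local Notation mono := (mono alpha).

(** Keeping real and imaginary parts apart lets the complex partial derivatives be
    computed from the real ones. *)
Definition prodC F b c p : R[i] := (F p * b (ct p)) +i* (F p * c (ct p)).

Lemma halfC (x : R[i]) : x / 2 = (2^-1)%:C * x.
Proof. by rewrite mulrC fmorphV /= rmorph_nat. Qed.

Lemma prodCE F b c p : prodC F b c p = (F p)%:C * (b (ct p) +i* c (ct p)).
Proof. by apply/eqP; rewrite eq_complex /= !mul0r subr0 addr0 !eqxx. Qed.

Lemma partial_prodC e F b c p (d : R) : is_derive p e F d -> smooth1 b -> smooth1 c ->
  partial e (prodC F b c) p =
  d%:C * (b (ct p) +i* c (ct p)) + (F p * ct e)%:C * (b^`()%classic (ct p) +i* c^`()%classic (ct p)).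
Proof.
move=> dF sb sc.
have D T : smooth1 T -> 'D_e (fun q => F q * T (ct q)) p = d * T (ct p) + F p * (T^`()%classic (ct p) * ct e).
  move=> sT; have D := is_derive_mul dF
    (is_derive_comp1 (is_derive_ct p e) (smooth1_is_derive (ct p) sT)).
  exact: derive_val.
rewrite /partial /prodC /= (D b sb) (D c sc).
by apply: eqC => /=; ring.
Qed.

Lemma is_derive_nsq_ey p : is_derive p ey (@nsq R) (2 * cy p).
Proof.
apply: is_derive_swap; rewrite (_ : (fun q => nsq (swp q)) = @nsq R); last first.
  by apply/funext => q; rewrite /nsq /swp /cx /cy /= addrC.
exact: is_derive_nsq_ex.
Qed.

(** In the variable [|z|^2] the function [g] is one of the flat functions; both are
    0 at the origin by definition. *)
Lemma gE p : g alpha (zcoord p) = fl alpha 0 0 1 (nsq p).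
Proof.
rewrite /g /zcoord; case: p => [[x y] t] /=.
rewrite /nsq /cx /cy /=; case: eqP => [[-> ->]|/eqP z0].
  by rewrite fl_neg // expr0n /= addr0.
have n0 : 0 < x ^+ 2 + y ^+ 2.
  rewrite lt_neqAle addr_ge0 ?sqr_ge0 // andbT eq_sym paddr_eq0 ?sqr_ge0 // !sqrf_eq0.
  by move: z0; rewrite eq_complex /=.
rewrite fl_pos // !expr0 !mul1r mulN1r /Sp; congr (expR (- _)).
rewrite /powR sqrtr_eq0 leNgt n0 /= -expRN; congr expR.
have -> : ln (x ^+ 2 + y ^+ 2) = 2 * ln (Num.sqrt (x ^+ 2 + y ^+ 2)).
  by rewrite -{1}(sqr_sqrtr (ltW n0)) lnXn ?sqrtr_gt0 // mulr_natl.
by field.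
Qed.

Lemma g1E p : g1 alpha p = (alpha / 2 * fl alpha 1 1 1 (nsq p))%:C * (cx p -i* cy p).
Proof.
have gd e (d : R) : is_derive p e (@nsq R) d ->
    'D_e (fun q => g alpha (zcoord q)) p = alpha / 2 * fl alpha 1 1 1 (nsq p) * d.
  move=> D; have := is_derive_comp1 D (is_derive_fl alpha0 0 0 (nsq p) ltr01).
  rewrite (_ : (fun q => fl alpha 0 0 1 (nsq q)) = (fun q => g alpha (zcoord q))); last first.
    by apply/funext => q; rewrite gE.
  by move=> [_ ->]; rewrite /dfl; ring.
rewrite /g1 /dz /partial /=.
rewrite (gd _ _ (is_derive_nsq_ex p)) (gd _ _ (is_derive_nsq_ey p)) !derive_cst.
move: (alpha / 2 * _) => a; rewrite halfC.
by apply: eqC => /=; field.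
Qed.

(** The derivatives of the [t]-profiles enter through the last term of [L] only,
    where they meet the derivative of [g]. *)
Lemma L_prodC F b c p (dx dy : R) : is_derive p ex F dx -> is_derive p ey F dy ->
  is_derive p et F 0 -> smooth1 b -> smooth1 c ->
  L alpha (prodC F b c) p =
    (2^-1)%:C * ((dx -i* dy) * (b (ct p) +i* c (ct p))) -
    (alpha / 2)%:C * 'i%C * ((fl alpha 1 1 1 (nsq p) * F p)%:C * (cx p -i* cy p)
      * (b^`()%classic (ct p) +i* c^`()%classic (ct p))).
Proof.
move=> Dx Dy Dt sb sc; rewrite /L /dz /dt g1E halfC.
rewrite (partial_prodC Dx sb sc) (partial_prodC Dy sb sc) (partial_prodC Dt sb sc).
rewrite {1 2}/ct /= mulr0.
move: (cx p) (cy p) (fl _ _ _ _ _) (F p) (b _) (c _) (_ (ct p)) (_ (ct p)) => X Y f x b0 c0 b1 c1.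
by apply: eqC => /=; field.
Qed.

(** Iterated derivatives, each divided by [s]; with [s = tau] they stay of size one
    on functions oscillating at frequency [tau]. *)
Definition nder (s : R) T n : R -> R := iter n (fun S x => s^-1 * S^`()%classic x) T.

Lemma smooth1_trig (s : R) : smooth1 (fun x => cos (s * x)) /\ smooth1 (fun x => sin (s * x)).
Proof.
pose S T := exists u v : R, T = fun x => u * cos (s * x) + v * sin (s * x).
have h T : S T -> smooth1 T.
  apply: smooth1_coind => {}T [u [v ->]].
  exists (fun x => (s * v) * cos (s * x) + (- (s * u)) * sin (s * x)).
    by exists (s * v), (- (s * u)).
  move=> x.
  have ds : is_derive x (1 : R) (fun y => s * y) (s * 1) by apply: is_derive1_scale; exact: is_derive_id.
  have D := is_derive1_add
    (is_derive1_scale u (is_derive1_chain ds (is_derive_cos (s * x))))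
    (is_derive1_scale v (is_derive1_chain ds (is_derive_sin (s * x)))).
  by apply: is_derive_eq D _; ring.
split; apply: h.
  by exists 1, 0; apply/funext => x; rewrite mul1r mul0r addr0.
by exists 0, 1; apply/funext => x; rewrite mul1r mul0r add0r.
Qed.

Definition zero_off (r : R) T := forall x, r < `|x| -> T x = 0.

Lemma zero_off_derive r T : smooth1 T -> zero_off r T -> zero_off r (T^`())%classic.
Proof.
move=> sT h x xr; apply: derive_zero_on => //.
have : \forall y \near x, r < `|y|.
  by apply: (cvgr_gt _ (@norm_continuous _ _ x) _ xr).
by apply: filterS => y; exact: h.
Qed.

Lemma nder_smooth s T n r : smooth1 T -> zero_off r T ->
  smooth1 (nder s T n) /\ zero_off r (nder s T n).
Proof.
move=> sT hT; elim: n => [//|n [sn zn]]; split; first exact/smooth1Z/smooth1_derive.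
by move=> x xr; rewrite /nder iterS (zero_off_derive sn zn) // mulr0.
Qed.

Lemma bump_nder s T n : bump1 T -> bump1 (nder s T n).
Proof.
move=> [sT [r r0 hT]]; have [sn zn] := nder_smooth s n sT hT; split => //.
by exists r.
Qed.

Lemma derive_nder s T n x : s != 0 -> (nder s T n)^`()%classic x = s * nder s T n.+1 x.
Proof. by move=> s0; rewrite /nder iterS mulrA divff // mul1r. Qed.

Variables (psi chi : R -> R).
Hypotheses (bpsi : bump1 psi) (bchi : bump1 chi).

Definition wave_re lam n := nder (tau lam) (fun t => chi t * cos (tau lam * t)) n.
Definition wave_im lam n := nder (tau lam) (fun t => chi t * - sin (tau lam * t)) n.

(** The [n]-th normalised derivative of [chi (t) exp (- i tau t)]. *)
Definition wave lam n (t : R) : R[i] := wave_re lam n t +i* wave_im lam n t.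

Lemma zero_wave lam n r : zero_off r chi ->
  [/\ smooth1 (wave_re lam n), smooth1 (wave_im lam n), zero_off r (wave_re lam n) & zero_off r (wave_im lam n)].
Proof.
move=> zc; have [sc _] := bchi; have [s1 s2] := smooth1_trig (tau lam).
have [h1 h2] : smooth1 (wave_re lam n) /\ zero_off r (wave_re lam n).
  apply: nder_smooth; first exact: smooth1M.
  by move=> x xr; rewrite zc // mul0r.
have [h3 h4] : smooth1 (wave_im lam n) /\ zero_off r (wave_im lam n).
  apply: nder_smooth; last by move=> x xr; rewrite zc // mul0r.
  apply: smooth1M => //; rewrite (_ : (fun t => - sin (tau lam * t)) = (fun t => -1 * sin (tau lam * t))).
    exact: smooth1Z.
  by apply/funext => t; rewrite mulN1r.
by split.
Qed.

Lemma bump_wave lam n : bump1 (wave_re lam n) /\ bump1 (wave_im lam n).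
Proof.
have [sc [r r0 zc]] := bchi; have [h1 h2 h3 h4] := zero_wave lam n zc.
by split; split => //; exists r.
Qed.

Let ipsi x : R := x * psi x.
Definition amp lam := mono 0 0 0 psi psi lam.

(** The components of [M1] and [M2] are the derivatives of the profile and of the
    cut-offs, normalised to be of size one: see [is_derive_amp_x]. *)
Definition M1x lam := mono 1 1 1 ipsi psi lam.
Definition M1y lam := mono 1 1 1 psi ipsi lam.
Definition M2x lam := mono 0 0 0 (psi^`())%classic psi lam.
Definition M2y lam := mono 0 0 0 psi (psi^`())%classic lam.

(** The [d/dz] derivative of the amplitude, inside the layer; up to a factor it is
    also [d g / dz] times the amplitude. *)
Definition Zc lam p : R[i] := M1x lam p -i* M1y lam p.

(** The terms of [d/dz] where a cut-off is differentiated. *)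
Definition Wc lam p : R[i] := M2x lam p -i* M2y lam p.

Lemma is_derive_amp_x lam p : 1 <= lam ->
  is_derive p ex (amp lam) (- (alpha * mu lam) * M1x lam p + (del lam)^-1 * M2x lam p).
Proof.
move=> l1; have D := is_derive_mono alpha0 p l1 (isT : admissible 0 0 0) bpsi bpsi.
by apply: is_derive_eq D _; rewrite /M1x /M2x /ipsi; ring.
Qed.

Lemma mono_swp i m n X Z lam p : mono i m n X Z lam (swp p) = mono i m n Z X lam p.
Proof. by rewrite /mono /nsq /swp /cx /cy /= mulrAC [_ ^+ 2 + _]addrC. Qed.

Lemma is_derive_amp_y lam p : 1 <= lam ->
  is_derive p ey (amp lam) (- (alpha * mu lam) * M1y lam p + (del lam)^-1 * M2y lam p).
Proof.
move=> l1; apply: is_derive_swap.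
have -> : (fun q => amp lam (swp q)) = amp lam by apply/funext => q; rewrite /amp mono_swp.
have -> : M1y lam p = M1x lam (swp p) by rewrite /M1x mono_swp.
have -> : M2y lam p = M2x lam (swp p) by rewrite /M2x mono_swp.
exact: is_derive_amp_x.
Qed.

(** The coefficient of the vector field times the amplitude is the same function
    [Zc] as the derivative of the profile: this is what produces the cancellation
    in [Lbar]. *)
Lemma flat_amp lam p : 1 <= lam ->
  (fl alpha 1 1 1 (nsq p) * amp lam p)%:C * (cx p -i* cy p) = (mu lam / tau lam)%:C * Zc lam p.
Proof.
move=> l1; have l0 : lam != 0 by rewrite gt_eqF //; lra.
have d0 := del_neq0 alpha lam; have t0 : tau lam != 0 by rewrite gt_eqF // tau_gt0.
rewrite /Zc /M1x /M1y /amp !monoE /th /ipsi muE.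
move: (cx p) (cy p) (fl _ _ _ _ _) (E _ _ _) (psi _) (psi _) => x y f e a b.
by apply: eqC => /=; field; rewrite l0 d0 t0.
Qed.

Definition probe lam N := prodC (amp lam) (wave_re lam N) (wave_im lam N).

Lemma is_derive_amp_t lam p : 1 <= lam -> is_derive p et (amp lam) 0.
Proof.
move=> l1; have [sp _] := bpsi; apply: is_derive_monot => //.
exact: lt_le_trans l1.
Qed.

(** On the transform of the probe, passing from [wave N] to [wave N.+1] is
    multiplication by [i xi_t / tau], which is [- i] at the peak [xi_t = - tau]: the
    two terms in [Zc] add up there, see [rhs_L]. *)
Lemma L_probe lam N p : 1 <= lam -> L alpha (probe lam N) p =
  - (alpha / 2 * mu lam)%:C * (Zc lam p * wave lam N (ct p)) +
  ((2 * del lam)^-1)%:C * (Wc lam p * wave lam N (ct p)) -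
  (alpha / 2 * mu lam)%:C * 'i%C * (Zc lam p * wave lam N.+1 (ct p)).
Proof.
move=> l1; have [[sr _] [si _]] := bump_wave lam N.
have t0 : tau lam != 0 by rewrite gt_eqF // tau_gt0.
have d0 := del_neq0 alpha lam.
rewrite (L_prodC (is_derive_amp_x p l1) (is_derive_amp_y p l1) (is_derive_amp_t p l1) sr si).
rewrite flat_amp // (derive_nder _ _ _ t0) (derive_nder _ _ _ t0).
rewrite -/(wave_re lam N.+1) -/(wave_im lam N.+1) /wave /Zc /Wc.
move: (M1x _ _) (M1y _ _) (M2x _ _) (M2y _ _) (wave_re _ _ _) (wave_im _ _ _) (wave_re _ _ _) (wave_im _ _ _) (mu lam).
move: d0 t0; move: (del lam) (tau lam) => d t d0 t0 z1 z2 w1 w2 b1 b2 b3 b4 m.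
by apply: eqC => /=; field; rewrite ?d0 ?t0.
Qed.

(** Compared with [L_probe], the coefficient of [wave N.+1] has the opposite sign:
    the two terms in [Zc] cancel at the peak frequency, see [rhs_Lbar]. *)
Lemma Lbar_probe lam N p : 1 <= lam -> Lbar alpha (probe lam N) p =
  - (alpha / 2 * mu lam)%:C * ((Zc lam p)^* * wave lam N (ct p)) +
  ((2 * del lam)^-1)%:C * ((Wc lam p)^* * wave lam N (ct p)) +
  (alpha / 2 * mu lam)%:C * 'i%C * ((Zc lam p)^* * wave lam N.+1 (ct p)).
Proof.
move=> l1; have [[sr _] [si _]] := bump_wave lam N.
have t0 : tau lam != 0 by rewrite gt_eqF // tau_gt0.
have d0 := del_neq0 alpha lam.
have sn : smooth1 (fun t => -1 * wave_im lam N t) by exact: smooth1Z.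
have -> : Lbar alpha (probe lam N) p = (L alpha (prodC (amp lam) (wave_re lam N) (fun t => -1 * wave_im lam N t)) p)^*.
  rewrite /Lbar; congr ((L alpha _ p)^*); apply/funext => q.
  by rewrite /probe /prodC /= mulN1r mulrN.
rewrite (L_prodC (is_derive_amp_x p l1) (is_derive_amp_y p l1) (is_derive_amp_t p l1) sr sn).
have -> : ((fun t => -1 * wave_im lam N t)^`())%classic (ct p) = -1 * (tau lam * wave_im lam N.+1 (ct p)).
  have D := is_derive1_scale (-1) (smooth1_is_derive (ct p) si).
  by rewrite derive1E; move: D => [_ ->]; rewrite (derive_nder _ _ _ t0).
rewrite flat_amp // (derive_nder _ _ _ t0).
rewrite -/(wave_re lam N.+1) /wave /Zc /Wc.
move: (M1x _ _) (M1y _ _) (M2x _ _) (M2y _ _) (wave_re _ _ _) (wave_im _ _ _) (wave_re _ _ _) (wave_im _ _ _) (mu lam).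
move: d0 t0; move: (del lam) (tau lam) => d t d0 t0 z1 z2 w1 w2 b1 b2 b3 b4 m.
by apply: eqC => /=; field; rewrite ?d0 ?t0.
Qed.

End Operators.

(** * Fourier transforms of the probe and of its images *)

Section FourierSide.
Context (R : realType) (alpha : R).
Hypothesis alpha0 : 0 < alpha.
Local Notation normc := ComplexField.Normc.normc.
Implicit Types (X Y T b c : R -> R) (F : R -> R3 R -> R) (G : R -> R3 R -> R[i]) (p xi : R3 R) (lam : R).
Local Notation del := (del alpha).
Local Notation mu := (mu alpha).
Local Notation tau := (@tau R).
Local Notation family := (family alpha).
Local Notation Dn := (Dn alpha).

Definition familyC t G := family t (fun lam p => complex.Re (G lam p)) /\ family t (fun lam p => complex.Im (G lam p)).

Definition FTc G T lam xi : R :=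
  FT (fun lam p => complex.Re (G lam p)) T lam xi + FT (fun lam p => complex.Im (G lam p)) T lam xi.

Lemma FTc_ge0 G T lam xi : 0 <= FTc G T lam xi.
Proof. by rewrite addr_ge0 ?FT_ge0. Qed.

Lemma familyC_real t F : family t F -> familyC t (fun lam p => (F lam p)%:C).
Proof.
move=> cF; split => //.
by apply: (family_eq _ (family_scalec 0 cF)) => lam p; rewrite mul0r.
Qed.

Lemma familyC_conj t G : familyC t G -> familyC t (fun lam p => (G lam p)^*).
Proof.
move=> [cr ci]; split; first by apply: (family_eq _ cr) => lam p; case: (G lam p).
by apply: (family_eq _ (family_scalec (-1) ci)) => lam p; rewrite mulN1r; case: (G lam p).
Qed.

Lemma familyC_pair t F F' : family t F -> family t F' -> familyC t (fun lam p => F lam p -i* F' lam p).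
Proof.
move=> cF cF'; split => //.
by apply: (family_eq _ (family_scalec (-1) cF')) => lam p; rewrite mulN1r.
Qed.

(** The conjugate of [z] in units of [del], which is bounded on the supports. *)
Definition zbar lam p : R[i] := (cx p / del lam) -i* (cy p / del lam).

Lemma zbarE lam p : (zcoord p)^* = (del lam)%:C * zbar lam p.
Proof.
have d0 := del_neq0 alpha lam.
rewrite /zcoord /zbar /cx /cy; apply: eqC => /=; field => //.
Qed.

Lemma familyC_zbar t G k : familyC t G -> familyC t (fun lam p => zbar lam p ^+ k * G lam p).
Proof.
move=> cG; elim: k => [|k [cr ci]].
  by move: cG => [cr ci]; split; [apply: (family_eq _ cr)|apply: (family_eq _ ci)] => lam p; rewrite expr0 mul1r.
split.
  apply: (family_eq _ (family_add (family_mulx cr) (family_muly ci))) => lam p; cbv beta; rewrite exprS -[zbar _ _ * _ * _]mulrA.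
  by move: (zbar lam p ^+ k * G lam p) => [a b]; rewrite /zbar /=; ring.
apply: (family_eq _ (family_add (family_mulx ci) (family_scalec (-1) (family_muly cr)))) => lam p; cbv beta; rewrite exprS -[zbar _ _ * _ * _]mulrA.
by move: (zbar lam p ^+ k * G lam p) => [a b]; rewrite /zbar /=; ring.
Qed.

Lemma fourier_nder t F T lam xi n (s : R) : family t F -> bump1 T -> 1 <= lam ->
  fourier (cplx (fun p => F lam p * nder s T n (ct p))) xi =
  ('i%C * (xi.2 / s)%:C) ^+ n * fourier (cplx (fun p => F lam p * T (ct p))) xi.
Proof.
move=> cF bT l1; have l0 : 0 < lam by exact: lt_le_trans l1.
elim: n => [|n IH]; first by rewrite expr0 mul1r.
have bS := bump_nder s n bT; have [sS _] := bS.
have D Z p : smooth1 Z -> is_derive p et (fun q => F lam q * Z (ct q)) (F lam p * (Z^`())%classic (ct p)).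
  move=> sZ; have D := is_derive_mul (family_derive_et p cF l0)
    (is_derive_comp1 (is_derive_ct p et) (smooth1_is_derive (ct p) sZ)).
  by apply: is_derive_eq D _; rewrite mul0r add0r /ct /= mulr1.
have etb : et \in @basis3 R by rewrite !inE eqxx !orbT.
have t1 := family_tame alpha0 cF bS l1; have t2 := family_tame alpha0 cF (bump_derive bS) l1.
have dK p : derivable (fun q => F lam q * ((nder s T n)^`())%classic (ct q)) p et.
  by have [] := D _ p (smooth1_derive sS).
have -> : cplx (fun p => F lam p * nder s T n.+1 (ct p)) =
    (fun p => (s^-1)%:C * cplx (fun q => F lam q * ((nder s T n)^`())%classic (ct q)) p).
  by apply/funext => p; rewrite /cplx /nder iterS -rmorphM /= mulrCA.
rewrite fourierZ; last exact: tameC_real.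
rewrite (fourier_deriv xi etb t1 t2 (fun p => D _ p sS) dK) IH exprS.
have -> : dot3 et xi = xi.2 by rewrite /dot3 /et /=; ring.
rewrite rmorphM /=; ring.
Qed.

Variables (chi : R -> R).
Hypothesis bchi : bump1 chi.
Local Notation wave := (wave chi).

Lemma fourier_wave t F lam xi n : family t F -> 1 <= lam ->
  tameC (fun p => (F lam p)%:C * wave lam n (ct p)) /\
  fourier (fun p => (F lam p)%:C * wave lam n (ct p)) xi =
  ('i%C * (xi.2 / tau lam)%:C) ^+ n * fourier (cplx (fun p => F lam p * chi (ct p))) (shift_t (tau lam) xi).
Proof.
move=> cF l1; have [b1 b2] := bump_wave bchi lam n; have [b3 b4] := bump_wave bchi lam 0.
have tm T : bump1 T -> tameC (cplx (fun p => F lam p * T (ct p))).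
  by move=> bT; apply: tameC_real; exact: (family_tame alpha0 cF bT l1).
have E m : (fun p => (F lam p)%:C * wave lam m (ct p)) =
    (fun p => cplx (fun p => F lam p * wave_re chi lam m (ct p)) p
      + 'i%C * cplx (fun p => F lam p * wave_im chi lam m (ct p)) p).
  apply/funext => p; rewrite /cplx /wave.
  by apply: eqC => /=; ring.
rewrite E; split; first by apply: tameC_add; [exact: tm|apply: tameC_scale; exact: tm].
rewrite fourierD; [|exact: tm|apply: tameC_scale; exact: tm].
rewrite fourierZ; last exact: tm.
rewrite (fourier_nder xi n (tau lam) cF b3 l1) (fourier_nder xi n (tau lam) cF b4 l1).
rewrite mulrCA -mulrDr; congr (_ * _).
rewrite -fourier_shift; have := E 0%N.
have -> : (fun p => (F lam p * chi (ct p))%:C * expNi (tau lam * ct p)) = (fun p => (F lam p)%:C * wave lam 0 (ct p)).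
  apply/funext => p; rewrite /wave /wave_re /wave_im /nder /= /expNi.
  by apply: eqC => /=; ring.
move=> ->; rewrite fourierD; [|exact: tm|apply: tameC_scale; exact: tm].
by rewrite fourierZ; last exact: tm.
Qed.

(** The transform of a complex amplitude times [chi], recentred at the peak. *)
Definition hatc G lam xi : R[i] :=
  fourier (cplx (fun p => complex.Re (G lam p) * chi (ct p))) (shift_t (tau lam) xi) +
  'i%C * fourier (cplx (fun p => complex.Im (G lam p) * chi (ct p))) (shift_t (tau lam) xi).

Lemma hatc_le G lam xi : normc (hatc G lam xi) <= FTc G chi lam (shift_t (tau lam) xi).
Proof.
apply: le_trans (normcD _ _) _.
by rewrite normcM normci mul1r.
Qed.

Lemma fourier_waveC t G lam xi n : familyC t G -> 1 <= lam ->
  tameC (fun p => G lam p * wave lam n (ct p)) /\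
  fourier (fun p => G lam p * wave lam n (ct p)) xi =
  ('i%C * (xi.2 / tau lam)%:C) ^+ n * hatc G lam xi.
Proof.
move=> [cr ci] l1.
have [t1 f1] := fourier_wave xi n cr l1; have [t2 f2] := fourier_wave xi n ci l1.
have -> : (fun p => G lam p * wave lam n (ct p)) =
   (fun p => (complex.Re (G lam p))%:C * wave lam n (ct p) + 'i%C * ((complex.Im (G lam p))%:C * wave lam n (ct p))).
  apply/funext => p; case: (G lam p) => a b; rewrite /wave.
  by apply: eqC => /=; ring.
split; first by apply: tameC_add t1 _; exact: tameC_scale.
rewrite fourierD //; last exact: tameC_scale.
by rewrite fourierZ // f1 f2 /hatc mulrDr [in RHS]mulrCA.
Qed.

Lemma normcX (a : R[i]) n : normc (a ^+ n) = normc a ^+ n.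
Proof.
elim: n => [|n IH]; last by rewrite !exprS normcM IH.
by rewrite !expr0 -[1]/((1 : R)%:C) normc_real normr1.
Qed.

Lemma norm_theta lam xi n : normc (('i%C * (xi.2 / tau lam)%:C) ^+ n) = (`|xi.2| / tau lam) ^+ n.
Proof.
rewrite normcX normcM normci mul1r normc_real normrM normfV (@ger0_norm _ (tau lam)) //.
exact/ltW/tau_gt0.
Qed.

(** Both [L] and [Lbar] applied to the probe have this form; the coefficient of the
    first amplitude becomes a function of [xi_t / tau], where the cancellation takes
    place. *)
Lemma fourier3 t1 t2 G1 G2 (c1 c2 c3 : R[i]) lam xi N : familyC t1 G1 -> familyC t2 G2 -> 1 <= lam ->
  normc (fourier (fun p => c1 * (G1 lam p * wave lam N (ct p)) + c2 * (G2 lam p * wave lam N (ct p))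
     + c3 * (G1 lam p * wave lam N.+1 (ct p))) xi) <=
  (`|xi.2| / tau lam) ^+ N *
  (normc (c1 + c3 * ('i%C * (xi.2 / tau lam)%:C)) * FTc G1 chi lam (shift_t (tau lam) xi) +
   normc c2 * FTc G2 chi lam (shift_t (tau lam) xi)).
Proof.
move=> g1 g2 l1.
have [ta fa] := fourier_waveC xi N g1 l1; have [tb fb] := fourier_waveC xi N g2 l1.
have [tc fc] := fourier_waveC xi N.+1 g1 l1.
have tab : tameC (fun p => c1 * (G1 lam p * wave lam N (ct p)) + c2 * (G2 lam p * wave lam N (ct p))).
  by apply: tameC_add; exact: tameC_scale.
rewrite fourierD //; last exact: tameC_scale.
rewrite fourierD; [|exact: tameC_scale|exact: tameC_scale].
rewrite !fourierZ // fa fb fc exprS -norm_theta.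
move: ('i%C * _ : R[i]) => th.
have -> : c1 * (th ^+ N * hatc G1 lam xi) + c2 * (th ^+ N * hatc G2 lam xi) + c3 * (th * th ^+ N * hatc G1 lam xi)
   = th ^+ N * ((c1 + c3 * th) * hatc G1 lam xi + c2 * hatc G2 lam xi) by ring.
rewrite normcM ler_wpM2l ?normc_ge0 //.
apply: le_trans (normcD _ _) _; rewrite !normcM.
by apply: lerD; apply: ler_wpM2l; rewrite ?normc_ge0 ?hatc_le.
Qed.

Lemma symbol_decayC t G s r N : familyC t G -> 0 <= s -> (1 <= N)%N -> 2 * `|r| <= N%:R ->
  exists2 C, 0 <= C & forall lam xi, 2 <= lam -> mu lam <= tau lam ->
  LambdaS s xi * logLambdaS r xi * ((`|xi.2| / tau lam) ^+ N *
    ((1 + `|xi.2 + tau lam|) * FTc G chi lam (shift_t (tau lam) xi))) <=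
  C * (tau lam `^ s * lam `^ r) * Dn t lam * weight3 (mu lam) (tau lam) xi.
Proof.
move=> [cr ci] s0 N1 rN.
have [C1 C10 H1] := symbol_decay alpha0 cr bchi s0 N1 rN; have [C2 C20 H2] := symbol_decay alpha0 ci bchi s0 N1 rN.
exists (C1 + C2); first exact: addr_ge0.
move=> lam xi l2 mt; have := H1 lam xi l2 mt; have := H2 lam xi l2 mt; rewrite /FTc.
move: (FT _ _ _ _) (FT _ _ _ _) (1 + `|_|) (_ ^+ N) (LambdaS _ _ * _) (_ `^ s * _) (Dn t lam) (weight3 _ _ _).
by clear => f1 f2 a y S q D o h1 h2; lra.
Qed.

(** The square of the norm of any function whose transform is dominated, up to one
    power of [1 + |xi_t + tau|], by the transforms of two amplitudes.  That spare
    power lets the coefficients depend on [xi_t]. *)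
Lemma normsq_bound t1 t2 G1 G2 s r N th : familyC t1 G1 -> familyC t2 G2 -> 0 <= s -> (1 <= N)%N ->
  2 * `|r| <= N%:R -> 0 < th -> th <= 1 ->
  exists2 C, 0 <= C & forall lam a1 a2 (v : R3 R -> R[i]), 2 <= lam -> mu lam <= tau lam ->
   0 <= a1 -> 0 <= a2 ->
   (forall xi, normc (fourier v xi) <= (`|xi.2| / tau lam) ^+ N * ((1 + `|xi.2 + tau lam|) *
      (a1 * FTc G1 chi lam (shift_t (tau lam) xi) + a2 * FTc G2 chi lam (shift_t (tau lam) xi)))) ->
   (log_sobolev_normsq r s v <=
    (C * (tau lam `^ s * lam `^ r * (a1 * Dn t1 lam + a2 * Dn t2 lam) * mu lam `^ th) ^+ 2)%:E)%E.
Proof.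
move=> g1 g2 s0 N1 rN th0 th1.
have [C1 C10 H1] := symbol_decayC g1 s0 N1 rN; have [C2 C20 H2] := symbol_decayC g2 s0 N1 rN.
pose P : R := (2 * pi) ^- 3.
have P0 : 0 <= P by rewrite invr_ge0 exprn_ge0 // mulr_ge0 // pi_ge0.
exists (P * ((2 / th) ^+ 3 * (C1 + C2) ^+ 2)).
  by rewrite mulr_ge0 // mulr_ge0 ?sqr_ge0 // exprn_ge0 // divr_ge0 // ltW.
move=> lam a1 a2 v l2 mt a10 a20 hv.
have l1 : 1 <= lam by lra.
have m1 := mu_ge1 alpha0 l1.
have D1 := Dn_ge0 alpha t1 l1; have D2 := Dn_ge0 alpha t2 l1.
pose B := (C1 + C2) * (tau lam `^ s * lam `^ r * (a1 * Dn t1 lam + a2 * Dn t2 lam)).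
have sym0 xi : 0 <= LambdaS s xi * logLambdaS r xi by rewrite mulr_ge0 ?powR_ge0.
have hB xi : LambdaS s xi * logLambdaS r xi * normc (fourier v xi) <= B * weight3 (mu lam) (tau lam) xi.
  apply: le_trans (ler_wpM2l (sym0 xi) (hv xi)) _.
  have := ler_wpM2l a10 (H1 lam xi l2 mt); have := ler_wpM2l a20 (H2 lam xi l2 mt).
  have o0 := weight3_ge0 (mu lam) (tau lam) xi.
  have q0 : 0 <= tau lam `^ s * lam `^ r by rewrite mulr_ge0 ?powR_ge0.
  rewrite /B; move: q0 o0; move: (weight3 _ _ _) (tau lam `^ s * lam `^ r) (LambdaS s xi * _) => o q S q0 o0.
  move: ((`|xi.2| / tau lam) ^+ N) (1 + `|xi.2 + tau lam|) (FTc G1 _ _ _) (FTc G2 _ _ _) => y z f1 f2 h2 h1.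
  move: D1 D2 h1 h2; move: (Dn t1 lam) (Dn t2 lam) => d1 d2 D1 D2 h1 h2.
  have e1 : 0 <= C2 * a1 * (q * d1 * o) by rewrite !mulr_ge0.
  have e2 : 0 <= C1 * a2 * (q * d2 * o) by rewrite !mulr_ge0.
  clear -h1 h2 e1 e2; lra.
rewrite /log_sobolev_normsq /multiplier_normsq -/P.
have hI := @int_weight3 R th (mu lam) (tau lam) (fun xi => LambdaS s xi * logLambdaS r xi * normc (fourier v xi)) B th0 th1 m1
  (fun xi => mulr_ge0 (sym0 xi) (normc_ge0 _)) hB.
have hP : (0 <= P%:E)%E by rewrite lee_fin.
apply: le_trans (lee_wpmul2l hP hI) _; rewrite -EFinM lee_fin; apply: le_eq.
rewrite /B; move: (mu lam `^ th) ((2 / th) ^+ 3) => b c; ring.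
Qed.

End FourierSide.

(** * Cut-offs, and the lower bound for the left-hand side *)

Section Cutoffs.
Context (R : realType).
Implicit Types (z : R3 R -> R) (p : R3 R).

Definition inbox (a b : R) p := [/\ `|cx p| <= a, `|cy p| <= a & `|ct p| <= b].

Lemma smooth_line f : smooth f -> smooth1 (fun t : R => f (t *: et + 0) : R).
Proof.
move=> sf; pose S (F : R -> R) := exists2 h, smooth h & F = fun t => h (t *: et + 0).
apply: (@smooth1_coind R S); last by exists f.
have etb : et \in @basis3 R by rewrite !inE eqxx !orbT.
move=> F [h sh ->]; exists (fun t => 'D_et h (t *: et + 0)).
  by exists (fun p => 'D_et h p) => //; exact: smooth_derive.
move=> t; apply/is_derive_line; exact: smooth_is_derive.
Qed.

(** The one-variable cut-offs are restrictions of the given cut-off to the [t]-axis,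
    which avoids constructing bump functions. *)
Lemma cutoff_line z : cutoff z -> exists (beta : R -> R) (rho M : R),
  [/\ smooth1 beta, (forall t, 0 <= beta t), 0 < rho, 0 < M & 
   [/\ zero_off M beta, (forall t, `|t| < rho -> beta t = 1) &
    forall p, `|cx p| < rho -> `|cy p| < rho -> `|ct p| < rho -> z p = 1]].
Proof.
move=> [sz cz z01 z1].
have [rho /= r0 hr] := (nbhs_ballP (0 : R3 R) _).1 z1.
have hb p : `|cx p| < rho -> `|cy p| < rho -> `|ct p| < rho -> z p = 1.
  move=> h1 h2 h3; apply: (hr p); split; first split.
  - by rewrite /ball /= sub0r normrN.
  - by rewrite /ball /= sub0r normrN.
  - by rewrite /ball /= sub0r normrN.
have cti (t : R) : [/\ cx (t *: et + 0) = 0, cy (t *: et + 0) = 0 & ct (t *: et + 0) = t].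
  by rewrite addr0 /cx /cy /ct /et /=; split; rewrite /GRing.scale /= ?mulr0 ?mulr1 // /GRing.scale /= mulr0.
have [M [_ hM]] := compact_bounded cz.
have M0 : 0 < `|M| + 1 by rewrite ltr_wpDl.
exists (fun t => z (t *: et + 0)), rho, (`|M| + 1); split => //.
- exact: smooth_line.
- by move=> t; case/andP: (z01 (t *: et + 0)).
split => //.
- move=> t tM; apply/eqP; apply/negP => /negP zn.
  have hs : supp z (t *: et + 0) by apply: subset_closure.
  have Mlt : M < `|M| + 1 by rewrite (le_lt_trans (ler_norm _)) ?ltrDl.
  have h : `|t *: et + 0 : R3 R| <= `|M| + 1 := hM _ Mlt _ hs.
  move: h; rewrite leNgt => /negP; apply; apply: (lt_le_trans tM).
  have [_ _ e3] := cti t; rewrite -{1}e3 prod_normE le_max; apply/orP; right.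
  exact: lexx.
- by move=> t tr; have [e1 e2 e3] := cti t; apply: hb; rewrite ?e1 ?e2 ?e3 ?normr0.
Qed.

(** Two dilations of the same restriction: [psi] equals 1 on [[-2, 2]], and [chi] is
    supported so close to 0 that the given cut-off equals 1 on the support of the
    probe. *)
Lemma cutoff_bumps z : cutoff z -> exists (psi chi : R -> R) (Y rho t0 : R),
  [/\ [/\ smooth1 psi, 0 < Y, zero_off Y psi, (forall x, `|x| <= 2 -> psi x = 1) & (forall x, 0 <= psi x)],
   [/\ smooth1 chi, 0 < t0, zero_off (rho / 2) chi, (forall t, `|t| <= t0 -> chi t = 1) & (forall t, 0 <= chi t)],
   0 < rho & forall p, inbox (rho / 2) (rho / 2) p -> z p = 1].
Proof.
move=> /cutoff_line[beta [rho [M [sb b0 r0 M0 [zb b1 hz]]]]].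
pose dil (e : R) x := beta (e * x).
have sd e : smooth1 (dil e).
  by apply: (@smooth1_comp R beta (fun x => e * x)) => //; apply: smooth1Z; exact: smooth1_id.
have zd e : 0 < e -> zero_off (M / e) (dil e).
  by move=> e0 x xM; apply: zb; rewrite normrM (gtr0_norm e0) mulrC -ltr_pdivrMr.
have d1 e x : 0 < e -> `|x| <= rho / 2 / e -> dil e x = 1.
  move=> e0 xr; apply: b1; rewrite normrM (gtr0_norm e0) mulrC.
  by move: xr; rewrite ler_pdivlMr //; lra.
(* [e * 2 <= rho / 2] makes the first dilation equal to 1 on [[-2, 2]], and
   [M / k = rho / 2] is the support radius of the second. *)
pose e := rho / 4; pose k := 2 * M / rho.
have e0 : 0 < e by rewrite divr_gt0.
have k0 : 0 < k by rewrite divr_gt0 ?mulr_gt0.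
exists (dil e), (dil k), (M / e), rho, (rho / 2 / k); split.
- split.
  + exact: sd.
  + by rewrite divr_gt0.
  + exact: zd.
  + move=> x x2; apply: d1 => //; apply: le_trans x2 _; apply: le_eq.
    by rewrite /e; field; rewrite gt_eqF.
  + by move=> x; exact: b0.
- split.
  + exact: sd.
  + by apply: divr_gt0 => //; apply: divr_gt0.
  + have -> : rho / 2 = M / k by rewrite /k; field; rewrite !gt_eqF.
    exact: zd.
  + by move=> x; exact: d1.
  + by move=> x; exact: b0.
- exact: r0.
- by move=> p [h1 h2 h3]; apply: hz; lra.
Qed.

(** Applied to the cut-offs of the estimate, which thereby leave the probe and its
    images unchanged. *)
Lemma cut_id z (v : R3 R -> R[i]) (B : R3 R -> Prop) : (forall p, B p -> z p = 1) ->
  (forall p, ~ B p -> v p = 0) -> (fun p => (z p)%:C * v p) = v.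
Proof.
move=> z1 v0; apply/funext => p; case: (pselect (B p)) => [/z1 ->|/v0 ->]; last by rewrite mulr0.
by rewrite mul1r.
Qed.

Lemma compact_inbox a b : compact [set p : R3 R | inbox a b p].
Proof.
have -> : [set p : R3 R | inbox a b p] = (`[- a, a] `*` `[- a, a]) `*` `[- b, b].
  apply/seteqP; split => -[[x y] t]; rewrite /inbox /cx /cy /ct /= !in_itv /= -!ler_norml.
    by move=> [-> -> ->].
  by move=> [[-> ->] ->].
by apply: compact_setX; [apply: compact_setX; exact: segment_compact|exact: segment_compact].
Qed.

Lemma hausdorff3 : hausdorff_space (R3 R).
Proof. exact: norm_hausdorff. Qed.

Lemma compact_supp (v : R3 R -> R[i]) a b : (forall p, ~ inbox a b p -> v p = 0) -> compact (supp v).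
Proof.
move=> h; apply: (@subclosed_compact _ _ [set p | inbox a b p]); first exact: closed_closure.
  exact: compact_inbox.
have cb : closed [set p | inbox a b p] by apply: compact_closed; [exact: hausdorff3|exact: compact_inbox].
rewrite [X in _ `<=` X](closure_id _).1 //; apply: closure_subset => p /= vp.
by apply/not_notP => nb; move: vp; rewrite h ?eqxx.
Qed.

End Cutoffs.

Section Probe.
Context (R : realType) (alpha : R).
Hypothesis alpha0 : 0 < alpha.
Local Notation L3 := (@leb3 R).
Local Notation normc := ComplexField.Normc.normc.
Implicit Types (X T : R -> R) (p xi : R3 R) (lam : R).
Local Notation del := (del alpha).
Local Notation tau := (@tau R).
Variables (psi chi : R -> R) (Y rt t0 : R).
Hypotheses (spsi : smooth1 psi) (Y0 : 0 < Y) (zpsi : zero_off Y psi)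
  (psi1 : forall x, `|x| <= 2 -> psi x = 1) (psi0 : forall x, 0 <= psi x).
Hypotheses (schi : smooth1 chi) (rt0 : 0 < rt) (zchi : zero_off rt chi) (t00 : 0 < t0)
  (chi1 : forall x, `|x| <= t0 -> chi x = 1) (chi0 : forall x, 0 <= chi x).
Local Notation wave := (wave chi).
Local Notation probe := (probe alpha psi chi).
Local Notation amp := (amp alpha psi).

Lemma bump1_psi : bump1 psi. Proof. by split => //; exists Y => //; exact: ltW. Qed.
Lemma bump1_chi : bump1 chi. Proof. by split => //; exists rt => //; exact: ltW. Qed.

Lemma mono_off i m n X T lam p : zero_off Y X -> zero_off Y T ->
  ~ (`|cx p| <= Y * del lam /\ `|cy p| <= Y * del lam) -> mono alpha i m n X T lam p = 0.
Proof.
move=> zX zT np; have d0 := del_gt0 alpha lam.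
have out c : Y * del lam < `|c| -> Y < `|c / del lam|.
  by move=> h; rewrite normrM normfV (gtr0_norm d0) ltr_pdivlMr.
have [hx|hx] := leP `|cx p| (Y * del lam); last by rewrite /mono zX ?mulr0 ?mul0r //; exact: out.
have [hy|hy] := leP `|cy p| (Y * del lam); last by rewrite /mono zT ?mulr0 //; exact: out.
by case: np.
Qed.

Lemma wave_off lam n t : rt < `|t| -> wave lam n t = 0.
Proof.
move=> h; have [_ _ z1 z2] := zero_wave bump1_chi lam n zchi.
by rewrite /wave z1 // z2.
Qed.

Lemma prod_off (A : R[i]) lam n p : (~ (`|cx p| <= Y * del lam /\ `|cy p| <= Y * del lam) -> A = 0) ->
  ~ inbox (Y * del lam) rt p -> A * wave lam n (ct p) = 0.
Proof.
move=> hA np; have [ht|ht] := leP `|ct p| rt; last by rewrite wave_off ?mulr0.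
by rewrite hA ?mul0r // => -[hx hy]; apply: np.
Qed.

Lemma zipsi : zero_off Y (fun x => x * psi x).
Proof. by move=> x h; rewrite zpsi // mulr0. Qed.

Lemma probeE lam N : probe lam N = fun p => (amp lam p)%:C * wave lam N (ct p).
Proof. by apply/funext => p; rewrite /probe prodCE. Qed.

Lemma probe_off lam N p : ~ inbox (Y * del lam) rt p -> probe lam N p = 0.
Proof.
move=> np; rewrite probeE prod_off // => h.
by rewrite /amp mono_off.
Qed.

Lemma ZW_off lam p : ~ (`|cx p| <= Y * del lam /\ `|cy p| <= Y * del lam) ->
  Zc alpha psi lam p = 0 /\ Wc alpha psi lam p = 0.
Proof.
move=> np; have zd := zero_off_derive spsi zpsi; have zi := zipsi.
by rewrite /Zc /Wc /M1x /M1y /M2x /M2y !mono_off // oppr0.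
Qed.

Lemma L_off lam N p : 1 <= lam -> ~ inbox (Y * del lam) rt p ->
  L alpha (probe lam N) p = 0 /\ Lbar alpha (probe lam N) p = 0.
Proof.
move=> l1 np; rewrite (L_probe alpha0 bump1_psi bump1_chi) // (Lbar_probe alpha0 bump1_psi bump1_chi) //.
have h0 : (0 : R[i])^* = 0 by apply/eqP; rewrite eq_complex /= oppr0 !eqxx.
by rewrite !prod_off ?mulr0 ?addr0 ?subr0 // => /ZW_off[z w]; rewrite ?z ?w ?h0.
Qed.

Lemma smooth_probe lam N : smoothC (probe lam N).
Proof.
have [[s1 _] [s2 _]] := bump_wave bump1_chi lam N.
have sa : smooth (amp lam).
  rewrite /amp (_ : mono _ _ _ _ _ _ _ = (fun p => E alpha lam (nsq p) * psi ((del lam)^-1 * cx p) * psi ((del lam)^-1 * cy p))).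
    have sn : smooth (@nsq R).
      rewrite (_ : @nsq R = fun p => cx p * cx p + cy p * cy p); last by apply/funext => p; rewrite /nsq !expr2.
      by apply: smoothD; apply: smoothM; [exact: smooth_cx|exact: smooth_cx|exact: smooth_cy|exact: smooth_cy].
    apply: smoothM; first apply: smoothM.
    - by apply: (smooth_comp (smooth1_E alpha0 lam)).
    - by apply: (smooth_comp spsi); apply: smoothM; [exact: smooth_cst|exact: smooth_cx].
    - by apply: (smooth_comp spsi); apply: smoothM; [exact: smooth_cst|exact: smooth_cy].
  apply/funext => p; rewrite /mono /th !expr0 !mul1r.
  by rewrite ![(del lam)^-1 * _]mulrC.
by split; apply: smoothM => //; apply: smooth_comp => //; exact: smooth_ct.
Qed.

Lemma test_probe lam N : test_function (probe lam N).
Proof.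
split; first exact: smooth_probe.
by apply: (@compact_supp _ _ (Y * del lam) rt) => p; exact: probe_off.
Qed.

(** Near the peak the symbol is at least a multiple of [tau^s] and the transform is
    at least a multiple of [del^2] on a box of volume of order [1 / del^2]. *)
Lemma probe_lower s N : 0 <= s -> exists c a : R, [/\ 0 < c, 0 < a & forall lam, 1 <= lam -> 2 * a <= tau lam ->
  ((c * (tau lam `^ s * del lam) ^+ 2)%:E <= sobolev_normsq s (probe lam N))%E].
Proof.
move=> s0.
have [c [a [c0 a0 hc]]] := FT_lower alpha0 spsi Y0 zpsi psi1 psi0 bump1_chi chi0 t00 chi1.
pose P : R := (2 * pi) ^- 3.
have P0 : 0 < P by rewrite invr_gt0 exprn_gt0 // mulr_gt0 // pi_gt0.
pose k : R := 2^-1 `^ s * 2^-1 ^+ N * c.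
have k0 : 0 < k by rewrite mulr_gt0 // mulr_gt0 ?powR_gt0 // exprn_gt0.
exists (P * (k ^+ 2 * (8 * a ^+ 3))), a; split => //.
  by rewrite !mulr_gt0 // exprn_gt0.
move=> lam l1 ta; have d0 := del_gt0 alpha lam; have t1 := tau_gt0 lam.
have ca : family alpha gen amp by apply: family_gen; exact: bump1_psi.
have fu xi : normc (fourier (probe lam N) xi) = (`|xi.2| / tau lam) ^+ N * FT amp chi lam (shift_t (tau lam) xi).
  have [_ fE] := fourier_wave alpha0 bump1_chi xi N ca l1.
  by rewrite probeE fE normcM norm_theta.
rewrite /sobolev_normsq /multiplier_normsq -/P.
pose K := k * tau lam `^ s * del lam ^+ 2.
have K0 : 0 <= K by rewrite !mulr_ge0 ?powR_ge0 ?sqr_ge0 // ltW.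
have ad : 0 <= a / del lam by rewrite divr_ge0 // ltW.
pose bxs xi : R := ind (a / del lam) (cx xi) * ind (a / del lam) (cy xi) * ind a (ct xi + tau lam).
have low xi : K ^+ 2 * bxs xi <= (LambdaS s xi * normc (fourier (probe lam N) xi)) ^+ 2.
  rewrite /bxs.
  have [xr|xr] := leP `|cx xi| (a / del lam); last by rewrite (ind0 xr) !mul0r mulr0 sqr_ge0.
  have [yr|yr] := leP `|cy xi| (a / del lam); last by rewrite (ind0 yr) mulr0 mul0r mulr0 sqr_ge0.
  have [tr|tr] := leP `|ct xi + tau lam| a; last by rewrite (ind0 tr) !mulr0 sqr_ge0.
  rewrite !ind1 // !mulr1.
  have hF : c * del lam ^+ 2 <= FT amp chi lam (shift_t (tau lam) xi) by exact: hc.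
  have ht : tau lam / 2 <= `|xi.2|.
    have := ler_normB (ct xi + tau lam) (ct xi); rewrite addrAC subrr add0r (gtr0_norm t1).
    rewrite /ct in tr *; lra.
  have hy : 2^-1 <= `|xi.2| / tau lam by rewrite ler_pdivlMr //; lra.
  have hyN : 2^-1 ^+ N <= (`|xi.2| / tau lam) ^+ N.
    by apply: lerXn2r => //; rewrite nnegrE; lra.
  have hL : 2^-1 `^ s * tau lam `^ s <= LambdaS s xi.
    rewrite -powRM ?(ltW t1) // /LambdaS.
    have -> : (2^-1 * tau lam) `^ s = ((2^-1 * tau lam) ^+ 2) `^ (s / 2).
      by rewrite -powR_mulrn ?mulr_ge0 ?ltW // -powRrM; congr (_ `^ _); field.
    have d3 : 0 <= 1 + dot3 xi xi by exact: addr_ge0 ler01 (dot3_ge0 xi).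
    apply: ge0_ler_powR; rewrite ?nnegrE ?sqr_ge0 ?d3 ?divr_ge0 //.
    have := sqr_ge0 xi.1.1; have := sqr_ge0 xi.1.2; rewrite /dot3 -!expr2.
    have : (2^-1 * tau lam) ^+ 2 <= xi.2 ^+ 2.
      rewrite -[leRHS]real_normK ?num_real //; apply: lerXn2r; rewrite ?nnegrE ?mulr_ge0 ?(ltW t1) //; lra.
    lra.
  rewrite fu; apply: lerXn2r; rewrite ?nnegrE //.
    apply: mulr_ge0; first exact: powR_ge0.
    by apply: mulr_ge0; [apply: exprn_ge0; apply: divr_ge0 => //; exact: ltW|exact: FT_ge0].
  have cd : 0 <= c * del lam ^+ 2 by apply: mulr_ge0; [exact: ltW|exact: sqr_ge0].
  have h0 : 0 <= (2^-1 : R) ^+ N by rewrite exprn_ge0.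
  have p1 := ler_pM (mulr_ge0 (powR_ge0 2^-1 s) (powR_ge0 (tau lam) s)) (mulr_ge0 h0 cd) hL
    (ler_pM h0 cd hyN hF).
  apply: le_trans p1; apply: le_eq.
  by rewrite /K /k; ring.
have I : (\int[L3]_xi (K ^+ 2 * bxs xi)%:E = (K ^+ 2 * (8 * a ^+ 3 / del lam ^+ 2))%:E)%E.
  have mi : measurable_fun setT (fun t : R => ind a (t + tau lam)).
    apply: (measurableT_comp (meas_ind a)); exact: measurable_funD.
  have mb : measurable_fun setT bxs.
    apply: measurable_funM; first apply: measurable_funM.
    - by apply: (measurableT_comp (meas_ind _)); exact: meas_cx.
    - by apply: (measurableT_comp (meas_ind _)); exact: meas_cy.
    - by apply: (measurableT_comp mi); exact: meas_ct.
  rewrite ge0_intZ ?sqr_ge0 //; last by move=> xi; rewrite !mulr_ge0 ?ind_ge0.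
  rewrite (@tonelli_prod R (ind (a / del lam)) (ind (a / del lam)) (fun t => ind a (t + tau lam))) //;
    try (by move=> ?; exact: ind_ge0); try exact: meas_ind.
  rewrite !integral_ind // int_shift_ind ?(ltW a0) //.
  by rewrite -!EFinM; congr EFin; field; rewrite gt_eqF.
have hI : (\int[L3]_xi (K ^+ 2 * bxs xi)%:E <= \int[L3]_xi ((LambdaS s xi * normc (fourier (probe lam N) xi)) ^+ 2)%:E)%E.
  apply: ge0_le_int => xi; rewrite lee_fin //.
  by rewrite mulr_ge0 ?sqr_ge0 // !mulr_ge0 ?ind_ge0.
have hP : (0 <= P%:E)%E by rewrite lee_fin ltW.
apply: le_trans (lee_wpmul2l hP hI); rewrite I -EFinM lee_fin; apply: le_eq.
by rewrite /K; field; rewrite gt_eqF.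
Qed.

End Probe.

(** * Choice of the scale *)

Section Growth.
Context (R : realType) (alpha : R).
Hypothesis alpha0 : 0 < alpha.
Implicit Types (l lam a b : R).
Local Notation del := (del alpha).
Local Notation mu := (mu alpha).
Local Notation tau := (@tau R).

Lemma exp_small b e : 0 < b -> 0 < e -> exists2 l0, 0 <= l0 & forall l, l0 <= l -> expR (- (b * l)) <= e.
Proof.
move=> b0 e0; exists (`|ln e| / b); first by rewrite divr_ge0 // ltW.
move=> l; rewrite ler_pdivrMr // => h.
rewrite -[leRHS](lnK e0) ler_expR.
have := ler_normr (- ln e) (ln e); have := ler_norm (- ln e); rewrite normrN; lra.
Qed.

Lemma exp_dominates a b : 0 < b -> exists2 l0, 0 <= l0 & forall l, l0 <= l -> a * l - b * expR l <= - l.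
Proof.
move=> b0; exists (2 * (`|a| + 1) / b).
  by rewrite divr_ge0 ?(ltW b0) // mulr_ge0 // addr_ge0.
move=> l; rewrite ler_pdivrMr // => h.
have l0 : 0 <= l.
  have : 0 <= l * b by apply: le_trans h; rewrite mulr_ge0 // addr_ge0.
  by rewrite pmulr_lge0.
have h1 := ler_wpM2l (ltW b0) (expR_ge_sqr l0).
have h2 := ler_wpM2r l0 h; have h3 := ler_wpM2r l0 (ler_norm a).
have : b * (l ^+ 2 / 2) = l * b * l / 2 by rewrite expr2; field.
lra.
Qed.

Lemma powR_expR (x y : R) : expR x `^ y = expR (y * x).
Proof. by rewrite /powR gt_eqF ?expR_gt0 // expRK. Qed.

(** With [l = ln lam], each quantity that has to be small is the exponential of a
    linear function of [l], either with negative slope or corrected by a negative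
    multiple of [exp l]. *)
Lemma choose_scale (r th a Y rho e : R) k :
  0 < k%:R / alpha - (r + (1 + th) * (1 + alpha^-1)) -> 0 < k%:R / alpha - th * (1 + alpha^-1) ->
  0 < Y -> 0 < rho -> 0 < e ->
  exists lam, [/\ 2 <= lam, mu lam <= tau lam, 2 * a <= tau lam, Y * del lam <= rho &
   [/\ lam `^ r * mu lam `^ th * mu lam / tau lam <= e,
       lam `^ r * mu lam `^ th * mu lam * expR (- (kap alpha * lam)) <= e,
       lam `^ r * mu lam `^ th * mu lam * del lam ^+ k <= e &
       del lam ^+ k * mu lam `^ th <= e]].
Proof.
move=> b1 b2 Y0 rho0 e0; have k0 := kap_gt0 alpha0.
have ia : 0 < alpha^-1 by rewrite invr_gt0.
pose A := r + (1 + th) * (1 + alpha^-1).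
have [l1 l10 h1] := exp_dominates (1 + alpha^-1) ltr01.
have [l2 l20 h2] := exp_dominates A ltr01.
have [l3 l30 h3] := exp_dominates A k0.
have [l4 l40 h4] := exp_small ia (divr_gt0 rho0 Y0).
have [l5 l50 h5] := exp_small ltr01 e0.
have [l6 l60 h6] := exp_small b1 e0.
have [l7 l70 h7] := exp_small b2 e0.
pose l := 1 + 2 * `|a| + l1 + l2 + l3 + l4 + l5 + l6 + l7.
have a0 : 0 <= `|a| by [].
have {}h1 := h1 l (ltac:(rewrite /l; lra)); have {}h2 := h2 l (ltac:(rewrite /l; lra)).
have {}h3 := h3 l (ltac:(rewrite /l; lra)); have {}h4 := h4 l (ltac:(rewrite /l; lra)).
have {}h5 := h5 l (ltac:(rewrite /l; lra)); have {}h6 := h6 l (ltac:(rewrite /l; lra)).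
have {}h7 := h7 l (ltac:(rewrite /l; lra)).
have la : 1 + 2 * a <= l by have := ler_norm a; rewrite /l; lra.
have lp : 1 <= l by rewrite /l; lra.
move: h1 h2 h3 h4 h5 h6 h7 la lp; move: l; clear l1 l10 l2 l20 l3 l30 l4 l40 l5 l50 l6 l60 l7 l70 => l h1 h2 h3 h4 h5 h6 h7 la lp.
have dE : del (expR l) = expR (- (alpha^-1 * l)) by rewrite delE expRK mulrC.
have mE : mu (expR l) = expR ((1 + alpha^-1) * l).
  by rewrite muE dE -expRN opprK -expRD; congr expR; ring.
have ge1 := expR_ge1Dx l; have ge2 := expR_ge1Dx (expR l).
exists (expR l); split.
- lra.
- rewrite mE tauE ler_expR; lra.
- rewrite tauE; lra.
- by rewrite dE mulrC -ler_pdivlMr.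
- rewrite dE mE tauE !powR_expR -!expRN -!expRM_natl -!expRD; split.
  + apply: le_trans h5; rewrite ler_expR; move: h2; rewrite /A; lra.
  + apply: le_trans h5; rewrite ler_expR; move: h3; rewrite /A; lra.
  + apply: le_trans h6; rewrite ler_expR; lra.
  + apply: le_trans h7; rewrite ler_expR; lra.
Qed.

End Growth.

(** * Upper bounds for the right-hand side *)

Section Assembly.
Context (R : realType) (alpha : R).
Hypothesis alpha0 : 0 < alpha.
Local Notation normc := ComplexField.Normc.normc.
Implicit Types (p xi : R3 R) (lam : R).
Local Notation del := (del alpha).
Local Notation mu := (mu alpha).
Local Notation tau := (@tau R).
Variables (psi chi : R -> R).
Hypotheses (bpsi : bump1 psi) (bchi : bump1 chi) (psi1 : forall x, `|x| <= 2 -> psi x = 1).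
Local Notation probe := (probe alpha psi chi).
Local Notation amp := (amp alpha psi).
Local Notation familyC := (familyC alpha).
Local Notation Zc := (Zc alpha psi).
Local Notation Wc := (Wc alpha psi).
Local Notation wave := (wave chi).

Lemma zero_near_dpsi : zero_near (psi^`())%classic.
Proof.
move=> x x2; rewrite derive1E.
have nx : \near x, cst 1 x = psi x.
  have h : \forall y \near x, `|y| < 2 by apply: (cvgr_lt _ (@norm_continuous _ _ x) _ x2).
  by apply: filterS h => y hy; rewrite psi1 // ltW.
by have [] := near_eq_is_derive nx (is_derive_cst (1 : R) x (1 : R)).
Qed.

Lemma familyC_amp : familyC gen (fun lam p => (amp lam p)%:C).
Proof. by apply: familyC_real; exact: family_gen. Qed.

Lemma familyC_Z : familyC flat Zc.
Proof.
by apply: familyC_pair; apply: family_flat => //; exact: bump_idM.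
Qed.

Lemma familyC_W : familyC far Wc.
Proof.
have bd := bump_derive bpsi; have fd := zero_near_dpsi.
by apply: familyC_pair; apply: family_far => //; [left|right].
Qed.

Lemma shift_le lam xi : 1 + `|xi.2 / tau lam| <= 2 * (1 + `|xi.2 + tau lam|) \/ lam < 1.
Proof.
have [l1|l1] := leP 1 lam; last by right.
left; have t1 := tau_ge1 l1; have t0 := tau_gt0 lam.
have h : `|xi.2 / tau lam| <= 1 + `|xi.2 + tau lam|.
  rewrite normrM normfV (gtr0_norm t0) ler_pdivrMr //.
  have := ler_normB (xi.2 + tau lam) (tau lam); rewrite addrK (gtr0_norm t0) => h.
  apply: le_trans h _; have n0 : 0 <= `|xi.2 + tau lam| by [].
  have := ler_wpM2l n0 t1; lra.
have : 0 <= `|xi.2 + tau lam| by [].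
lra.
Qed.

(** At frequency [xi_t] the two terms in the layer combine into a multiple of
    [(xi_t + tau) / tau]: the loss of one power of [1 + |xi_t + tau|] is compensated
    by a factor [1 / tau]. *)
Lemma rhs_Lbar s r N th : 0 <= s -> (1 <= N)%N -> 2 * `|r| <= N%:R -> 0 < th -> th <= 1 ->
  exists2 C, 0 <= C & forall lam, 2 <= lam -> mu lam <= tau lam ->
  (log_sobolev_normsq r s (Lbar alpha (probe lam N)) <=
   (C * (tau lam `^ s * del lam * (lam `^ r * mu lam `^ th * mu lam / tau lam +
      lam `^ r * mu lam `^ th * mu lam * expR (- (kap alpha * lam)))) ^+ 2)%:E)%E.
Proof.
move=> s0 N1 rN th0 th1.
have [C C0 H] := normsq_bound alpha0 bchi (familyC_conj familyC_Z) (familyC_conj familyC_W) s0 N1 rN th0 th1.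
exists (C * (alpha / 2 + 2^-1) ^+ 2); first by rewrite mulr_ge0 ?sqr_ge0.
move=> lam l2 mt; have l1 : 1 <= lam by lra.
have d0 := del_gt0 alpha lam; have m0 := mu_gt0 alpha l1; have t0 := tau_gt0 lam.
have a20 : 0 <= alpha / 2 by rewrite divr_ge0 // ltW.
have a1 : 0 <= alpha / 2 * mu lam / tau lam by exact: divr_ge0 (mulr_ge0 a20 (ltW m0)) (ltW t0).
have a2 : 0 <= (2 * del lam)^-1 by rewrite invr_ge0 mulr_ge0 // ltW.
apply: (le_trans (H lam _ _ _ l2 mt a1 a2 _)).
  move=> xi; rewrite (_ : Lbar alpha (probe lam N) = fun p =>
     (- (alpha / 2 * mu lam)%:C) * ((Zc lam p)^* * wave lam N (ct p)) +
     ((2 * del lam)^-1)%:C * ((Wc lam p)^* * wave lam N (ct p)) +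
     ((alpha / 2 * mu lam)%:C * 'i%C) * ((Zc lam p)^* * wave lam N.+1 (ct p))); last first.
    by apply/funext => p; exact: (Lbar_probe alpha0 bpsi bchi).
  have h := fourier3 alpha0 bchi (- (alpha / 2 * mu lam)%:C) (((2 * del lam)^-1)%:C)
    ((alpha / 2 * mu lam)%:C * 'i%C) xi N (familyC_conj familyC_Z) (familyC_conj familyC_W) l1.
  apply: le_trans h _; apply: ler_wpM2l.
    by apply: exprn_ge0; apply: divr_ge0 => //; exact: ltW.
  rewrite [leRHS]mulrDr; apply: lerD.
    rewrite [leRHS]mulrA; apply: ler_wpM2r; first exact: FTc_ge0.
    have -> : - (alpha / 2 * mu lam)%:C + (alpha / 2 * mu lam)%:C * 'i%C * ('i%C * (xi.2 / tau lam)%:C) =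
       (- (alpha / 2 * mu lam / tau lam * (xi.2 + tau lam)))%:C.
      by apply: eqC => /=; field; rewrite gt_eqF.
    rewrite normc_real normrN normrM (ger0_norm a1) mulrC ler_wpM2r // lerDr //.
  rewrite [leRHS]mulrA; apply: ler_wpM2r; first exact: FTc_ge0.
  by rewrite normc_real (ger0_norm a2) ler_peMl // lerDl.
rewrite lee_fin -[leRHS]mulrA ler_wpM2l // -[leRHS]exprMn.
have e0 := expR_ge0 (- (kap alpha * lam)).
have X0 : 0 <= lam `^ r * mu lam `^ th by rewrite mulr_ge0 ?powR_ge0.
have T0 := powR_ge0 (tau lam) s.
rewrite /Dn; move: (lam `^ r) (mu lam `^ th) (tau lam `^ s) (expR _) X0 T0 e0 => A B T e X0 T0 e0.
have P1 : 0 <= T * del lam * (A * B * mu lam / tau lam).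
  by apply: mulr_ge0; [apply: mulr_ge0 => //; exact: ltW|apply: divr_ge0; [apply: mulr_ge0 => //|]; exact: ltW].
have P2 : 0 <= T * del lam * (A * B * mu lam * e).
  by apply: mulr_ge0; [apply: mulr_ge0 => //; exact: ltW|apply: mulr_ge0 => //; apply: mulr_ge0 => //; exact: ltW].
have -> : T * A * (alpha / 2 * mu lam / tau lam * del lam + (2 * del lam)^-1 * (e * del lam ^+ 2 * mu lam)) * B =
   alpha / 2 * (T * del lam * (A * B * mu lam / tau lam)) + 2^-1 * (T * del lam * (A * B * mu lam * e)).
  by field; rewrite !gt_eqF.
rewrite [T * del lam * (_ + _)]mulrDr; move: P1 P2; move: (T * _ * _) (T * _ * _) => x y x0 y0.
have h1 : 0 <= alpha / 2 * x by rewrite mulr_ge0.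
have h2 : 0 <= alpha / 2 * y by rewrite mulr_ge0.
apply: lerXn2r; rewrite ?nnegrE; lra.
Qed.

(** The two terms in the layer add up, to size [mu], and [zbar^k] contributes
    [del^k]. *)
Lemma rhs_L s r N (th : R) k : 0 <= s -> (1 <= N)%N -> 2 * `|r| <= N%:R -> 0 < th -> th <= 1 ->
  exists2 C, 0 <= C & forall lam, 2 <= lam -> mu lam <= tau lam ->
  (log_sobolev_normsq r s (fun p => ((zcoord p)^* ^+ k * L alpha (probe lam N) p)%R) <=
   (C * (tau lam `^ s * del lam * (lam `^ r * mu lam `^ th * mu lam * del lam ^+ k +
      lam `^ r * mu lam `^ th * mu lam * expR (- (kap alpha * lam)))) ^+ 2)%:E)%E.
Proof.
move=> s0 N1 rN th0 th1.
have [C C0 H] := normsq_bound alpha0 bchi (familyC_zbar k familyC_Z) (familyC_zbar k familyC_W) s0 N1 rN th0 th1.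
exists (C * (alpha + 2^-1) ^+ 2); first by rewrite mulr_ge0 ?sqr_ge0.
move=> lam l2 mt; have l1 : 1 <= lam by lra.
have d0 := del_gt0 alpha lam; have m0 := mu_gt0 alpha l1; have t0 := tau_gt0 lam.
have dk0 : 0 <= del lam ^+ k by rewrite exprn_ge0 // ltW.
have dk1 : del lam ^+ k <= 1 by apply: exprn_ile1 => //; [exact: ltW|exact: del_le1].
have a20 : 0 <= alpha / 2 by rewrite divr_ge0 // ltW.
have a1 : 0 <= del lam ^+ k * (alpha * mu lam) by exact: mulr_ge0 dk0 (mulr_ge0 (ltW alpha0) (ltW m0)).
have a2 : 0 <= del lam ^+ k * (2 * del lam)^-1 by rewrite mulr_ge0 // invr_ge0 mulr_ge0 // ltW.
apply: (le_trans (H lam _ _ _ l2 mt a1 a2 _)).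
  pose dC : R[i] := (del lam ^+ k)%:C.
  move=> xi; rewrite (_ : (fun p => (zcoord p)^* ^+ k * L alpha (probe lam N) p) = fun p =>
     (- (dC * (alpha / 2 * mu lam)%:C)) * ((zbar alpha lam p ^+ k * Zc lam p) * wave lam N (ct p)) +
     (dC * ((2 * del lam)^-1)%:C) * ((zbar alpha lam p ^+ k * Wc lam p) * wave lam N (ct p)) +
     (- (dC * (alpha / 2 * mu lam)%:C * 'i%C)) * ((zbar alpha lam p ^+ k * Zc lam p) * wave lam N.+1 (ct p))); last first.
    apply/funext => p; rewrite (L_probe alpha0 bpsi bchi) // (zbarE alpha lam p) exprMn -rmorphXn /= -/dC.
    ring.
  have h := fourier3 alpha0 bchi (- (dC * (alpha / 2 * mu lam)%:C)) (dC * ((2 * del lam)^-1)%:C)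
    (- (dC * (alpha / 2 * mu lam)%:C * 'i%C)) xi N (familyC_zbar k familyC_Z) (familyC_zbar k familyC_W) l1.
  apply: le_trans h _; apply: ler_wpM2l.
    by apply: exprn_ge0; apply: divr_ge0 => //; exact: ltW.
  rewrite [leRHS]mulrDr; apply: lerD.
    rewrite [leRHS]mulrA; apply: ler_wpM2r; first exact: FTc_ge0.
    have -> : - (dC * (alpha / 2 * mu lam)%:C) + - (dC * (alpha / 2 * mu lam)%:C * 'i%C) * ('i%C * (xi.2 / tau lam)%:C) =
       (- (del lam ^+ k * (alpha / 2 * mu lam) * (1 - xi.2 / tau lam)))%:C.
      by rewrite /dC; apply: eqC => /=; ring.
    have b1 : 0 <= del lam ^+ k * (alpha / 2 * mu lam) by exact: mulr_ge0 dk0 (mulr_ge0 a20 (ltW m0)).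
    rewrite normc_real normrN normrM (ger0_norm b1).
    have hs : 1 + `|xi.2 / tau lam| <= 2 * (1 + `|xi.2 + tau lam|).
      by have [//|] := shift_le lam xi; rewrite ltNge l1.
    have h1 : `|1 - xi.2 / tau lam| <= 2 * (1 + `|xi.2 + tau lam|).
      by apply: le_trans hs; apply: le_trans (ler_normB _ _) _; rewrite normr1.
    apply: le_trans (ler_wpM2l b1 h1) _; apply: le_eq; by field.
  rewrite [leRHS]mulrA; apply: ler_wpM2r; first exact: FTc_ge0.
  by rewrite normcM /dC !normc_real (ger0_norm dk0) ger0_norm ?ler_peMl ?lerDl // invr_ge0 mulr_ge0 // ltW.
rewrite lee_fin -[leRHS]mulrA ler_wpM2l // -[leRHS]exprMn.
have e0 := expR_ge0 (- (kap alpha * lam)).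
have X0 : 0 <= lam `^ r * mu lam `^ th by rewrite mulr_ge0 ?powR_ge0.
have T0 := powR_ge0 (tau lam) s.
rewrite /Dn; move: dk0 dk1; move: (del lam ^+ k) (lam `^ r) (mu lam `^ th) (tau lam `^ s) (expR _) X0 T0 e0 => D A B T e X0 T0 e0 D0 D1.
have P1 : 0 <= T * del lam * (A * B * mu lam * D).
  by apply: mulr_ge0; [apply: mulr_ge0 => //; exact: ltW|apply: mulr_ge0 => //; apply: mulr_ge0 => //; exact: ltW].
have P2 : 0 <= T * del lam * (A * B * mu lam * e).
  by apply: mulr_ge0; [apply: mulr_ge0 => //; exact: ltW|apply: mulr_ge0 => //; apply: mulr_ge0 => //; exact: ltW].
have -> : T * A * (D * (alpha * mu lam) * del lam + D * (2 * del lam)^-1 * (e * del lam ^+ 2 * mu lam)) * B =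
   alpha * (T * del lam * (A * B * mu lam * D)) + 2^-1 * (D * (T * del lam * (A * B * mu lam * e))).
  by field; rewrite !gt_eqF.
rewrite [T * del lam * (_ + _)]mulrDr; move: P1 P2; move: (T * _ * _) (T * _ * _) => x y x0 y0.
have h1 : 0 <= alpha * x by rewrite mulr_ge0 // ltW.
have h2 : 0 <= alpha * y by rewrite mulr_ge0 // ltW.
have h3 : D * x <= x by rewrite ler_piMl.
have h4 : 0 <= D * x by rewrite mulr_ge0.
apply: lerXn2r; rewrite ?nnegrE; lra.
Qed.

(** The factor [tau^(1/2-s)] is at most 1 because [s >= 1/2]. *)
Lemma rhs_z s N (th : R) k : 2^-1 <= s -> (1 <= N)%N -> 0 < th -> th <= 1 ->
  exists2 C, 0 <= C & forall lam, 2 <= lam -> mu lam <= tau lam ->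
  (sobolev_normsq (2^-1)%R (fun p => ((zcoord p)^* ^+ k * probe lam N p)%R) <=
   (C * (tau lam `^ s * del lam * (del lam ^+ k * mu lam `^ th)) ^+ 2)%:E)%E.
Proof.
move=> s0 N1 th0 th1.
have h20 : 0 <= (2^-1 : R) by [].
have rN : 2 * `|0 : R| <= N%:R by rewrite normr0 mulr0.
have [C C0 H] := normsq_bound alpha0 bchi (familyC_zbar k familyC_amp) (familyC_zbar k familyC_amp) h20 N1 rN th0 th1.
exists C => // lam l2 mt; have l1 : 1 <= lam by lra.
have d0 := del_gt0 alpha lam; have m0 := mu_gt0 alpha l1; have t0 := tau_gt0 lam.
have dk0 : 0 <= del lam ^+ k by rewrite exprn_ge0 // ltW.
have -> (v : R3 R -> R[i]) : sobolev_normsq 2^-1 v = log_sobolev_normsq 0 2^-1 v.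
  rewrite /sobolev_normsq /log_sobolev_normsq; congr multiplier_normsq.
  by apply/funext => xi; rewrite /logLambdaS powRr0 mulr1.
apply: (le_trans (H lam _ _ _ l2 mt dk0 (lexx 0) _)).
  pose dC : R[i] := (del lam ^+ k)%:C.
  move=> xi; rewrite (_ : (fun p => (zcoord p)^* ^+ k * probe lam N p) = fun p =>
     dC * ((zbar alpha lam p ^+ k * (amp lam p)%:C) * wave lam N (ct p)) +
     0 * ((zbar alpha lam p ^+ k * (amp lam p)%:C) * wave lam N (ct p)) +
     0 * ((zbar alpha lam p ^+ k * (amp lam p)%:C) * wave lam N.+1 (ct p))); last first.
    apply/funext => p; rewrite probeE (zbarE alpha lam p) exprMn -rmorphXn /= -/dC.
    ring.
  have h := fourier3 alpha0 bchi dC 0 0 xi N (familyC_zbar k familyC_amp) (familyC_zbar k familyC_amp) l1.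
  apply: le_trans h _; apply: ler_wpM2l.
    by apply: exprn_ge0; apply: divr_ge0 => //; exact: ltW.
  have n0 : normc (0 : R[i]) = 0 by rewrite -[0]/((0 : R)%:C) normc_real normr0.
  rewrite n0 !mul0r !addr0 /dC normc_real (ger0_norm dk0).
  rewrite ler_peMl ?lerDl //; first by rewrite mulr_ge0 ?FTc_ge0.
have tt : tau lam `^ 2^-1 <= tau lam `^ s by rewrite ler_powR // tau_ge1.
rewrite lee_fin ler_wpM2l // powRr0 mulr1 mul0r addr0 /Dn.
have B0 := powR_ge0 (mu lam) th; have T0 := powR_ge0 (tau lam) 2^-1.
have q0 : 0 <= del lam ^+ k * del lam * mu lam `^ th by rewrite mulr_ge0 // mulr_ge0 // ltW.
have h := ler_wpM2r q0 tt.
have e1 : tau lam `^ 2^-1 * (del lam ^+ k * del lam) * mu lam `^ th = tau lam `^ 2^-1 * (del lam ^+ k * del lam * mu lam `^ th) by rewrite -mulrA.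
have e2 : tau lam `^ s * del lam * (del lam ^+ k * mu lam `^ th) = tau lam `^ s * (del lam ^+ k * del lam * mu lam `^ th) by ring.
rewrite e1 e2; apply: lerXn2r => //; rewrite nnegrE mulr_ge0 ?powR_ge0 //.
Qed.

End Assembly.

(** * Conclusion *)

(** If [r] were smaller than the bound by [eta], then for [theta] small enough in
    terms of [eta] and [alpha] every term of the right-hand side, divided by
    [(tau^s del)^2], would tend to 0 as [lam] grows, while the left-hand side stays
    bounded below. *)
Lemma log_estimate_exponent (R : realType) (alpha s r : R) (k : nat) (zeta0 zeta1 : R3 R -> R) :
  0 < alpha -> 2^-1 <= s -> (1 <= k)%N -> cutoff zeta0 -> prec zeta0 zeta1 ->
  log_estimate alpha s r k zeta0 zeta1 -> (k%:R - (alpha + 1)) / alpha <= r.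
Proof.
move=> alpha0 s2 k1 cz pz [C C0 HC]; rewrite leNgt; apply/negP => rk.
have s0 : 0 <= s by lra.
have [psi [chi [Y [rho [t0 [[spsi Y0 zpsi psi1 psi0] [schi t00 zchi chi1 chi0] rho0 hz]]]]]] := cutoff_bumps cz.
have rt0 : 0 < rho / 2 by rewrite divr_gt0.
have bpsi : bump1 psi by exact: (bump1_psi spsi Y0 zpsi).
have bchi : bump1 chi by exact: (bump1_chi schi rt0 zchi).
have [N N1 rN] : exists2 N, (1 <= N)%N & 2 * `|r| <= N%:R.
  exists (Num.bound (2 * `|r|)).+1 => //.
  have h : 2 * `|r| < (Num.bound (2 * `|r|))%:R by apply: archi_boundP; rewrite mulr_ge0.
  by rewrite -natr1; lra.
pose eta := (k%:R - (alpha + 1)) / alpha - r.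
have eta0 : 0 < eta by rewrite subr_gt0.
(* [th * (1 + 1 / alpha) = m / (2 * alpha)] is at most half of [eta] and half of
   [1 / alpha], which are the margins available in [c1] and [c2]. *)
pose m := Num.min 1 (eta * alpha).
have m0 : 0 < m by rewrite lt_min ltr01 mulr_gt0.
have m1 : m <= 1 by rewrite ge_min lexx.
have me : m <= eta * alpha by rewrite ge_min lexx orbT.
pose th := m / (2 * (alpha + 1)).
have a1 : 0 < alpha + 1 by lra.
have th0 : 0 < th by rewrite divr_gt0 // mulr_gt0.
have th1 : th <= 1 by rewrite ler_pdivrMr ?mulr_gt0 // mul1r; lra.
have thE : th * (1 + alpha^-1) = m / 2 / alpha by rewrite /th; field; rewrite !gt_eqF.
have c1 : 0 < k%:R / alpha - (r + (1 + th) * (1 + alpha^-1)).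
  have -> : k%:R / alpha - (r + (1 + th) * (1 + alpha^-1)) = (eta * alpha - m / 2) / alpha.
    by rewrite mulrDl mul1r thE /eta; field; rewrite gt_eqF.
  by apply: divr_gt0 => //; lra.
have c2 : 0 < k%:R / alpha - th * (1 + alpha^-1).
  rewrite thE -mulrBl; apply: divr_gt0 => //.
  have : (1 : R) <= k%:R by rewrite ler1n.
  lra.
have [c [a [c0 a0 Hlow]]] := probe_lower alpha0 spsi Y0 zpsi psi1 psi0 schi rt0 zchi t00 chi1 chi0 N s0.
have [C1 C10 H1] := rhs_Lbar alpha0 bpsi bchi psi1 s0 N1 rN th0 th1.
have [C2 C20 H2] := rhs_L alpha0 bpsi bchi psi1 k s0 N1 rN th0 th1.
have [C3 C30 H3] := rhs_z alpha0 bpsi bchi k s2 N1 th0 th1.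
pose K := C * (4 * C1 + 4 * C2 + C3).
have K0 : 0 <= K by apply: mulr_ge0; [exact: ltW|lra].
(* Any [e <= 1] with [K * e < c] would do. *)
pose e := c / (2 * (K + c + 1)).
have S0 : 0 < 2 * (K + c + 1) by lra.
have e0 : 0 < e by rewrite divr_gt0.
have e1 : e <= 1 by rewrite ler_pdivrMr // mul1r; lra.
have eK : K * e < c by rewrite /e mulrA ltr_pdivrMr //; have := mulr_gt0 c0 c0; have := mulr_ge0 K0 (ltW c0); lra.
have [lam [l2 mt ta Yr [X1 X2 X3 X4]]] := choose_scale alpha0 a c1 c2 Y0 rt0 e0.
have l1 : 1 <= lam by lra.
have hin p : inbox (Y * del alpha lam) (rho / 2) p -> zeta0 p = 1.
  move=> [h1 h2 h3]; apply: hz; split => //; exact: le_trans Yr.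
have hin1 p : inbox (Y * del alpha lam) (rho / 2) p -> zeta1 p = 1.
  move=> hp; apply: pz; apply: subset_closure => /=.
  by rewrite hin // oner_eq0.
have := HC _ (test_probe alpha0 spsi zpsi schi rt0 zchi lam N).
rewrite (cut_id hin (fun p np => probe_off zpsi schi rt0 zchi N np)).
rewrite (cut_id hin1 (fun p np => (L_off alpha0 spsi Y0 zpsi schi rt0 zchi N l1 np).2)).
rewrite (@cut_id _ zeta1 (fun p => (zcoord p)^* ^+ k * L alpha (probe alpha psi chi lam N) p) _ hin1); last first.
  by move=> p np; rewrite (L_off alpha0 spsi Y0 zpsi schi rt0 zchi N l1 np).1 mulr0.
have h1 := H1 lam l2 mt; have h2 := H2 lam l2 mt; have h3 := H3 lam l2 mt.
have hC : (0 <= C%:E)%E by rewrite lee_fin ltW.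
move=> est.
have := le_trans (Hlow lam l1 ta) (le_trans est (lee_wpmul2l hC (leeD (leeD h1 h2) h3))).
rewrite -!EFinD -EFinM lee_fin; apply/negP; rewrite -ltNge.
move: X1 X2 X3 X4.
have X0 : 0 <= lam `^ r * mu alpha lam `^ th * mu alpha lam.
  exact: mulr_ge0 (mulr_ge0 (powR_ge0 _ _) (powR_ge0 _ _)) (ltW (mu_gt0 alpha l1)).
have z1 : 0 <= lam `^ r * mu alpha lam `^ th * mu alpha lam / tau lam by rewrite divr_ge0 // ltW // tau_gt0.
have z2 : 0 <= lam `^ r * mu alpha lam `^ th * mu alpha lam * expR (- (kap alpha * lam)) by rewrite mulr_ge0 ?expR_ge0.
have dk0 : 0 <= del alpha lam ^+ k by rewrite exprn_ge0 // ltW // del_gt0.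
have z3 : 0 <= lam `^ r * mu alpha lam `^ th * mu alpha lam * del alpha lam ^+ k by rewrite mulr_ge0.
have z4 : 0 <= del alpha lam ^+ k * mu alpha lam `^ th by rewrite mulr_ge0 ?powR_ge0.
move: z1 z2 z3 z4.
move: (lam `^ r * mu alpha lam `^ th * mu alpha lam / tau lam)
  (lam `^ r * mu alpha lam `^ th * mu alpha lam * expR (- (kap alpha * lam)))
  (lam `^ r * mu alpha lam `^ th * mu alpha lam * del alpha lam ^+ k)
  (del alpha lam ^+ k * mu alpha lam `^ th) => x1 x2 x3 x4 z1 z2 z3 z4 X1 X2 X3 X4.
have u0 : 0 < tau lam `^ s * del alpha lam by rewrite mulr_gt0 ?powR_gt0 ?tau_gt0 ?del_gt0.
move: u0; move: (tau lam `^ s * del alpha lam) => u u0.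
have sq (x y : R) : 0 <= x -> x <= y -> x ^+ 2 <= y ^+ 2.
  by move=> x0 xy; apply: lerXn2r; rewrite ?nnegrE //; exact: le_trans xy.
have q1 : (x1 + x2) ^+ 2 <= (2 * e) ^+ 2 by apply: sq; lra.
have q2 : (x3 + x2) ^+ 2 <= (2 * e) ^+ 2 by apply: sq; lra.
have q3 : x4 ^+ 2 <= e ^+ 2 by apply: sq.
have ee : e ^+ 2 <= e by rewrite expr2 ler_piMl // ltW.
have p1 := ler_wpM2l C10 q1; have p2 := ler_wpM2l C20 q2; have p3 := ler_wpM2l C30 q3.
have -> : C * (C1 * (u * (x1 + x2)) ^+ 2 + C2 * (u * (x3 + x2)) ^+ 2 + C3 * (u * x4) ^+ 2) =
  u ^+ 2 * (C * (C1 * (x1 + x2) ^+ 2 + C2 * (x3 + x2) ^+ 2 + C3 * x4 ^+ 2)) by ring.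
rewrite [c * _]mulrC ltr_pM2l ?exprn_gt0 //.
apply: le_lt_trans eK; apply: le_trans (ler_wpM2l K0 ee); rewrite /K -mulrA ler_wpM2l ?(ltW C0) //.
have e4 : (2 * e) ^+ 2 = 4 * e ^+ 2 by ring.
rewrite e4 in p1 p2; lra.
Qed.

Theorem proposition1p4 (R : realType) :
  exists2 c : R, 0 < c &
    forall (alpha s r : R) (k : nat) (zeta0 zeta1 : R * R * R -> R),
      0 < alpha -> 2^-1 <= s -> (1 <= k)%N ->
      cutoff zeta0 -> cutoff zeta1 -> prec zeta0 zeta1 ->
      log_estimate alpha s r k zeta0 zeta1 ->
      c * ((k%:R - (alpha + 1)) / alpha) <= r.
Proof.
exists 1 => // alpha s r k z0 z1 alpha0 s2 k1 c0 _ pz est.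
by rewrite mul1r; exact: log_estimate_exponent est.
Qed.
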